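(* Let $G$ be a finite group and let $R$ be a commutative ring such that $|G|$ is a unit in $R$. If $\underline{R}$ satisfies the Hilbert basis theorem, then the functor $$\mathrm{ev}_{G/e} : \mathsf{Grp}^{\mathrm{f\acute{e}t\text{-}aff}}_{\underline{R}} \rightarrow (\mathsf{Grp}^{\mathrm{f\acute{e}t\text{-}aff}}_{R})^{BG}$$ is an equivalence of categories with inverse induced by $\mathrm{FP}$.
   Context: Mackey, (commutative) Green and Tambara functors for a finite group $G$ have their standard meaning: a $G$-Tambara functor $k$ has commutative rings $k(X)$ for finite $G$-sets $X$, with restrictions $\mathrm{Res}$, transfers $\mathrm{Tr}$ and norms $\mathrm{Nm}$. A module over a Tambara functor is a module over its underlying Green functor. A $k$-algebra is a Tambara functor $S$ with a morphism $k \to S$. $\boxtimes_k$ is the relative box product over $k$. A $k$-algebra is finite if it is finitely generated as a $k$-module. For a ring $S$ with $G$-action, $\mathrm{FP}(S)$ is the fixed-point Tambara functor, $\mathrm{FP}(S)(G/H) = S^H$, with restrictions the inclusions and transfers and norms given by sums and products over cosets. $\underline{R}$ is the constant Tambara functor, i.e. $\mathrm{FP}(R)$ with trivial action. Étale. A $k$-module $M$ is flat if $M \boxtimes_k -$ is exact on $k$-modules. The free polynomial $k$-algebra on a generator in level $X$ ($X$ a finite $G$-set) is the $k$-algebra representing $S \mapsto S(X)$. A $k$-algebra is finitely presented if it is the coequalizer of a pair of maps between free polynomial $k$-algebras on finitely many generators. A Tambara ideal is the (levelwise) kernel of a morphism of Tambara functors. For a Tambara ideal $I$, $I^{>1}$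 is the sub-ideal of $I$ generated by all nontrivial norms (including products) of elements of $I$: in level $G/H$ by $I(G/H)^2$ together with the images of all norms $I(G/K) \to I(G/H)$ for $K$ conjugate to a proper subgroup of $H$. For a $k$-algebra $S$ with $I = \ker(S \boxtimes_k S \to S)$ (multiplication), the genuine Kähler differentials are $\Omega^{1,\mathrm{Tamb}}_{S/k} := I/I^{>1}$. A morphism $k \to S$ is formally étale if $S$ is flat as a $k$-module and $\Omega^{1,\mathrm{Tamb}}_{S/k} = 0$; it is étale if it is moreover finitely presented. A Tambara functor $k$ satisfies the Hilbert basis theorem if every (Tambara) ideal of every free polynomial $k$-algebra on finitely many generators is finitely generated. Group schemes. A finite affine étale group scheme over a Tambara functor $k$ is a representable functor $\mathrm{Hom}_{k\text{-}\mathrm{Alg}}(S,-) : k\text{-}\mathrm{Alg} \to \mathsf{Grp}$ with $k \to S$ finite and étale. The category of these, with natural transformations as morphisms, is $\mathsf{Grp}^{\mathrm{f\acute{e}t\text{-}aff}}_k$. Over an ordinary ring the same definition is used (the case of the trivial group). For a category $\mathcal{C}$, $\mathcal{C}^{BG}$ is the category of objects of $\mathcal{C}$ with a $G$-action and $G$-equivariant morphisms. The functor $\mathrm{ev}_{G/e}$ sends the group scheme represented by $S$ to the one represented by the ring $S(G/e)$ (whose cogroup structure is induced from that of $S$ via $(S \boxtimes_k S)(G/e) \cong S(G/e) \otimes_{k(G/e)} S(G/e)$), with $G$ acting through the Weyl action on $S(G/e)$. The inverse induced by $\mathrm{FP}$ sends the group scheme with $G$-action represented by $L$ (a ring with $G$-action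 by cogroup automorphisms) to the group scheme represented by $\mathrm{FP}(L)$. *)

(* Defs.v *)
From HB Require Import structures.
From mathcomp Require Import all_boot all_fingroup all_algebra.
From mathcomp Require Import boolp.

Set Implicit Arguments.
Unset Strict Implicit.
Unset Printing Implicit Defensive.
Import GRing.Theory.
Local Open Scope ring_scope.

(* Rings are comPzRingType: a level of a Tambara functor may be the zero ring. *)

Record category := Category {
  cob :> Type;
  chom : cob -> cob -> Type;
  cidm : forall A, chom A A;
  ccomp : forall A B C, chom B C -> chom A B -> chom A C;
  ccomp1m : forall A B (f : chom A B), ccomp (cidm B) f = f;
  ccompm1 : forall A B (f : chom A B), ccomp f (cidm A) = f;
  ccompA : forall A B C D (h : chom C D) (g : chom B C) (f : chom A B),
    ccomp h (ccomp g f) = ccomp (ccomp h g) f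
}.
Arguments chom {c} _ _.
Arguments cidm {c} A.
Arguments ccomp {c A B C} _ _.

Notation "g \oc f" := (ccomp g f) (at level 50, left associativity).

Record ciso (C : category) (A B : C) := CIso {
  cito :> chom A B;
  cifrom : chom B A;
  citoK : cifrom \oc cito = cidm A;
  cifromK : cito \oc cifrom = cidm B
}.

Record functor (C D : category) := Functor {
  fob :> C -> D;
  fmap : forall A B, chom A B -> chom (fob A) (fob B);
  fmap1 : forall A, fmap (cidm A) = cidm (fob A);
  fmapM : forall A B E (g : chom B E) (f : chom A B),
    fmap (g \oc f) = fmap g \oc fmap f
}.

Definition fid (C : category) : functor C C :=
  @Functor C C id (fun _ _ f => f) (fun _ => erefl) (fun _ _ _ _ _ => erefl).

Section FunctorComp.
Variables (C D E : category) (G : functor D E) (F : functor C D).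

Lemma fcomp1 A : fmap G (fmap F (cidm A)) = cidm (G (F A)).
Proof. by rewrite !fmap1. Qed.

Lemma fcompM A B A' (g : chom B A') (f : chom A B) :
  fmap G (fmap F (g \oc f)) = fmap G (fmap F g) \oc fmap G (fmap F f).
Proof. by rewrite !fmapM. Qed.

Definition fcomp : functor C E :=
  @Functor C E (fun A => G (F A)) (fun _ _ f => fmap G (fmap F f)) fcomp1 fcompM.
End FunctorComp.

Definition nat_isomorphic (C D : category) (F F' : functor C D) : Prop :=
  exists t : forall A, ciso (F A) (F' A),
    forall A B (f : chom A B), t B \oc fmap F f = fmap F' f \oc t A.

Definition quasi_inverse (C D : category) (F : functor C D) (F' : functor D C) :
    Prop :=
  nat_isomorphic (fcomp F' F) (fid C) /\ nat_isomorphic (fcomp F F') (fid D).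

Section BG.
Variables (gT : finGroupType) (C : category).

Record bg_ob := BGOb {
  bg_val :> C;
  bg_act : gT -> chom bg_val bg_val;
  bg_act1 : bg_act 1%g = cidm bg_val;
  bg_actM : forall g h, bg_act (g * h)%g = bg_act g \oc bg_act h
}.

Record bg_hom (A B : bg_ob) := BGHom {
  bgh_val :> chom A B;
  bgh_eq : forall g, bgh_val \oc bg_act A g = bg_act B g \oc bgh_val
}.

Lemma bg_hom_ext A B (f g : bg_hom A B) : bgh_val f = bgh_val g -> f = g.
Proof.
case: f g => [f hf] [g hg] /= e; case: _ / e hg => hg.
by rewrite (Prop_irrelevance hf hg).
Qed.

Lemma bg_id_eq (A : bg_ob) g : cidm A \oc bg_act A g = bg_act A g \oc cidm A.
Proof. by rewrite ccomp1m ccompm1. Qed.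

Lemma bg_comp_eq A B D (u : bg_hom B D) (v : bg_hom A B) g :
  (u \oc v) \oc bg_act A g = bg_act D g \oc (u \oc v).
Proof. by rewrite -ccompA bgh_eq ccompA bgh_eq ccompA. Qed.

Definition BG : category.
Proof.
refine (@Category bg_ob bg_hom (fun A => BGHom (@bg_id_eq A))
  (fun A B D u v => BGHom (bg_comp_eq u v)) _ _ _).
- by move=> A B f; apply: bg_hom_ext; rewrite /= ccomp1m.
- by move=> A B f; apply: bg_hom_ext; rewrite /= ccompm1.
- by move=> A B D E h g f; apply: bg_hom_ext; rewrite /= ccompA.
Defined.
End BG.

Record group_law (T : Type) := GroupLaw {
  gop : T -> T -> T;
  gone : T;
  ginv : T -> T;
  gopA : associative gop;
  gop1 : left_id gone gop;
  gopV : left_inverse gone ginv gop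
}.

Section GrpCat.
Variables (C : category) (P : C -> Prop).

(* The functor chom S - with a lift to groups, for a representing object S
   satisfying P. *)
Record grp_ob := GrpOb {
  grep :> C;
  grepP : P grep;
  glaw : forall T : C, group_law (chom grep T);
  glaw_nat : forall (T T' : C) (f : chom T T') (a b : chom grep T),
    f \oc gop (glaw T) a b = gop (glaw T') (f \oc a) (f \oc b)
}.

Record grp_hom (A B : grp_ob) := GrpHom {
  gnt :> forall T : C, chom A T -> chom B T;
  gnt_nat : forall (T T' : C) (f : chom T T') (a : chom A T),
    gnt (f \oc a) = f \oc gnt a;
  gnt_mul : forall (T : C) (a b : chom A T),
    gnt (gop (glaw A T) a b) = gop (glaw B T) (gnt a) (gnt b)
}.

Lemma grp_hom_ext A B (f g : grp_hom A B) :
  (forall (T : C) (a : chom A T), f T a = g T a) -> f = g.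
Proof.
case: f g => [f hf hf'] [g hg hg'] /= e.
have {}e : f = g.
  by apply: functional_extensionality_dep => T; apply: funext => a; exact: e.
case: _ / e hg hg' => hg hg'.
by rewrite (Prop_irrelevance hf hg) (Prop_irrelevance hf' hg').
Qed.

Definition grp_id A : grp_hom A A :=
  @GrpHom A A (fun _ a => a) (fun _ _ _ _ => erefl) (fun _ _ _ => erefl).

Lemma grp_comp_nat A B D (u : grp_hom B D) (v : grp_hom A B)
    (T T' : C) (f : chom T T') (a : chom A T) :
  u T' (v T' (f \oc a)) = f \oc u T (v T a).
Proof. by rewrite !gnt_nat. Qed.

Lemma grp_comp_mul A B D (u : grp_hom B D) (v : grp_hom A B)
    (T : C) (a b : chom A T) :
  u T (v T (gop (glaw A T) a b)) = gop (glaw D T) (u T (v T a)) (u T (v T b)).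
Proof. by rewrite !gnt_mul. Qed.

Definition grp_comp A B D (u : grp_hom B D) (v : grp_hom A B) : grp_hom A D :=
  GrpHom (@grp_comp_nat A B D u v) (@grp_comp_mul A B D u v).

Definition GrpCat : category.
Proof.
by refine (@Category grp_ob grp_hom grp_id grp_comp _ _ _) => *;
  apply: grp_hom_ext.
Defined.

(* The morphism of representing objects underlying a transformation. *)
Definition yoneda (A B : grp_ob) (f : grp_hom A B) : chom B A := f A (cidm A).

Lemma yonedaE A B (f : grp_hom A B) T (a : chom A T) : f T a = a \oc yoneda f.
Proof. by rewrite /yoneda -gnt_nat ccompm1. Qed.

Lemma yoneda_comp A B D (u : grp_hom B D) (v : grp_hom A B) :
  yoneda (grp_comp u v) = yoneda v \oc yoneda u.
Proof. exact: (yonedaE u (yoneda v)). Qed.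
End GrpCat.

Lemma rmorphism_ext (A B : comPzRingType) (f g : {rmorphism A -> B}) :
  f =1 g -> f = g.
Proof.
case: f g => [f cf] [g cg] /= /funext e; case: _ / e cg => cg.
case: cf cg => [[a] [b]] [[a'] [b']].
by rewrite (Prop_irrelevance a a') (Prop_irrelevance b b').
Qed.

Definition rscal (A B : comPzRingType) (f : {rmorphism A -> B}) : Type := B.

Section RestrictScalars.
Variables (A B : comPzRingType) (f : {rmorphism A -> B}).

Local Notation M := (rscal f).
HB.instance Definition _ := GRing.Zmodule.copy M B.

Let scale (a : A) (b : M) : M := (f a * b : B).
Fact rscalA a b v : scale a (scale b v) = scale (a * b) v.
Proof. by rewrite /scale rmorphM mulrA. Qed.
Fact rscal1 : left_id 1 scale.
Proof. by move=> v; rewrite /scale rmorph1 mul1r. Qed.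
Fact rscalDr : right_distributive scale +%R.
Proof. by move=> a u v; rewrite /scale mulrDr. Qed.
Fact rscalDl v : {morph scale^~ v : a b / a + b}.
Proof. by move=> a b; rewrite /scale rmorphD mulrDl. Qed.
HB.instance Definition _ :=
  GRing.Zmodule_isLmodule.Build A M rscalA rscal1 rscalDr rscalDl.
End RestrictScalars.

(* The notions for Tambara functors below, in the case of the trivial group:
   levelwise data reduce to one module or ring, and I^{>1} to I^2. *)
Section OrdinaryRings.
Variable R : comPzRingType.

Record ralg := RAlg {
  ra_ring :> comPzRingType;
  ra_map : {rmorphism R -> ra_ring}
}.

Record rhom (A B : ralg) := RHom {
  rh :> {rmorphism A -> B};
  rhE : forall r, rh (ra_map A r) = ra_map B r
}.

Definition ralg_mod (A : ralg) : lmodType R := rscal (ra_map A).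

Definition short_exact_lin (A B C : lmodType R)
    (i : {linear A -> B}) (p : {linear B -> C}) : Prop :=
  [/\ injective i, (forall c, exists b, p b = c) &
      forall b, p b = 0 <-> exists a, i a = b].

Definition is_bilinear (M N P : lmodType R) (t : M -> N -> P) : Prop :=
  [/\ forall a m m' n, t (a *: m + m') n = a *: t m n + t m' n &
      forall a m n n', t m (a *: n + n') = a *: t m n + t m n'].

Definition is_tensor (M N P : lmodType R) (t : M -> N -> P) : Prop :=
  is_bilinear t /\
  forall (Q : lmodType R) (t' : M -> N -> Q), is_bilinear t' ->
    (exists f : {linear P -> Q}, forall m n, f (t m n) = t' m n) /\
    (forall f f' : {linear P -> Q},
       (forall m n, f (t m n) = f' (t m n)) -> f =1 f').

Definition flat_lmod (M : lmodType R) : Prop :=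
  forall (A B C : lmodType R) (i : {linear A -> B}) (p : {linear B -> C}),
    short_exact_lin i p ->
  forall (MA MB MC : lmodType R)
    (tA : M -> A -> MA) (tB : M -> B -> MB) (tC : M -> C -> MC),
    is_tensor tA -> is_tensor tB -> is_tensor tC ->
  forall (Mi : {linear MA -> MB}) (Mp : {linear MB -> MC}),
    (forall m a, Mi (tA m a) = tB m (i a)) ->
    (forall m b, Mp (tB m b) = tC m (p b)) ->
  short_exact_lin Mi Mp.

Definition fg_lmod (M : lmodType R) : Prop :=
  exists n (m : 'I_n -> M), forall x, exists a : 'I_n -> R,
    x = \sum_i a i *: m i.

Definition is_tensor_alg (A B P : ralg) (i : rhom A P) (j : rhom B P) : Prop :=
  @is_tensor (ralg_mod A) (ralg_mod B) (ralg_mod P)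
    (fun a b => i a * j b : P).

Definition free_poly_ring (n : nat) (P : ralg) (x : 'I_n -> P) : Prop :=
  forall (S : ralg) (s : 'I_n -> S),
    exists! f : rhom P S, forall i, f (x i) = s i.

Definition is_coequalizer_ring (Q P S : ralg) (u v : rhom Q P) (p : rhom P S) :
    Prop :=
  (forall a, p (u a) = p (v a)) /\
  forall (T : ralg) (f : rhom P T), (forall a, f (u a) = f (v a)) ->
    exists! g : rhom S T, forall a, g (p a) = f a.

Definition fp_ralg (S : ralg) : Prop :=
  exists m n (Q P : ralg) (y : 'I_m -> Q) (x : 'I_n -> P)
    (u v : rhom Q P) (p : rhom P S),
  [/\ free_poly_ring y, free_poly_ring x & is_coequalizer_ring u v p].

Definition is_ideal (S : comPzRingType) (J : S -> Prop) : Prop :=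
  [/\ J 0, forall a b, J a -> J b -> J (a + b) &
      forall a b, J b -> J (a * b)].

Definition ideal_sq (S : comPzRingType) (I : S -> Prop) (a : S) : Prop :=
  forall J, is_ideal J -> (forall x y, I x -> I y -> J (x * y)) -> J a.

(* I/J, as the type of cosets a + J with a in I. *)
Definition ideal_quot (S : comPzRingType) (I J : S -> Prop) : Type :=
  {c : S -> Prop | exists2 a, I a & c = (fun b => J (b - a))}.

Definition ring_kahler (P S : ralg) (mu : rhom P S) : Type :=
  let I := fun a : P => mu a = 0 in ideal_quot I (ideal_sq I).

Definition ring_kahler_zero (S : ralg) : Prop :=
  exists (P : ralg) (i j : rhom S P) (mu : rhom P S),
  [/\ is_tensor_alg i j, (forall a, mu (i a) = a), (forall a, mu (j a) = a) &
      forall c d : ring_kahler mu, c = d].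

Definition finite_etale_ring (S : ralg) : Prop :=
  [/\ fg_lmod (ralg_mod S), flat_lmod (ralg_mod S), ring_kahler_zero S &
      fp_ralg S].


Lemma rhom_ext (A B : ralg) (f g : rhom A B) : f =1 g -> f = g.
Proof.
case: f g => [f hf] [g hg] /= /rmorphism_ext e; case: _ / e hg => hg.
by rewrite (Prop_irrelevance hf hg).
Qed.

Definition rhom_id (A : ralg) : rhom A A := @RHom A A idfun (fun _ => erefl).

Lemma rhom_comp_eq (A B C : ralg) (g : rhom B C) (f : rhom A B) r :
  g (f (ra_map A r)) = ra_map C r.
Proof. by rewrite !rhE. Qed.

Definition rhom_comp (A B C : ralg) (g : rhom B C) (f : rhom A B) : rhom A C :=
  @RHom A C (rh g \o rh f) (rhom_comp_eq g f).

Definition RAlgCat : category.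
Proof.
by refine (@Category ralg rhom rhom_id rhom_comp _ _ _) => *; apply: rhom_ext.
Defined.
End OrdinaryRings.

Definition GrpFetRing (R : comPzRingType) : category :=
  @GrpCat (RAlgCat R) (@finite_etale_ring R).

Section GSets.
Variable gT : finGroupType.

(* Right actions; a right G-set is a left G-set through inversion in G. *)
Record gset := GSet {
  gcar :> finType;
  gsact : {action gT &-> gcar}
}.

Record gmap (X Y : gset) := GMap {
  gfun :> X -> Y;
  gfunE : forall x g, gfun (gsact X x g) = gsact Y (gfun x) g
}.

Lemma gmap_ext X Y (f g : gmap X Y) : f =1 g -> f = g.
Proof.
case: f g => [f hf] [g hg] /= /funext e; case: _ / e hg => hg.
by rewrite (Prop_irrelevance hf hg).
Qed.

Definition gmap_id X : gmap X X := @GMap X X id (fun _ _ => erefl).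

Lemma gmap_comp_eq X Y Z (g : gmap Y Z) (f : gmap X Y) x a :
  g (f (gsact X x a)) = gsact Z (g (f x)) a.
Proof. by rewrite !gfunE. Qed.

Definition gmap_comp X Y Z (g : gmap Y Z) (f : gmap X Y) : gmap X Z :=
  @GMap X Z (fun x => g (f x)) (gmap_comp_eq g f).

Section Sum.
Variables X Y : gset.

Definition sum_act (z : X + Y) (g : gT) : X + Y :=
  match z with inl x => inl (gsact X x g) | inr y => inr (gsact Y y g) end.

Fact sum_act1 : sum_act^~ 1%g =1 id.
Proof. by case=> z /=; rewrite act1. Qed.

Fact sum_actM : forall z, act_morph sum_act z.
Proof. by case=> z a b /=; rewrite actM. Qed.

Definition gsum : gset := @GSet (X + Y)%type (TotalAction sum_act1 sum_actM).

Definition ginl : gmap X gsum := @GMap X gsum inl (fun _ _ => erefl).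
Definition ginr : gmap Y gsum := @GMap Y gsum inr (fun _ _ => erefl).
End Sum.

(* G/e, whose automorphisms are the left translations. *)
Definition gfree : gset := @GSet gT (mulgr_action gT).

Lemma gtrans_eq (h x g : gT) : (h * (x * g) = (h * x) * g)%g.
Proof. exact: mulgA. Qed.

Definition gtrans (h : gT) : gmap gfree gfree :=
  @GMap gfree gfree (mulg h) (gtrans_eq h).

Section Orbits.
Variable H : {group gT}.

Definition coset_car := {A : {set gT} | A \in rcosets H [set: gT]}.

Fact coset_actP (A : coset_car) g : (val A :* g)%g \in rcosets H [set: gT].
Proof.
case: A => A /= /rcosetsP[x _ ->]; apply/rcosetsP; exists (x * g)%g => //.
by rewrite rcosetM.
Qed.

Definition coset_act (A : coset_car) (g : gT) : coset_car :=
  exist _ (val A :* g)%g (coset_actP A g).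

Fact coset_act1 : coset_act^~ 1%g =1 id.
Proof. by move=> A; apply: val_inj; rewrite /= rcoset1. Qed.

Fact coset_actM : forall A, act_morph coset_act A.
Proof. by move=> A a b; apply: val_inj; rewrite /= rcosetM. Qed.

(* G/H *)
Definition gorbit : gset := @GSet coset_car (TotalAction coset_act1 coset_actM).
End Orbits.

(* W --g'--> X
   |f'       |f
   Z --g---> Y *)
Definition is_pullback (X Y Z W : gset) (f : gmap X Y) (g : gmap Z Y)
    (g' : gmap W X) (f' : gmap W Z) : Prop :=
  (forall w, f (g' w) = g (f' w)) /\
  forall x z, f x = g z -> exists! w, g' w = x /\ f' w = z.

(* X <--p-- A <--e-- C
   |f                |f'
   Y <------q------- B
   with c = p e, in which C = X x_Y B and the fibre of q over y is the set of
   sections of p over the fibre of f over y, e being the evaluation map. *)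
Definition is_exponential (X Y A B C : gset) (f : gmap X Y) (p : gmap A X)
    (q : gmap B Y) (c : gmap C X) (f' : gmap C B) (e : gmap C A) : Prop :=
  [/\ is_pullback f q c f', (forall z, p (e z) = c z) &
      forall (y : Y) (s : {x : X | f x == y} -> A),
        (forall x, p (s x) = val x) ->
        exists! b, q b = y /\
          forall z x, f' z = b -> c z = val x -> e z = s x].

Record tambara := Tambara {
  tob :> gset -> comPzRingType;
  tres : forall X Y, gmap X Y -> {rmorphism tob Y -> tob X};
  ttr : forall X Y, gmap X Y -> {additive tob X -> tob Y};
  tnm : forall X Y, gmap X Y -> tob X -> tob Y;
  tnm_one : forall X Y (f : gmap X Y), tnm f 1 = 1;
  tnm_mul : forall X Y (f : gmap X Y) a b, tnm f (a * b) = tnm f a * tnm f b;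
  tres_id : forall X a, tres (gmap_id X) a = a;
  ttr_id : forall X a, ttr (gmap_id X) a = a;
  tnm_id : forall X a, tnm (gmap_id X) a = a;
  tres_comp : forall X Y Z (g : gmap Y Z) (f : gmap X Y) a,
    tres (gmap_comp g f) a = tres f (tres g a);
  ttr_comp : forall X Y Z (g : gmap Y Z) (f : gmap X Y) a,
    ttr (gmap_comp g f) a = ttr g (ttr f a);
  tnm_comp : forall X Y Z (g : gmap Y Z) (f : gmap X Y) a,
    tnm (gmap_comp g f) a = tnm g (tnm f a);
  t_empty : forall X : gset, #|X| = 0%N -> forall a : tob X, a = 0;
  t_sum : forall X Y (a : tob X) (b : tob Y),
    exists! c, tres (ginl X Y) c = a /\ tres (ginr X Y) c = b;
  ttr_bc : forall X Y Z W (f : gmap X Y) (g : gmap Z Y)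
      (g' : gmap W X) (f' : gmap W Z), is_pullback f g g' f' ->
    forall a, tres g (ttr f a) = ttr f' (tres g' a);
  tnm_bc : forall X Y Z W (f : gmap X Y) (g : gmap Z Y)
      (g' : gmap W X) (f' : gmap W Z), is_pullback f g g' f' ->
    forall a, tres g (tnm f a) = tnm f' (tres g' a);
  tnm_ttr : forall X Y A B C (f : gmap X Y) (p : gmap A X)
      (q : gmap B Y) (c : gmap C X) (f' : gmap C B) (e : gmap C A),
      is_exponential f p q c f' e ->
    forall a, tnm f (ttr p a) = ttr q (tnm f' (tres e a));
  (* implied by tnm_ttr and tnm_bc applied to fold maps *)
  ttr_frob : forall X Y (f : gmap X Y) a b,
    ttr f (tres f b * a) = b * ttr f a
}.

Arguments tres t {X Y} _.
Arguments ttr t {X Y} _.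
Arguments tnm t {X Y} _ _.

Record thom (S T : tambara) := THom {
  th :> forall X, {rmorphism S X -> T X};
  th_res : forall X Y (f : gmap X Y) a, th X (tres S f a) = tres T f (th Y a);
  th_tr : forall X Y (f : gmap X Y) a, th Y (ttr S f a) = ttr T f (th X a);
  th_nm : forall X Y (f : gmap X Y) a, th Y (tnm S f a) = tnm T f (th X a)
}.

Lemma thom_ext S T (f g : thom S T) : (forall X, f X =1 g X) -> f = g.
Proof.
case: f g => [f f1 f2 f3] [g g1 g2 g3] /= e.
have {}e : f = g.
  by apply: functional_extensionality_dep => X; apply: rmorphism_ext; exact: e.
case: _ / e g1 g2 g3 => g1 g2 g3.
by rewrite (Prop_irrelevance f1 g1) (Prop_irrelevance f2 g2)
  (Prop_irrelevance f3 g3).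
Qed.

Definition thom_id S : thom S S :=
  @THom S S (fun X => idfun) (fun _ _ _ _ => erefl) (fun _ _ _ _ => erefl)
    (fun _ _ _ _ => erefl).

Definition thom_comp S T U (g : thom T U) (f : thom S T) : thom S U.
Proof.
refine (@THom S U (fun X => g X \o f X) _ _ _) => X Y h a /=.
- by rewrite !th_res.
- by rewrite !th_tr.
- by rewrite !th_nm.
Defined.

Definition is_tideal (S : tambara) (J : forall X, S X -> Prop) : Prop :=
  exists (T : tambara) (f : thom S T), forall X a, J X a <-> f X a = 0.

Definition tideal_gen (S : tambara) (A : forall X, S X -> Prop) X (a : S X) :
    Prop :=
  forall J : forall X, S X -> Prop,
    is_tideal J -> (forall Y b, A Y b -> J Y b) -> J X a.

Definition fg_tideal (S : tambara) (J : forall X, S X -> Prop) : Prop :=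
  exists n (Y : 'I_n -> gset) (y : forall i, S (Y i)), forall X (a : S X),
    J X a <->
    tideal_gen
      (fun Z b => exists i, existT (fun Z => tob S Z) (Y i) (y i) = existT _ Z b)
      a.

(* The second constructor ranges over the maps G/K -> G/H with K conjugate to a
   proper subgroup of H. *)
Variant norm_gens (S : tambara) (I : forall X, S X -> Prop) :
    forall X, S X -> Prop :=
| NormProd (H : {group gT}) (a b : S (gorbit H)) of
    I _ a & I _ b : norm_gens I (a * b)
| NormProper (K H : {group gT}) (f : gmap (gorbit K) (gorbit H))
    (a : S (gorbit K)) of
    (exists x, (K :^ x)%g \proper H) & I _ a : norm_gens I (tnm S f a).

Definition tideal_gt1 (S : tambara) (I : forall X, S X -> Prop) :
    forall X, S X -> Prop :=
  tideal_gen (norm_gens I).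

Section Modules.
Variable k : tambara.

(* mresZ, mtrZl and mtrZr say that the action k x M -> M is a Dress pairing. *)
Record tmod := TMod {
  mob :> forall X, lmodType (k X);
  mres : forall X Y, gmap X Y -> {additive mob Y -> mob X};
  mtr : forall X Y, gmap X Y -> {additive mob X -> mob Y};
  mres_id : forall X m, mres (gmap_id X) m = m;
  mtr_id : forall X m, mtr (gmap_id X) m = m;
  mres_comp : forall X Y Z (g : gmap Y Z) (f : gmap X Y) m,
    mres (gmap_comp g f) m = mres f (mres g m);
  mtr_comp : forall X Y Z (g : gmap Y Z) (f : gmap X Y) m,
    mtr (gmap_comp g f) m = mtr g (mtr f m);
  m_empty : forall X : gset, #|X| = 0%N -> forall m : mob X, m = 0;
  m_sum : forall X Y (m : mob X) (n : mob Y),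
    exists! c, mres (ginl X Y) c = m /\ mres (ginr X Y) c = n;
  mtr_bc : forall X Y Z W (f : gmap X Y) (g : gmap Z Y)
      (g' : gmap W X) (f' : gmap W Z), is_pullback f g g' f' ->
    forall m, mres g (mtr f m) = mtr f' (mres g' m);
  mresZ : forall X Y (f : gmap X Y) a m,
    mres f (a *: m) = tres k f a *: mres f m;
  mtrZl : forall X Y (f : gmap X Y) a m,
    mtr f (a *: mres f m) = ttr k f a *: m;
  mtrZr : forall X Y (f : gmap X Y) a m,
    mtr f (tres k f a *: m) = a *: mtr f m
}.

Arguments mres t {X Y} _.
Arguments mtr t {X Y} _.

Record mhom (M N : tmod) := MHom {
  mh :> forall X, {linear M X -> N X};
  mh_res : forall X Y (f : gmap X Y) m, mh X (mres M f m) = mres N f (mh Y m);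
  mh_tr : forall X Y (f : gmap X Y) m, mh Y (mtr M f m) = mtr N f (mh X m)
}.

Definition short_exact (A B C : tmod) (i : mhom A B) (p : mhom B C) : Prop :=
  forall X, short_exact_lin (i X) (p X).

(* k-bilinear Dress pairings *)
Record is_pairing (M N P : tmod) (t : forall X, M X -> N X -> P X) : Prop :=
  IsPairing {
    pairing_bilinear : forall X, is_bilinear (t X);
    pairing_res : forall X Y (f : gmap X Y) m n,
      mres P f (t Y m n) = t X (mres M f m) (mres N f n);
    pairing_trl : forall X Y (f : gmap X Y) m n,
      mtr P f (t X m (mres N f n)) = t Y (mtr M f m) n;
    pairing_trr : forall X Y (f : gmap X Y) m n,
      mtr P f (t X (mres M f m) n) = t Y m (mtr N f n)
  }.

(* P is the relative box product of M and N over k, with universal pairing t. *)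
Definition is_box (M N P : tmod) (t : forall X, M X -> N X -> P X) : Prop :=
  is_pairing t /\
  forall (Q : tmod) (t' : forall X, M X -> N X -> Q X), is_pairing t' ->
    (exists f : mhom P Q, forall X m n, f X (t X m n) = t' X m n) /\
    (forall f f' : mhom P Q,
       (forall X m n, f X (t X m n) = f' X (t X m n)) ->
       forall X, f X =1 f' X).

Definition flat_tmod (M : tmod) : Prop :=
  forall (A B C : tmod) (i : mhom A B) (p : mhom B C), short_exact i p ->
  forall (MA MB MC : tmod) (tA : forall X, M X -> A X -> MA X)
    (tB : forall X, M X -> B X -> MB X) (tC : forall X, M X -> C X -> MC X),
    is_box tA -> is_box tB -> is_box tC ->
  forall (Mi : mhom MA MB) (Mp : mhom MB MC),
    (forall X m a, Mi X (tA X m a) = tB X m (i X a)) ->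
    (forall X m b, Mp X (tB X m b) = tC X m (p X b)) ->
  short_exact Mi Mp.

Record is_submod (M : tmod) (N : forall X, M X -> Prop) : Prop := IsSubmod {
  submod0 : forall X, N X 0;
  submodD : forall X m n, N X m -> N X n -> N X (m + n);
  submodZ : forall X a m, N X m -> N X (a *: m);
  submod_res : forall X Y (f : gmap X Y) m, N Y m -> N X (mres M f m);
  submod_tr : forall X Y (f : gmap X Y) m, N X m -> N Y (mtr M f m)
}.

Definition fg_tmod (M : tmod) : Prop :=
  exists n (Y : 'I_n -> gset) (y : forall i, M (Y i)),
    forall N, @is_submod M N -> (forall i, N (Y i) (y i)) ->
    forall X m, N X m.

Record kalg := KAlg {
  ka_tambara :> tambara;
  ka_map : thom k ka_tambara
}.

Record ahom (S T : kalg) := AHom {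
  ah :> thom S T;
  ahE : forall X a, ah X (ka_map S X a) = ka_map T X a
}.

Lemma ahom_ext (S T : kalg) (f g : ahom S T) :
  (forall X, f X =1 g X) -> f = g.
Proof.
case: f g => [f hf] [g hg] /= /thom_ext e; case: _ / e hg => hg.
by rewrite (Prop_irrelevance hf hg).
Qed.

Definition ahom_id (S : kalg) : ahom S S :=
  @AHom S S (thom_id S) (fun _ _ => erefl).

Definition ahom_comp (S T U : kalg) (g : ahom T U) (f : ahom S T) : ahom S U.
Proof.
by refine (@AHom S U (thom_comp g f) _) => X a /=; rewrite !ahE.
Defined.

Definition KAlgCat : category.
Proof.
by refine (@Category kalg ahom ahom_id ahom_comp _ _ _) => *; apply: ahom_ext.
Defined.

Definition alg_mod (S : kalg) : tmod.
Proof.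
refine (@TMod (fun X => rscal (ka_map S X)) (@tres S) (@ttr S)
  (@tres_id S) (@ttr_id S) (@tres_comp S) (@ttr_comp S)
  (@t_empty S) (@t_sum S) (@ttr_bc S) _ _ _) => X Y f a m.
- by rewrite /GRing.scale /= rmorphM th_res.
- by rewrite /GRing.scale /= mulrC ttr_frob mulrC th_tr.
- by rewrite /GRing.scale /= th_res ttr_frob.
Defined.

(* P is the relative box product of S and T: the norms of P are forced by the
   requirement that i and j be maps of Tambara functors. *)
Definition is_box_alg (S T P : kalg) (i : ahom S P) (j : ahom T P) : Prop :=
  @is_box (alg_mod S) (alg_mod T) (alg_mod P)
    (fun X s t => i X s * j X t : P X).

(* P is free on generators x i in level Y i. *)
Definition free_poly (n : nat) (Y : 'I_n -> gset) (P : kalg)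
    (x : forall i, P (Y i)) : Prop :=
  forall (S : kalg) (s : forall i, S (Y i)),
    exists! f : ahom P S, forall i, f (Y i) (x i) = s i.

Definition is_coequalizer (Q P S : kalg) (u v : ahom Q P) (p : ahom P S) :
    Prop :=
  (forall X a, p X (u X a) = p X (v X a)) /\
  forall (T : kalg) (f : ahom P T), (forall X a, f X (u X a) = f X (v X a)) ->
    exists! g : ahom S T, forall X a, g X (p X a) = f X a.

Definition fp_kalg (S : kalg) : Prop :=
  exists m n (Z : 'I_m -> gset) (Y : 'I_n -> gset) (Q P : kalg)
    (z : forall i, Q (Z i)) (y : forall i, P (Y i))
    (u v : ahom Q P) (p : ahom P S),
  [/\ free_poly z, free_poly y & is_coequalizer u v p].

(* The level X of I/I^{>1}, for I the kernel of mu. *)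
Definition kahler (P S : kalg) (mu : ahom P S) (X : gset) : Type :=
  let I := fun Y (a : P Y) => mu Y a = 0 in
  ideal_quot (I X) (@tideal_gt1 P I X).

Definition kahler_zero (S : kalg) : Prop :=
  exists (P : kalg) (i j : ahom S P) (mu : ahom P S),
  [/\ is_box_alg i j, (forall X a, mu X (i X a) = a),
      (forall X a, mu X (j X a) = a) &
      forall X (c d : kahler mu X), c = d].

Definition formally_etale (S : kalg) : Prop :=
  flat_tmod (alg_mod S) /\ kahler_zero S.

Definition etale (S : kalg) : Prop := formally_etale S /\ fp_kalg S.

Definition finite_etale (S : kalg) : Prop := fg_tmod (alg_mod S) /\ etale S.

Definition hilbert_basis : Prop :=
  forall n (Y : 'I_n -> gset) (P : kalg) (y : forall i, P (Y i)),
    free_poly y ->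
  forall J : forall X, P X -> Prop, is_tideal J -> fg_tideal J.

End Modules.

Definition GrpFet (k : tambara) : category :=
  @GrpCat (KAlgCat k) (@finite_etale k).

Record gring := GRingOb {
  gr_ring :> comPzRingType;
  gr_act : gT -> {rmorphism gr_ring -> gr_ring};
  gr_act1 : forall x, gr_act 1%g x = x;
  gr_actM : forall g h x, gr_act (g * h)%g x = gr_act h (gr_act g x)
}.

Definition gring_triv (R : comPzRingType) : gring :=
  @GRingOb R (fun _ => idfun) (fun _ => erefl) (fun _ _ _ => erefl).

Section FixedPoints.
Variable L : gring.

(* FP(L)(X) is the ring of equivariant maps X -> L; in level G/H evaluation at
   the trivial coset identifies it with the subring of H-fixed elements. *)
Definition fp_pred (X : gset) : {pred {ffun X -> L}} :=
  fun a => [forall x, forall g, a (gsact X x g) == gr_act L g (a x)].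

Arguments fp_pred : clear implicits.

Lemma fp_predP (X : gset) (a : {ffun X -> L}) :
  reflect (forall x g, a (gsact X x g) = gr_act L g (a x)) (a \in fp_pred X).
Proof.
apply: (iffP forallP) => [h x g|h x]; first exact/eqP/(forallP (h x)).
by apply/forallP => g; apply/eqP.
Qed.

Lemma fp_subring (X : gset) : subring_closed (fp_pred X).
Proof.
split=> [|a b /fp_predP ha /fp_predP hb|a b /fp_predP ha /fp_predP hb];
  apply/fp_predP => x g; rewrite !ffunE ?rmorph1 //.
- by rewrite ha hb rmorphB.
- by rewrite ha hb rmorphM.
Qed.

Record fp (X : gset) := FP { fpv :> {ffun X -> L}; fpvP : fpv \in fp_pred X }.
HB.instance Definition _ (X : gset) := [isSub for @fpv X].
HB.instance Definition _ (X : gset) := [Choice of fp X by <:].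
HB.instance Definition _ (X : gset) :=
  GRing.SubChoice_isSubPzRing.Build {ffun X -> L} (fp_pred X) (fp X)
    (fp_subring X).

Lemma fp_mulC X : commutative (@GRing.mul (fp X)).
Proof.
by move=> a b; apply: val_inj; rewrite !rmorphM; apply/ffunP => x;
  rewrite !ffunE mulrC.
Qed.
HB.instance Definition _ (X : gset) :=
  GRing.PzRing_hasCommutativeMul.Build (fp X) (@fp_mulC X).

Lemma fpE X (a : fp X) x g : a (gsact X x g) = gr_act L g (a x).
Proof. by move/fp_predP: (fpvP a). Qed.

Lemma fpP X (a b : fp X) : (forall x, a x = b x) -> a = b.
Proof. by move=> e; apply: val_inj; apply/ffunP. Qed.

Lemma fibre_act (X Y : gset) (f : gmap X Y) x y g :
  (f (gsact X x g) == gsact Y y g) = (f x == y).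
Proof. by rewrite gfunE (inj_eq (act_inj (gsact Y) g)). Qed.

Section Operations.
Variables (X Y : gset) (f : gmap X Y).

Fact fp_resP (a : fp Y) : [ffun x => a (f x)] \in fp_pred X.
Proof. by apply/fp_predP => x g; rewrite !ffunE gfunE fpE. Qed.
Definition fp_res (a : fp Y) : fp X := FP (fp_resP a).

Fact fp_trP (a : fp X) : [ffun y => \sum_(x | f x == y) a x] \in fp_pred Y.
Proof.
apply/fp_predP => y g; rewrite !ffunE rmorph_sum /=.
rewrite (reindex_inj (act_inj (gsact X) g)) /=.
by apply: eq_big => [x|x _]; rewrite ?fibre_act ?fpE.
Qed.
Definition fp_tr (a : fp X) : fp Y := FP (fp_trP a).

Fact fp_nmP (a : fp X) : [ffun y => \prod_(x | f x == y) a x] \in fp_pred Y.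
Proof.
apply/fp_predP => y g; rewrite !ffunE rmorph_prod /=.
rewrite (reindex_inj (act_inj (gsact X) g)) /=.
by apply: eq_big => [x|x _]; rewrite ?fibre_act ?fpE.
Qed.
Definition fp_nm (a : fp X) : fp Y := FP (fp_nmP a).

Fact fp_res_zmod : zmod_morphism fp_res.
Proof. by move=> a b; apply: fpP => x; rewrite !ffunE. Qed.
Fact fp_res_monoid : monoid_morphism fp_res.
Proof. by split=> [|a b]; apply: fpP => x; rewrite !ffunE. Qed.
HB.instance Definition _ := GRing.isZmodMorphism.Build _ _ fp_res fp_res_zmod.
HB.instance Definition _ :=
  GRing.isMonoidMorphism.Build _ _ fp_res fp_res_monoid.

Fact fp_tr_zmod : zmod_morphism fp_tr.
Proof.
move=> a b; apply: fpP => y; rewrite !ffunE -sumrB.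
by apply: eq_bigr => x _; rewrite !ffunE.
Qed.
HB.instance Definition _ := GRing.isZmodMorphism.Build _ _ fp_tr fp_tr_zmod.
End Operations.

Lemma pullback_inj (X Y Z W : gset) (f : gmap X Y) (g : gmap Z Y)
    (g' : gmap W X) (f' : gmap W Z) w w' : is_pullback f g g' f' ->
  g' w = g' w' -> f' w = f' w' -> w = w'.
Proof.
case=> fg pb eg ef; have [w0 [_ u]] := pb (g' w') (f' w') (fg w').
by rewrite -(u w) // -(u w').
Qed.

Section BaseChange.
Variables (T : Type) (idx : T) (op : Monoid.com_law idx).
Lemma fibre_bc (X Y Z W : gset) (f : gmap X Y) (g : gmap Z Y) (g' : gmap W X)
    (f' : gmap W Z) (F : X -> T) z : is_pullback f g g' f' ->
  \big[op/idx]_(x | f x == g z) F x = \big[op/idx]_(w | f' w == z) F (g' w).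
Proof.
case=> fg pb; rewrite (reindex_omap g' (fun x =>
  [pick w | (g' w == x) && (f' w == z)])) /= => [|x /eqP/pb[w [[ew ez] _]]].
  apply: eq_bigl => w; apply/andP/eqP => [[/eqP ew /eqP]|ez].
    by case: pickP => // w' /andP[_ /eqP e] [<-].
  split; first by rewrite fg ez.
  case: pickP => [w' /andP[/eqP e1 /eqP e2]|/(_ w)]; last by rewrite ez !eqxx.
  by rewrite (pullback_inj (conj fg pb) e1) // e2 ez.
case: pickP => [w1 /andP[/eqP e1 _] | /(_ w)] /=; first by rewrite e1.
by rewrite ew ez !eqxx.
Qed.

Lemma fibre_comp (X Y Z : gset) (g : gmap Y Z) (f : gmap X Y) (F : X -> T) z :
  \big[op/idx]_(x | g (f x) == z) F x =
  \big[op/idx]_(y | g y == z) \big[op/idx]_(x | f x == y) F x.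
Proof.
rewrite (partition_big (fun x => f x) (fun y => g y == z)) //=.
apply: eq_bigr => y /eqP gy; apply: eq_bigl => x.
by case: (f x =P y) => [->|]; rewrite ?gy ?eqxx ?andbF.
Qed.
End BaseChange.

Lemma fp_exp (X Y A B C : gset) (f : gmap X Y) (p : gmap A X)
    (q : gmap B Y) (c : gmap C X) (f' : gmap C B) (e : gmap C A) :
  is_exponential f p q c f' e -> forall (F : A -> L) y,
  \prod_(x | f x == y) \sum_(a | p a == x) F a =
  \sum_(b | q b == y) \prod_(z | f' z == b) F (e z).
Proof.
case=> [[fc pb] pe sec] F y.
pose Q x (o : option A) := if o is Some a then p a == x else false.
pose G (o : option A) : L := if o is Some a then F a else 0.
have -> : \prod_(x | f x == y) \sum_(a | p a == x) F a =
          \prod_(x | f x == y) \sum_(o | Q x o) G o.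
  apply: eq_bigr => x _; rewrite [RHS](reindex_omap Some id) /=; last by case.
  by apply: eq_bigl => a; rewrite eqxx andbT.
rewrite (big_distr_big_dep None) /=.
pose sig b : {ffun X -> option A} :=
  [ffun x => omap e [pick z | (f' z == b) && (c z == x)]].
have sigE b z : f' z = b -> sig b (c z) = Some (e z).
  move=> fz; rewrite ffunE.
  case: pickP => [w /andP[/eqP fw /eqP cw]|/(_ z)]; last by rewrite fz !eqxx.
  by rewrite /= (pullback_inj (conj fc pb) cw) // fw fz.
have sigF b x : f x != q b -> sig b x = None.
  move=> nx; rewrite ffunE; case: pickP => // z /andP[/eqP fz /eqP cz].
  by move: nx; rewrite -cz -fz fc eqxx.
have sigT b x : f x = q b -> exists2 z, f' z = b & c z = x.
  by case/pb=> z [[cz fz] _]; exists z.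
have PA s : (s \in pfamily None (fun x => f x == y) Q) ->
  exists b, q b = y /\ sig b = s.
  move/pfamilyP=> [/supportP s0 sQ].
  have sS (x : {x : X | f x == y}) : {a | s (val x) = Some a /\ p a = val x}.
    move: (sQ _ (valP x)); rewrite /in_mem /= /Q.
    by case: (s _) => // a /eqP pa; exists a.
  have [x|b [[qb hb] _]] := sec y (fun x => sval (sS x)).
    by have [_] := svalP (sS x).
  exists b; split=> //; apply/ffunP => x.
  case: (eqVneq (f x) y) => [fx|nx]; last by rewrite sigF ?qb // s0.
  have [z fz cz] := sigT b x (etrans fx (esym qb)).
  have fx' : f x == y by apply/eqP.
  rewrite -{1}cz (sigE _ _ fz) (hb z (exist _ x fx') fz cz).
  by have [es _] := svalP (sS (exist _ x fx')); rewrite [RHS]es.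
have AP b : q b = y -> sig b \in pfamily None (fun x => f x == y) Q.
  move=> qb; apply/pfamilyP; split.
    by apply/supportP => x nx; rewrite sigF // qb.
  move=> x /eqP fx; have [z fz cz] := sigT b x (etrans fx (esym qb)).
  by rewrite -cz (sigE _ _ fz) /in_mem /= pe.
have sig_inj b b' : q b = y -> q b' = y -> sig b = sig b' -> b = b'.
  move=> qb qb' es.
  have sS (x : {x : X | f x == y}) : {a | sig b (val x) = Some a /\ p a = val x}.
    have /pfamilyP[_ /(_ _ (valP x))] := AP b qb.
    by rewrite /in_mem /= /Q; case: (sig b _) => // a /eqP pa; exists a.
  have [x|b0 [_ u]] := sec y (fun x => sval (sS x)).
    by have [_] := svalP (sS x).
  rewrite -(u b) ?(u b') //; split=> // z x fz cz; case: (sS x) => a /= [].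
    by rewrite es -cz (sigE _ _ fz) => -[].
  by rewrite -cz (sigE _ _ fz) => -[].
rewrite (reindex_omap sig (fun s => [pick b | (q b == y) && (sig b == s)])) /=;
  last first.
  move=> s /PA[b [qb sb]].
  case: pickP => [b' /andP[_ /eqP sb']|/(_ b)] /=; first by rewrite sb'.
  by rewrite qb sb !eqxx.
apply: eq_big => [b|b /andP[/PA[b0 [qb0 sb0]] /eqP]].
  apply/andP/eqP => [[_ /eqP]|qb].
    by case: pickP => // b' /andP[/eqP qb' _] [<-].
  split; first exact: AP.
  case: pickP => [b' /andP[/eqP qb' /eqP sb']|/(_ b)]; last by rewrite qb !eqxx.
  by rewrite (sig_inj b' b).
case: pickP => // b' /andP[/eqP qb' _] [eb]; rewrite eb in qb'.
rewrite (reindex_omap c (fun x => [pick z | (f' z == b) && (c z == x)])) /=.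
  apply: eq_big => [z|z /andP[_ /eqP]].
    apply/andP/eqP => [[_ /eqP]|fz].
      by case: pickP => // w /andP[/eqP fw _] [<-].
    split; first by rewrite fc fz qb'.
    case: pickP => [w /andP[/eqP fw /eqP cw]|/(_ z)]; last by rewrite fz !eqxx.
    by rewrite (pullback_inj (conj fc pb) cw) // fw fz.
  by case: pickP => // w /andP[/eqP fw _] [ew]; rewrite sigE // -ew.
move=> x /eqP fx; have [z fz cz] := sigT b x (etrans fx (esym qb')).
case: pickP => [w /andP[_ /eqP cw]|/(_ z)] /=; first by rewrite cw.
by rewrite fz cz !eqxx.
Qed.

Definition FPTambara : tambara.
Proof.
refine (@Tambara fp (fun X Y f => fp_res f) (fun X Y f => fp_tr f) fp_nm
  _ _ _ _ _ _ _ _ _ _ _ _ _ _).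
- move=> X Y f; apply: fpP => y; rewrite !ffunE big1 // => x _.
  by rewrite ffunE.
- move=> X Y f a b; apply: fpP => y; rewrite !ffunE -big_split /=.
  by apply: eq_bigr => x _; rewrite !ffunE.
- by move=> X a; apply: fpP => x; rewrite !ffunE.
- by move=> X a; apply: fpP => x; rewrite !ffunE /= big_pred1_eq.
- by move=> X a; apply: fpP => x; rewrite !ffunE /= big_pred1_eq.
- by move=> X Y Z g f a; apply: fpP => x; rewrite !ffunE.
- move=> X Y Z g f a; apply: fpP => z; rewrite !ffunE /= fibre_comp.
  by apply: eq_bigr => y _; rewrite ffunE.
- move=> X Y Z g f a; apply: fpP => z; rewrite !ffunE /= fibre_comp.
  by apply: eq_bigr => y _; rewrite ffunE.
- by move=> X X0 a; apply: fpP => x; have := fintype0 x X0.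
- move=> X Y a b.
  pose c : {ffun gsum X Y -> L} := [ffun z => match z with inl x => a x | inr y => b y end].
  have cP : c \in fp_pred (gsum X Y).
    by apply/fp_predP => -[] z g; rewrite !ffunE /= fpE.
  exists (FP cP); split=> [|d [ea eb]].
    by split; apply: fpP => x; rewrite !ffunE.
  by apply: fpP => -[] z; rewrite !ffunE -?ea -?eb !ffunE.
- move=> X Y Z W f g g' f' pb a; apply: fpP => z.
  by rewrite !ffunE (fibre_bc _ _ _ pb); apply: eq_bigr => w _; rewrite !ffunE.
- move=> X Y Z W f g g' f' pb a; apply: fpP => z.
  by rewrite !ffunE (fibre_bc _ _ _ pb); apply: eq_bigr => w _; rewrite !ffunE.
- move=> X Y A B C f p q c f' e ex a; apply: fpP => y; rewrite !ffunE.
  under eq_bigr do rewrite !ffunE.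
  rewrite (fp_exp ex); apply: eq_bigr => b _; rewrite !ffunE.
  by apply: eq_bigr => z _; rewrite !ffunE.
- move=> X Y f a b; apply: fpP => y; rewrite !ffunE big_distrr /=.
  by apply: eq_bigr => x /eqP <-; rewrite !ffunE.
Defined.

End FixedPoints.

Section FPMap.
Variables (L L' : gring) (h : {rmorphism L -> L'}).
Hypothesis hE : forall g x, h (gr_act L g x) = gr_act L' g (h x).

Section Level.
Variable X : gset.

Fact fp_map_funP (a : fp L X) : [ffun x => h (a x)] \in @fp_pred L' X.
Proof. by apply/fp_predP => x g; rewrite !ffunE fpE hE. Qed.
Definition fp_map_fun (a : fp L X) : fp L' X := FP (fp_map_funP a).

Fact fp_map_zmod : zmod_morphism fp_map_fun.
Proof. by move=> a b; apply: fpP => x; rewrite !ffunE rmorphB. Qed.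
Fact fp_map_monoid : monoid_morphism fp_map_fun.
Proof.
by split=> [|a b]; apply: fpP => x; rewrite !ffunE ?rmorph1 ?rmorphM.
Qed.
HB.instance Definition _ := GRing.isZmodMorphism.Build _ _ fp_map_fun fp_map_zmod.
HB.instance Definition _ :=
  GRing.isMonoidMorphism.Build _ _ fp_map_fun fp_map_monoid.
End Level.

Definition fp_map : thom (FPTambara L) (FPTambara L').
Proof.
refine (@THom (FPTambara L) (FPTambara L') (fun X => fp_map_fun (X := X)) _ _ _)
  => X Y f a; apply: fpP => x; rewrite !ffunE //.
- by rewrite rmorph_sum; apply: eq_bigr => y _; rewrite ffunE.
- by rewrite rmorph_prod; apply: eq_bigr => y _; rewrite ffunE.
Defined.
End FPMap.

Section Constant.
Variable R : comPzRingType.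

Definition const_tambara : tambara := FPTambara (gring_triv R).

Section ConstMap.
Variable X : gset.

Fact const_funP (r : R) : [ffun _ => r] \in @fp_pred (gring_triv R) X.
Proof. by apply/fp_predP => x g; rewrite !ffunE. Qed.
Definition const_fun (r : R) : const_tambara X := FP (const_funP r).

Fact const_zmod : zmod_morphism const_fun.
Proof. by move=> a b; apply: fpP => x; rewrite !ffunE. Qed.
Fact const_monoid : monoid_morphism const_fun.
Proof. by split=> [|a b]; apply: fpP => x; rewrite !ffunE. Qed.
HB.instance Definition _ := GRing.isZmodMorphism.Build _ _ const_fun const_zmod.
HB.instance Definition _ :=
  GRing.isMonoidMorphism.Build _ _ const_fun const_monoid.
End ConstMap.

(* S(G/e), regarded as an algebra over R = const_tambara(G/e). *)
Definition ev_ralg (S : kalg const_tambara) : ralg R :=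
  @RAlg R (S gfree) (ka_map S gfree \o @const_fun gfree).

Definition ev_rhom (S T : kalg const_tambara) (f : ahom S T) :
  rhom (ev_ralg S) (ev_ralg T).
Proof.
by refine (@RHom R (ev_ralg S) (ev_ralg T) (f gfree) _) => r /=; rewrite ahE.
Defined.

Definition weyl (S : kalg const_tambara) (g : gT) : rhom (ev_ralg S) (ev_ralg S).
Proof.
refine (@RHom R (ev_ralg S) (ev_ralg S) (tres S (gtrans g)) _) => r /=.
by rewrite -th_res; congr (ka_map S gfree _); apply: fpP => x; rewrite !ffunE.
Defined.

(* Right actions, as a left action on a scheme is a right action on the ring
   representing it. *)
Record gralg := GRAlg {
  ga_alg :> ralg R;
  ga_act : gT -> rhom ga_alg ga_alg;
  ga_act1 : ga_act 1%g = rhom_id ga_alg;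
  ga_actM : forall g h, ga_act (g * h)%g = rhom_comp (ga_act h) (ga_act g)
}.

Record grhom (A B : gralg) := GRHom {
  grh :> rhom A B;
  grhE : forall g x, grh (ga_act A g x) = ga_act B g (grh x)
}.

Definition gring_of (A : gralg) : gring.
Proof.
refine (@GRingOb A (fun g => ga_act A g) _ _) => *.
- by rewrite ga_act1.
- by rewrite ga_actM.
Defined.

Definition FPAlg (A : gralg) : kalg const_tambara :=
  @KAlg const_tambara (FPTambara (gring_of A))
    (@fp_map (gring_triv R) (gring_of A) (ra_map A)
       (fun g r => esym (rhE (ga_act A g) r))).

Definition FPHom (A B : gralg) (f : grhom A B) : ahom (FPAlg A) (FPAlg B).
Proof.
refine (@AHom const_tambara (FPAlg A) (FPAlg B)
  (@fp_map (gring_of A) (gring_of B) f (grhE f)) _) => X a.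
by apply: fpP => x; rewrite !ffunE rhE.
Defined.

Section Schemes.
Local Notation GrpR_BG := (BG gT (GrpFetRing R)).
Local Notation GrpK := (GrpFet const_tambara).

Definition rep_gralg (Gam : GrpR_BG) : gralg.
Proof.
refine (@GRAlg (grep (bg_val Gam)) (fun g => yoneda (bg_act Gam g)) _ _).
- by rewrite bg_act1.
- move=> g h; rewrite bg_actM.
  exact: (@yoneda_comp (RAlgCat R) (@finite_etale_ring R) _ _ _
    (bg_act Gam g) (bg_act Gam h)).
Defined.

Lemma rep_grhom_eq (Gam Del : GrpR_BG) (f : chom Gam Del) g :
  rhom_comp (yoneda (bgh_val f)) (yoneda (bg_act Del g)) =
  rhom_comp (yoneda (bg_act Gam g)) (yoneda (bgh_val f)).
Proof.
rewrite -[LHS](@yoneda_comp (RAlgCat R) (@finite_etale_ring R) _ _ _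
  (bg_act Del g) (bgh_val f)).
rewrite -[RHS](@yoneda_comp (RAlgCat R) (@finite_etale_ring R) _ _ _
  (bgh_val f) (bg_act Gam g)).
exact: (congr1 (@yoneda (RAlgCat R) (@finite_etale_ring R) _ _)
  (esym (bgh_eq f g))).
Qed.

Definition rep_grhom (Gam Del : GrpR_BG) (f : chom Gam Del) :
  grhom (rep_gralg Del) (rep_gralg Gam) :=
  @GRHom (rep_gralg Del) (rep_gralg Gam) (yoneda (bgh_val f))
    (fun g x => congr1 (fun h : rhom _ _ => h x) (rep_grhom_eq f g)).

(* The product of the two points i and j of the group functor represented by A.
   When P is the coproduct of A with itself, with inclusions i and j, this is
   the comultiplication of A. *)
Definition comul (C : category) (Q : C -> Prop) (A : grp_ob Q) (P : C)
    (i j : chom A P) : chom A P := gop (glaw A P) i j.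

(* EV is represented by the rings S(G/e), with the cogroup structure induced
   through (S box S)(G/e) = S(G/e) (x) S(G/e), the Weyl action, and the evident
   action on morphisms. *)
Definition is_ev (EV : functor GrpK GrpR_BG) : Prop :=
  exists th : forall S : GrpK,
    @ciso (RAlgCat R) (grep (bg_val (EV S))) (ev_ralg (grep S)),
  [/\ forall (S : GrpK) (P : KAlgCat const_tambara) (i j : chom (grep S) P)
        (Q : RAlgCat R) (i' j' : chom (ev_ralg (grep S) : RAlgCat R) Q),
        is_box_alg i j -> is_tensor_alg i' j' ->
        exists kappa : @ciso (RAlgCat R) Q (ev_ralg P),
        [/\ kappa \oc i' = ev_rhom i, kappa \oc j' = ev_rhom j &
            kappa \oc comul (A := bg_val (EV S)) (i' \oc th S) (j' \oc th S) =
            (ev_rhom (comul (A := S) i j) : chom (_ : RAlgCat R) _) \oc th S],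
      forall (S : GrpK) (g : gT),
        (th S : chom _ _) \oc yoneda (bg_act (EV S) g) =
        (weyl (grep S) g : chom (_ : RAlgCat R) _) \oc th S &
      forall (S T : GrpK) (f : chom S T),
        (th S : chom _ _) \oc yoneda (bgh_val (fmap EV f)) =
        (ev_rhom (yoneda f) : chom (_ : RAlgCat R) _) \oc th T].

(* Phi is represented by the algebras FP(L), with the cogroup structure induced
   through FP(L) box FP(L) = FP(L (x) L). *)
Definition is_FP (Phi : functor GrpR_BG GrpK) : Prop :=
  exists ps : forall Gam : GrpR_BG,
    @ciso (KAlgCat const_tambara) (grep (Phi Gam)) (FPAlg (rep_gralg Gam)),
  (forall (Gam : GrpR_BG) (Q : gralg) (i j : grhom (rep_gralg Gam) Q),
     is_tensor_alg i j ->
     is_box_alg (FPHom i) (FPHom j) /\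
     exists2 d : grhom (rep_gralg Gam) Q,
       grh d = comul (A := bg_val Gam) (P := ga_alg Q : RAlgCat R) i j &
       comul (A := Phi Gam)
         ((FPHom i : chom (_ : KAlgCat const_tambara) _) \oc ps Gam)
         ((FPHom j : chom (_ : KAlgCat const_tambara) _) \oc ps Gam) =
       (FPHom d : chom (_ : KAlgCat const_tambara) _) \oc ps Gam) /\
  (forall (Gam Del : GrpR_BG) (f : chom Gam Del),
     (ps Gam : chom _ _) \oc yoneda (fmap Phi f) =
     (FPHom (rep_grhom f) : chom (_ : KAlgCat const_tambara) _) \oc ps Del).
End Schemes.
End Constant.
End GSets.

(* Main.v *)
Require Import Defs.
From mathcomp Require Import all_boot all_fingroup all_algebra.
From HB Require Import structures.
From mathcomp Require Import boolp.

Set Implicit Arguments.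
Unset Strict Implicit.
Unset Printing Implicit Defensive.
Import GRing.Theory.
Local Open Scope ring_scope.

(* Let |G| be invertible in R. A point x of a finite G-set X amounts to the
   map pt x : G/e -> X, g |-> x g. For a module M over the constant Tambara
   functor, Frobenius reciprocity gives |G| m = sum_x Tr_(pt x) (Res_(pt x)
   m), so M(X) is the set of equivariant maps X -> M(G/e); under this
   identification transfers and norms are sums and products over fibres. Hence
   S |-> S(G/e) is fully faithful from algebras to R-algebras with G-action,
   with inverse FP, and as a functor to bare R-algebras it has the right
   adjoint B |-> FP(Map(G, B)). Through this adjunction, and its analogue for
   modules, the universal properties of box products, Kaehler differentials,
   presentations and group laws are compared with those over R. The Hilbert
   basis theorem is needed for the finite presentation of FP(L) only: a finite
   algebra is a quotient of a finitely generated free one, by a finitely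
   generated ideal. *)

(** * Group laws and quotient rings *)

(** Box products, polynomial algebras and coequalizers are given here by universal properties, and
    over R the competing objects carry no action of G. Descending to R therefore needs more than an
    equivalence with objects with action: a competitor B without action is replaced by Map(G, B),
    and the map obtained is evaluated at the unit of G. Ascending to the constant Tambara functor k,
    the maps supplied over R are equivariant because uniqueness forces it. Group laws show the same
    asymmetry. A law on Hom(S(G/e), B) is wanted for every R-algebra B; it comes from the bijection
    with Hom(S, FP(Map(G, B))). In the other direction Hom(FP(L), T) is the subgroup of equivariant
    maps in Hom(L, T(G/e)). Flatness over k says something only about box products that are at hand.
    The box product of M with a coinduced module can be written down from a tensor product with
    M(G/e) over R, and these box products suffice to deduce flatness over R. *)

Definition linear_of (R : pzRingType) (U V : lmodType R) (f : U -> V)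
    (hf : linear f) : {linear U -> V} :=
  HB.pack f (GRing.isLinear.Build R U V *:%R f hf).

Definition additive_of (U V : zmodType) (f : U -> V)
    (hf : zmod_morphism f) : {additive U -> V} :=
  HB.pack f (GRing.isZmodMorphism.Build U V f hf).

Definition rmorphism_of (A B : comPzRingType) (f : A -> B)
    (hf : zmod_morphism f) (hf' : monoid_morphism f) : {rmorphism A -> B} :=
  HB.pack f (GRing.isZmodMorphism.Build A B f hf)
    (GRing.isMonoidMorphism.Build A B f hf').

Section GroupLaw.
Variables (T : Type) (L : group_law T).
Local Notation "a * b" := (gop L a b).

(** The axioms of [group_law] are one-sided. The right-handed ones follow from this fact, since a
    product [a * ginv L a] is idempotent; so does the preservation of units by multiplicative
    maps. *)
Lemma gop_idem a : a * a = a -> a = gone L.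
Proof. by move=> e; rewrite -[LHS](gop1 L) -(gopV L a) -gopA e. Qed.

Lemma gopVr a : a * ginv L a = gone L.
Proof.
by apply: gop_idem; rewrite gopA -[X in X * _](gopA L a) gopV -gopA gop1.
Qed.

Lemma gopr1 a : a * gone L = a.
Proof. by rewrite -(gopV L a) gopA gopVr gop1. Qed.

Lemma ginv_uniq a b : b * a = gone L -> b = ginv L a.
Proof. by move=> e; rewrite -[b]gopr1 -(gopVr a) gopA e gop1. Qed.
End GroupLaw.

Lemma gop_morph1 (T T' : Type) (L : group_law T) (L' : group_law T')
  (h : T -> T') :
  (forall a b, h (gop L a b) = gop L' (h a) (h b)) -> h (gone L) = gone L'.
Proof. by move=> hM; apply: gop_idem; rewrite -hM gop1. Qed.

Lemma gop_morphV (T T' : Type) (L : group_law T) (L' : group_law T')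
  (h : T -> T') :
  (forall a b, h (gop L a b) = gop L' (h a) (h b)) ->
  forall a, h (ginv L a) = ginv L' (h a).
Proof.
by move=> hM a; apply: ginv_uniq; rewrite -hM gopV (gop_morph1 hM).
Qed.

(** The image of [i] is a subgroup. Both transports of group laws are instances: in one [i] is the
    adjunction bijection into maps to a coinduced algebra, in the other the inclusion of the
    equivariant maps. *)
Lemma group_law_pullback_ex (T T' : Type) (L : group_law T') (i : T -> T') :
  injective i -> (forall a b, exists c, i c = gop L (i a) (i b)) ->
  (exists c, i c = gone L) -> (forall a, exists c, i c = ginv L (i a)) ->
  exists K : group_law T, forall a b, i (gop K a b) = gop L (i a) (i b).
Proof.
move=> inj hM h1 hV.
have [m mE] := choice (fun p : T * T => hM p.1 p.2).
have [v vE] := choice hV; have [e eE] := h1.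
unshelve eexists (@GroupLaw T (fun a b => m (a,
  b)) e v _ _ _) => [a b c|a|a|a b];
  try apply: inj; rewrite !mE /= ?mE /=.
- exact: gopA.
- by rewrite eE gop1.
- by rewrite vE gopV eE.
- by [].
Qed.

Section GroupLawPullback.
Variables (T T' : Type) (L : group_law T') (i : T -> T') (inj : injective i)
  (hM : forall a b, exists c, i c = gop L (i a) (i b))
  (h1 : exists c, i c = gone L) (hV : forall a, exists c, i c = ginv L (i a)).

Definition group_law_pullback : group_law T :=
  sval (cid (group_law_pullback_ex inj hM h1 hV)).

Lemma group_law_pullbackE a b :
  i (gop group_law_pullback a b) = gop L (i a) (i b).
Proof. exact: (svalP (cid (group_law_pullback_ex inj hM h1 hV))). Qed.
End GroupLawPullback.

Section GrpIso.
Variables (C : category) (P : C -> Prop) (A B : grp_ob P).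
Variable e : @ciso C (grep B) (grep A).
Hypothesis eM : forall T (a b : chom (grep A) T),
  gop (glaw A T) a b \oc cito e = gop (glaw B T) (a \oc e) (b \oc e).

Let to_nat (T T' : C) (f : chom T T') (a : chom (grep A) T) :
  (f \oc a) \oc cito e = f \oc (a \oc e).
Proof. by rewrite ccompA. Qed.

Let from_nat (T T' : C) (f : chom T T') (a : chom (grep B) T) :
  (f \oc a) \oc cifrom e = f \oc (a \oc cifrom e).
Proof. by rewrite ccompA. Qed.

Let from_mul (T : C) (a b : chom (grep B) T) :
  gop (glaw B T) a b \oc cifrom e =
  gop (glaw A T) (a \oc cifrom e) (b \oc cifrom e).
Proof.
rewrite -[RHS]ccompm1 -(cifromK e) ccompA eM -!ccompA.
by rewrite (citoK e) !ccompm1.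
Qed.

Definition grp_iso_to : grp_hom A B := @GrpHom _ _ A B _ to_nat eM.
Definition grp_iso_from : grp_hom B A := @GrpHom _ _ B A _ from_nat from_mul.

Definition grp_iso : @ciso (GrpCat P) A B.
Proof.
refine (@CIso (GrpCat P) A B grp_iso_to grp_iso_from _ _);
  apply: grp_hom_ext => T a /=; rewrite -ccompA.
- by rewrite cifromK ccompm1.
- by rewrite citoK ccompm1.
Defined.
End GrpIso.

Section QuotientRing.
Variables (T : Type) (zero one : T) (opp : T -> T) (add mul : T -> T -> T).
Variable E : T -> T -> Prop.
Hypotheses (Erefl : forall a, E a a) (Esym : forall a b, E a b -> E b a)
  (Etrans : forall a b c, E a b -> E b c -> E a c).
Hypotheses (Eopp : forall a b, E a b -> E (opp a) (opp b))
  (Eadd : forall a b c d, E a b -> E c d -> E (add a c) (add b d))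
  (Emul : forall a b c d, E a b -> E c d -> E (mul a c) (mul b d)).
Hypotheses (addA : forall a b c, E (add a (add b c)) (add (add a b) c))
  (addC : forall a b, E (add a b) (add b a))
  (add0 : forall a, E (add zero a) a)
  (addN : forall a, E (add (opp a) a) zero)
  (mulA : forall a b c, E (mul a (mul b c)) (mul (mul a b) c))
  (mulC : forall a b, E (mul a b) (mul b a))
  (mul1 : forall a, E (mul one a) a)
  (mulD : forall a b c, E (mul (add a b) c) (add (mul a c) (mul b c))).

(** Classes are predicates, compared by extensionality, so that [T] may be a bare type such as the
    type of polynomial terms below. *)
Definition quot_car : Type := {c : T -> Prop | exists a, c = E a}.
Definition qpi (a : T) : quot_car := exist _ (E a) (ex_intro _ a erefl).

Lemma qpiP a b : qpi a = qpi b <-> E a b.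
Proof.
split=> [/(congr1 (fun q => sval q b)) /= -> //|ab].
apply: eq_exist => /=; apply: funext => c; apply: propext.
by split=> [|/(Etrans ab)//]; apply/Etrans/Esym.
Qed.

Lemma qpi_surj (q : quot_car) : exists a, qpi a = q.
Proof. by case: q => c [a e]; exists a; apply: eq_exist; rewrite e. Qed.

Definition qrep (q : quot_car) : T := sval (cid (qpi_surj q)).
Lemma qrepK q : qpi (qrep q) = q. Proof. exact: svalP (cid (qpi_surj q)). Qed.
Lemma qrepE a : E (qrep (qpi a)) a. Proof. by apply/qpiP; rewrite qrepK. Qed.

Let qopp x := qpi (opp (qrep x)).
Let qadd x y := qpi (add (qrep x) (qrep y)).
Let qmul x y := qpi (mul (qrep x) (qrep y)).

Let qoppE a : qopp (qpi a) = qpi (opp a).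
Proof. exact/qpiP/Eopp/qrepE. Qed.
Let qaddE a b : qadd (qpi a) (qpi b) = qpi (add a b).
Proof. by apply/qpiP/Eadd; apply: qrepE. Qed.
Let qmulE a b : qmul (qpi a) (qpi b) = qpi (mul a b).
Proof. by apply/qpiP/Emul; apply: qrepE. Qed.

HB.instance Definition _ := gen_eqMixin quot_car.
HB.instance Definition _ := gen_choiceMixin quot_car.
Fact qaddA : associative qadd.
Proof.
move=> x y z; rewrite -(qrepK x) -(qrepK y) -(qrepK z) !qaddE.
exact/qpiP/addA.
Qed.
Fact qaddC : commutative qadd.
Proof. by move=> x y; rewrite -(qrepK x) -(qrepK y) !qaddE; apply/qpiP. Qed.
Fact qadd0 : left_id (qpi zero) qadd.
Proof. by move=> x; rewrite -(qrepK x) !qaddE; apply/qpiP. Qed.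
Fact qaddN : left_inverse (qpi zero) qopp qadd.
Proof. by move=> x; rewrite -(qrepK x) qoppE !qaddE; apply/qpiP. Qed.
HB.instance Definition _ :=
  GRing.isZmodule.Build quot_car qaddA qaddC qadd0 qaddN.
Fact qmulA : associative qmul.
Proof.
move=> x y z; rewrite -(qrepK x) -(qrepK y) -(qrepK z) !qmulE.
exact/qpiP/mulA.
Qed.
Fact qmulC : commutative qmul.
Proof. by move=> x y; rewrite -(qrepK x) -(qrepK y) !qmulE; apply/qpiP. Qed.
Fact qmul1 : left_id (qpi one) qmul.
Proof. by move=> x; rewrite -(qrepK x) !qmulE; apply/qpiP. Qed.
Fact qmulD : left_distributive qmul qadd.
Proof.
move=> x y z; rewrite -(qrepK x) -(qrepK y) -(qrepK z) !(qmulE, qaddE).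
exact/qpiP/mulD.
Qed.
HB.instance Definition _ :=
  GRing.Zmodule_isComPzRing.Build quot_car qmulA qmulC qmul1 qmulD.

Lemma quotient_ring_ex : exists (Q : comPzRingType) (p : T -> Q),
  [/\ forall a b, p a = p b <-> E a b, forall q, exists a, p a = q, p zero = 0,
      p one = 1 & [/\ forall a, p (opp a) = - p a,
      forall a b, p (add a b) = p a + p b &
      forall a b, p (mul a b) = p a * p b]].
Proof.
exists quot_car, qpi; split=> //; first exact: qpiP; first exact: qpi_surj.
by split=> *; rewrite -?qoppE -?qaddE -?qmulE.
Qed.
End QuotientRing.

(** * Free algebras and tensor products *)

Lemma ideal_quotient_ex (S : comPzRingType) (J : S -> Prop) : is_ideal J ->
  exists (Q : comPzRingType) (p : {rmorphism S -> Q}), forall a, p a =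
    0 <-> J a.
Proof.
case=> J0 JD JM; pose E a b := J (a - b).
have JN a : J a -> J (- a) by move/(JM (-1)); rewrite mulN1r.
have Er a : E a a by rewrite /E subrr.
have ErW a b : a = b -> E a b by move=> ->.
have [|||||||||||||Q [p [pE _ p0 p1 [pN pD pM]]]] :=
  @quotient_ring_ex S 0 1 -%R +%R *%R E Er.
- by move=> a b /JN; rewrite opprB.
- by move=> a b c ab /(JD _ _ ab); rewrite addrA subrK.
- by move=> a b /JN; rewrite /E opprD.
- by move=> a b c d ab /(JD _ _ ab); rewrite /E addrACA -opprD.
(* ac - bd = c(a - b) + b(c - d). *)
- move=> a b c d /(JM c) ab /(JM b)/(JD _ _ ab).
  by rewrite /E !mulrBr addrA [c * b]mulrC subrK [c * a]mulrC.
- by move=> *; apply/ErW/addrA.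
- by move=> *; apply/ErW/addrC.
- by move=> *; apply/ErW/add0r.
- by move=> *; apply/ErW/addNr.
- by move=> *; apply/ErW/mulrA.
- by move=> *; apply/ErW/mulrC.
- by move=> *; apply/ErW/mul1r.
- by move=> *; apply/ErW/mulrDl.
have hz : zmod_morphism p by move=> a b; rewrite pD pN.
exists Q, (rmorphism_of hz (conj p1 pM)) => a.
by rewrite -p0 /= pE /E subr0.
Qed.

Section FreeAlgebra.
Variables (R : comPzRingType) (I : Type).

Inductive pterm : Type :=
| PVar of I
| PConst of R
| POpp of pterm
| PAdd of pterm & pterm
| PMul of pterm & pterm.

Fixpoint peval (S : ralg R) (s : I -> S) (t : pterm) : S :=
  match t with
  | PVar i => s i
  | PConst r => ra_map S r
  | POpp t => - peval s t
  | PAdd t u => peval s t + peval s u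
  | PMul t u => peval s t * peval s u
  end.

(* Terms modulo equality of all evaluations; unlike {mpoly R[n]} this allows R
   to be the zero ring. *)
Lemma free_ralg_ex : exists (P : ralg R) (x : I -> P),
  forall (S : ralg R) (s : I -> S), exists! f : rhom P S, forall i, f (x i) =
    s i.
Proof.
pose E (a b : pterm) := forall (S : ralg R) (s : I -> S), peval s a = peval s b.
have [|||||||||||||Q [p [pE psurj p0 p1 [pN pD pM]]]] :=
  @quotient_ring_ex pterm (PConst 0) (PConst 1) POpp PAdd PMul E (fun _ _ _ =>
    erefl).
- by move=> a b h S s.
- by move=> a b c h h' S s; rewrite h.
- by move=> a b h S s /=; rewrite h.
- by move=> a b c d h h' S s /=; rewrite h h'.
- by move=> a b c d h h' S s /=; rewrite h h'.
- by move=> a b c S s /=; rewrite addrA.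
- by move=> a b S s /=; rewrite addrC.
- by move=> a S s /=; rewrite rmorph0 add0r.
- by move=> a S s /=; rewrite rmorph0 addNr.
- by move=> a b c S s /=; rewrite mulrA.
- by move=> a b S s /=; rewrite mulrC.
- by move=> a S s /=; rewrite rmorph1 mul1r.
- by move=> a b c S s /=; rewrite mulrDl.
have cz : zmod_morphism (fun r => p (PConst r)).
  by move=> a b; rewrite -pN -pD; apply/pE => S s /=; rewrite rmorphB.
have cm : monoid_morphism (fun r => p (PConst r)).
  by split=> // a b; rewrite -pM; apply/pE => S s /=; rewrite rmorphM.
pose P := @RAlg R Q (rmorphism_of cz cm).
exists P, (fun i => p (PVar i)) => S s.
have [r rK] := choice psurj.
pose f (q : P) : S := peval s (r q).
have fE t : f (p t) = peval s t by apply: (proj1 (pE _ _) (rK (p t))).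
have fz : zmod_morphism f.
  by move=> a b; rewrite -(rK a) -(rK b) -pN -pD !fE.
have fm : monoid_morphism f.
  split=> [|a b]; first by rewrite -p1 fE /= rmorph1.
  by rewrite -(rK a) -(rK b) -pM !fE.
have fr c : rmorphism_of fz fm (ra_map P c) = ra_map S c by rewrite /= fE.
exists (RHom fr); split=> [i|g gx]; first by rewrite /= fE.
apply: rhom_ext => q /=; rewrite -(rK q) fE.
elim: (r q) => [i|c|t IH|t IH u IH'|t IH u IH'] /=.
- by rewrite gx.
- by rewrite -[LHS](rhE g c).
- by rewrite pN rmorphN IH.
- by rewrite pD rmorphD IH IH'.
- by rewrite pM rmorphM IH IH'.
Qed.
End FreeAlgebra.

Lemma idfun_bij (V : Type) : bijective (@idfun V).
Proof. by exists id. Qed.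

Section Tensor.
Variable R : comPzRingType.

Lemma linear_can (U V : lmodType R) (e : {linear U -> V}) (g : V -> U) :
  cancel e g -> cancel g e -> linear g.
Proof. by move=> eK gK a x y; apply: (can_inj eK); rewrite linearP !gK. Qed.

Section Bilinear.
Variables (M N P : lmodType R) (t : M -> N -> P).
Hypothesis tb : is_bilinear t.

Lemma bilinear_zmodl n : zmod_morphism (t^~ n).
Proof.
move=> m m'; rewrite -scaleN1r addrC; case: tb => -> _.
by rewrite scaleN1r addrC.
Qed.

Lemma bilinear_zmodr m : zmod_morphism (t m).
Proof.
move=> n n'; rewrite -scaleN1r addrC; case: tb => _ ->.
by rewrite scaleN1r addrC.
Qed.

Lemma bilinear0r m : t m 0 = 0.
Proof. exact: (raddf0 (additive_of (bilinear_zmodr m))). Qed.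

Lemma bilinear_suml (I : Type) (r : seq I) (Q : pred I) (F : I -> M) n :
  t (\sum_(i <- r | Q i) F i) n = \sum_(i <- r | Q i) t (F i) n.
Proof. exact: (raddf_sum (additive_of (bilinear_zmodl n))). Qed.

Lemma bilinear_sumr (I : Type) (r : seq I) (Q : pred I) (F : I -> N) m :
  t m (\sum_(i <- r | Q i) F i) = \sum_(i <- r | Q i) t m (F i).
Proof. exact: (raddf_sum (additive_of (bilinear_zmodr m))). Qed.
End Bilinear.

(** Besides genuine isomorphisms this serves to pass between modules that have the same elements and
    operations but are different terms. *)
Lemma is_tensor_iso (M M' N N' P P' : lmodType R) (t : M -> N -> P)
    (t' : M' -> N' -> P') (eM : {linear M' -> M}) (eN : {linear N' -> N})
    (eP : {linear P' -> P}) :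
  bijective eM -> bijective eN -> bijective eP ->
  (forall m n, eP (t' m n) = t (eM m) (eN n)) -> is_tensor t -> is_tensor t'.
Proof.
move=> [gM MK KM] [gN NK KN] [gP PK KP] et [[tl tr] tu].
have lM := linear_can MK KM; have lN := linear_can NK KN.
have lP := linear_can PK KP.
split=> [|Q s [sl sr]].
  by split=> a m m' n; apply: (can_inj PK); rewrite linearP !et linearP ?tl ?tr.
have [|[f fE] funi] := tu Q (fun m n => s (gM m) (gN n)).
  by split=> a m m' n; rewrite ?lM ?lN ?sl ?sr.
split=> [|f1 f2 e12 p].
  have lf : linear (fun p => f (eP p)) by move=> a x y; rewrite !linearP.
  by exists (linear_of lf) => m n; rewrite /= et fE MK NK.
have l1 : linear (fun p => f1 (gP p)) by move=> a x y; rewrite lP linearP.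
have l2 : linear (fun p => f2 (gP p)) by move=> a x y; rewrite lP linearP.
suff e : linear_of l1 =1 linear_of l2 by have := e (eP p); rewrite /= !PK.
have [|_ u] := tu Q (fun m n => f1 (gP (t m n))).
  by split=> a m m' n; rewrite ?tl ?tr lP linearP.
by apply: u => m n; rewrite /= -(KM m) -(KN n) -et PK; apply: e12.
Qed.

Lemma tensor_uniq (M N P Q : lmodType R) (t : M -> N -> P)
  (f f' : {linear P -> Q}) :
  is_tensor t -> (forall m n, f (t m n) = f' (t m n)) -> f =1 f'.
Proof.
case=> [[tl tr] tu]; have [|_ u] := tu Q (fun m n => f (t m n)); last exact: u.
by split=> a m m' n; rewrite ?tl ?tr linearP.
Qed.

Lemma flat_lmod_iso (M M' : lmodType R) (e : {linear M' -> M}) :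
  bijective e -> flat_lmod M -> flat_lmod M'.
Proof.
move=> be fl A B C i p ip MA MB MC tA tB tC hA hB hC Mi Mp hi hp.
have [g eK gK] := be; have lg := linear_can eK gK.
have tr (X MX : lmodType R) (t : M' -> X -> MX) :
    is_tensor t -> is_tensor (fun m x => t (g m) x).
  move=> ht; have bg : bijective (linear_of lg) by exists e.
  exact: (@is_tensor_iso _ _ _ _ _ _ t (fun m x => t (g m) x)
    (linear_of lg) idfun idfun bg (@idfun_bij _) (@idfun_bij _)).
apply: (fl A B C i p ip MA MB MC _ _ _ (tr _ _ _ hA) (tr _ _ _ hB) (tr _ _ _
  hC)).
- by move=> m a; rewrite hi.
- by move=> m a; rewrite hp.
Qed.

Lemma rhom_compE (A B C : ralg R) (g : rhom B C) (f : rhom A B) a :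
  rhom_comp g f a = g (f a).
Proof. by []. Qed.

Lemma rhom_linear (A B : ralg R) (f : rhom A B) :
  linear (f : ralg_mod A -> ralg_mod B).
Proof. by move=> a x y; rewrite /GRing.scale /= rmorphD rmorphM rhE. Qed.

Definition rhom_lin (A B : ralg R) (f : rhom A B) :
  {linear ralg_mod A -> ralg_mod B} := linear_of (rhom_linear f).

Section Coproduct.
Variables (A B P : ralg R) (i : rhom A P) (j : rhom B P).
Hypothesis ij : is_tensor_alg i j.

Lemma tensor_alg_uniq (C : ralg R) (f g : rhom P C) :
  (forall a, f (i a) = g (i a)) -> (forall b, f (j b) = g (j b)) -> f = g.
Proof.
move=> hi hj; apply: rhom_ext => p.
apply: (tensor_uniq (f := rhom_lin f) (f' := rhom_lin g) ij) => a b.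
by rewrite /= !rmorphM hi hj.
Qed.

(** The universal property concerns modules only. The linear map [h] that it provides is
    multiplicative because [h (x * y)] and [h x * h y] are linear in [x] and in [y] and agree on the
    products [i a * j b]; uniqueness is applied to one variable at a time. *)
Lemma tensor_alg_ex (C : ralg R) (f : rhom A C) (g : rhom B C) :
  exists h : rhom P C, (forall a, h (i a) = f a) /\ (forall b, h (j b) = g b).
Proof.
have [_ /(_ (ralg_mod C) (fun a b => f a * g b))[]] := ij.
  split=> a m m' n; rewrite /GRing.scale /=.
  - by rewrite rmorphD rmorphM rhE mulrDl mulrA.
  - by rewrite rmorphD rmorphM rhE mulrDr mulrCA.
case=> h hE _.
have h1 : h 1 = 1 by have := hE 1 1; rewrite !rmorph1 !mulr1.
have hM x y : h (x * y) = h x * h y.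
  have lL z : linear (fun y : ralg_mod P => h (z * y : P) : ralg_mod C).
    move=> r u v; rewrite -linearP; congr (h _).
    by rewrite /GRing.scale /= mulrDr mulrCA.
  have lR (z : C) : linear (fun y : ralg_mod P => (z * h y : C) : ralg_mod C).
    by move=> r u v; rewrite linearP /GRing.scale /= mulrDr mulrCA.
  suff e a b : h (i a * j b * y) = f a * g b * h y.
    rewrite mulrC [RHS]mulrC.
    apply: (tensor_uniq (f := linear_of (lL y)) (f' :=
      linear_of (lR (h y))) ij).
    by move=> a b /=; rewrite mulrC e hE mulrC.
  apply: (tensor_uniq (f := linear_of (lL (i a * j b)))
    (f' := linear_of (lR (f a * g b))) ij) => a' b' /=.
  by rewrite mulrACA -!rmorphM !hE !rmorphM mulrACA.
have hz : zmod_morphism h by move=> x y; rewrite raddfB.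
have hr r : h (ra_map P r) = ra_map C r.
  by rewrite -[LHS]/(h _) -[ra_map P r]mulr1 -[LHS]/(h (r *: (1 : ralg_mod P)))
    linearZ /= h1 /GRing.scale /= mulr1.
exists (@RHom R P C (rmorphism_of hz (conj h1 hM)) hr); split=> x /=.
- by rewrite -[i x]mulr1 -(rmorph1 j) hE rmorph1 mulr1.
- by rewrite -[j x]mul1r -(rmorph1 i) hE rmorph1 mul1r.
Qed.
End Coproduct.

Lemma tensor_alg_ciso (A B P P' : ralg R) (i : rhom A P) (j : rhom B P)
    (i' : rhom A P') (j' : rhom B P') :
  is_tensor_alg i j -> is_tensor_alg i' j' ->
  exists kappa : @ciso (RAlgCat R) P P',
    rhom_comp (cito kappa) i = i' /\ rhom_comp (cito kappa) j = j'.
Proof.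
move=> h h'; have [f [fi fj]] := tensor_alg_ex h i' j'.
have [g [gi gj]] := tensor_alg_ex h' i j.
have gf : rhom_comp g f = rhom_id P.
  by apply: (tensor_alg_uniq h) => a /=; rewrite ?fi ?fj ?gi ?gj.
have fg : rhom_comp f g = rhom_id P'.
  by apply: (tensor_alg_uniq h') => a /=; rewrite ?gi ?gj ?fi ?fj.
by exists (@CIso (RAlgCat R) P P' f g gf fg); split; apply: rhom_ext => a /=.
Qed.
End Tensor.

(** * Localization of modules *)

Arguments mres {gT k} t {X Y} _.
Arguments mtr {gT k} t {X Y} _.
Arguments tres {gT} t {X Y} _.
Arguments ttr {gT} t {X Y} _.
Arguments tnm {gT} t {X Y} _ _.

Section Points.
Variable gT : finGroupType.
Local Notation e := (gfree gT).

Fact pt_eq (X : gset gT) (x : X) (h g : gT) :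
  gsact X x (h * g)%g = gsact X (gsact X x h) g.
Proof. exact: actM. Qed.

Definition pt (X : gset gT) (x : X) : gmap e X :=
  @GMap gT e X (fun g => gsact X x g) (pt_eq x).

Lemma comp_pt (X Y : gset gT) (f : gmap X Y) x : gmap_comp f (pt x) = pt (f x).
Proof. by apply: gmap_ext => g; rewrite /= gfunE. Qed.

Lemma pt1 : pt (1%g : e) = gmap_id e.
Proof. by apply: gmap_ext => g /=; rewrite mul1g. Qed.

Lemma pt_free (h : e) : pt h = gtrans h.
Proof. by apply: gmap_ext => g. Qed.

Lemma pt_act (X : gset gT) (x : X) g :
  pt (gsact X x g) = gmap_comp (pt x) (gtrans g).
Proof. by apply: gmap_ext => h /=; rewrite actM. Qed.

Section Pullback.
Variables (X Y Z : gset gT) (f : gmap X Y) (g : gmap Z Y).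
Let car := {w : X * Z | f w.1 == g w.2}.
Fact pb_actP (w : car) a :
  f (gsact X (val w).1 a) == g (gsact Z (val w).2 a).
Proof. by rewrite !gfunE (eqP (valP w)). Qed.
Let pb_act (w : car) a : car :=
  exist _ (gsact X (val w).1 a, gsact Z (val w).2 a) (pb_actP w a).
Fact pb_act1 : pb_act^~ 1%g =1 id.
Proof. by move=> w; apply: val_inj; rewrite /= !act1 -surjective_pairing. Qed.
Fact pb_actM : forall w, act_morph pb_act w.
Proof. by move=> w a b; apply: val_inj; rewrite /= !actM. Qed.
Let pb : gset gT := @GSet gT car (TotalAction pb_act1 pb_actM).

Lemma pullback_ex : exists (W : gset gT) (g' : gmap W X) (f' : gmap W Z),
  is_pullback f g g' f'.
Proof.
exists pb, (@GMap gT pb X (fun w => (val w).1) (fun _ _ => erefl)),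
  (@GMap gT pb Z (fun w => (val w).2) (fun _ _ => erefl)).
split=> [w|x z /eqP xz]; first exact/eqP/(valP w).
exists (exist _ (x, z) xz); split=> // -[[x' z'] p] /= [ex ez].
by apply: val_inj; rewrite /= ex ez.
Qed.
End Pullback.

Lemma fp_sumE (L : gring gT) (X : gset gT) (I : Type) (r : seq I) (P : pred I)
    (F : I -> fp L X) x :
  (\sum_(i <- r | P i) F i) x = \sum_(i <- r | P i) F i x.
Proof.
have -> : \sum_(i <- r | P i) F i x = (\sum_(i <- r | P i) fpv (F i)) x.
  by rewrite sum_ffunE.
by congr (fun_of_fin _ x); apply: (big_morph (@fpv gT L X)).
Qed.
End Points.

Section Localization.
Variables (gT : finGroupType) (R : comPzRingType).
Local Notation e := (gfree gT).
Local Notation k := (const_tambara gT R).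

Lemma const_res (X Y : gset gT) (f : gmap X Y) r :
  tres k f (const_fun Y r) = const_fun X r.
Proof. by apply: fpP => x; rewrite !ffunE. Qed.

Lemma const_inv (X : gset gT) (a : k X) x g : a (gsact X x g) = a x.
Proof. exact: (@fpE gT (gring_triv gT R) X a x g). Qed.

Lemma const_res_pt (X : gset gT) (x : X) (a : k X) :
  tres k (pt x) a = const_fun e (a x).
Proof. apply: fpP => g; rewrite !ffunE; apply: const_inv. Qed.

Section Module.
Variable M : tmod k.

(** A G-set over G/e is free on its fibre over 1. Hence the transfers of 1 from the points of that
    fibre add up to 1, and by Frobenius reciprocity [m] is the sum of the transfers of its
    restrictions to them; on each such orbit [p] is an isomorphism. *)
Lemma mtr_over_free (W : gset gT) (p : gmap W e) (m : M W) :
  mtr M p m = \sum_(w | p w == 1%g) mres M (pt w) m.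
Proof.
have mE : \sum_(w | p w == 1%g) mtr M (pt w) (mres M (pt w) m) = m.
  transitivity (\sum_(w | p w == 1%g) (ttr k (pt w) 1 *: m)).
    by apply: eq_bigr => w _; rewrite -mtrZl scale1r.
  rewrite -scaler_suml -[RHS]scale1r; congr (_ *: m).
  apply: fpP => w; rewrite fp_sumE ffunE.
  (* Only one point of the fibre over 1 lies in the orbit of [w], namely w (p w)^-1, and [p w] is
     the only group element that takes it to [w]. *)
  rewrite (bigD1 (gsact W w (p w)^-1%g)) /=; last first.
    by rewrite gfunE /= mulgV.
  rewrite big1 => [|w' /andP[/eqP pw' ne]]; last first.
    rewrite ffunE big1 // => g /eqP wg; case/eqP: ne.
    by rewrite -wg gfunE pw' /= mul1g actK.
  rewrite ffunE addr0 (big_pred1 (p w)) ?ffunE // => g.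
  rewrite /= -actM; apply/eqP/eqP => [/(congr1 p)|->].
    by rewrite gfunE /= -[RHS]mulg1 => /mulgI/(congr1 (mulg (p w)));
      rewrite mulKVg mulg1.
  by rewrite mulVg act1.
rewrite -{1}mE raddf_sum; apply: eq_bigr => w /eqP pw.
by rewrite -mtr_comp comp_pt pw pt1 mtr_id.
Qed.

(** Base change along the point [y] reduces to a transfer to G/e, and the fibre over 1 of the
    pullback is the fibre of [f] over [y]. *)
Lemma mres_mtr (X Y : gset gT) (f : gmap X Y) (m : M X) y :
  mres M (pt y) (mtr M f m) = \sum_(x | f x == y) mres M (pt x) m.
Proof.
have [W [g' [f' pb]]] := pullback_ex f (pt y).
rewrite (mtr_bc pb) mtr_over_free.
have -> : \sum_(x | f x == y) mres M (pt x) m =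
    \sum_(x | f x == pt y 1%g) mres M (pt x) m.
  by apply: eq_bigl => x; rewrite /= act1.
rewrite (fibre_bc _ _ _ pb); apply: eq_bigr => w _.
by rewrite -mres_comp comp_pt.
Qed.

Variable u : R.
Hypothesis uE : #|gT|%:R * u = 1.

(* Frobenius reciprocity: the transfers of 1 from the points of X add up to the
   constant |G|. *)
Lemma mod_average (X : gset gT) (m : M X) :
  m = const_fun X u *: \sum_x mtr M (pt x) (mres M (pt x) m).
Proof.
transitivity (const_fun X u *: \sum_x (ttr k (pt x) 1 *: m)); last first.
  congr (_ *: _); apply: eq_bigr => x _; by rewrite -mtrZl scale1r.
rewrite -scaler_suml scalerA -[LHS]scale1r; congr (_ *: m).
apply: fpP => y; rewrite !ffunE fp_sumE.
transitivity (u * \sum_(x : X) \sum_(g : gT | gsact X x g == y) 1); last first.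
  by congr (_ * _); apply: eq_bigr => x _; rewrite ffunE; apply: eq_bigr => g _;
    rewrite ffunE.
rewrite (exchange_big_dep xpredT) //= (eq_bigr (fun _ => 1)) ?sumr_const
  ?card_ord.
  by rewrite mulrC uE.
move=> g _; rewrite (big_pred1 (gsact X y g^-1%g)) // => x /=.
by apply/eqP/eqP => [<-|->]; rewrite -actM ?mulgV ?mulVg act1.
Qed.

Lemma mod_loc_inj (X : gset gT) (m m' : M X) :
  (forall x, mres M (pt x) m = mres M (pt x) m') -> m = m'.
Proof.
move=> h; rewrite (mod_average m) (mod_average m'); congr (_ *: _).
by apply: eq_bigr => x _; rewrite h.
Qed.

(** The right-hand side of [mod_average], with prescribed local values instead of restrictions. It
    is defined for every [F], equivariant or not. *)
Definition mod_glue (X : gset gT) (F : X -> M e) : M X :=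
  const_fun X u *: \sum_x mtr M (pt x) (F x).

Lemma mod_glueE (X : gset gT) (F : X -> M e) :
  (forall x g, F (gsact X x g) = mres M (gtrans g) (F x)) ->
  forall x, mres M (pt x) (mod_glue F) = F x.
Proof.
move=> FE y; rewrite /mod_glue mresZ const_res raddf_sum /=.
(* The transfer from [x] contributes at [y] one term F (x g) = F y for each g with x g = y. Each g
   occurs for exactly one [x], so there are |G| terms in all, which [u] cancels. *)
transitivity (const_fun e u *: \sum_(x : X) \sum_(g :
  gT | gsact X x g == y) F y).
  congr (_ *: _); apply: eq_bigr => x _; rewrite mres_mtr.
  by apply: eq_bigr => g /eqP <-; rewrite FE pt_free.
rewrite (exchange_big_dep xpredT) //= (eq_bigr (fun _ => F y)); last first.
  move=> g _; rewrite (big_pred1 (gsact X y g^-1%g)) // => x /=.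
  by apply/eqP/eqP => [<-|->]; rewrite -actM ?mulgV ?mulVg act1.
rewrite sumr_const -scaler_nat scalerA -[RHS]scale1r; congr (_ *: _).
by rewrite -(rmorph_nat (@const_fun gT R e)) -rmorphM mulrC uE rmorph1.
Qed.
End Module.
End Localization.

(** * Localization of algebras *)

Section Algebra.
Variables (gT : finGroupType) (R : comPzRingType).
Local Notation e := (gfree gT).
Local Notation k := (const_tambara gT R).
Variable u : R.
Hypothesis uE : #|gT|%:R * u = 1.
Variable S : kalg k.

Lemma alg_loc_inj (X : gset gT) (a b : S X) :
  (forall x, tres S (pt x) a = tres S (pt x) b) -> a = b.
Proof. exact: (@mod_loc_inj _ _ (alg_mod S) u uE). Qed.

Lemma tres_ttr (X Y : gset gT) (f : gmap X Y) (a : S X) y :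
  tres S (pt y) (ttr S f a) = \sum_(x | f x == y) tres S (pt x) a.
Proof. exact: (@mres_mtr _ _ (alg_mod S)). Qed.

Definition alg_glue (X : gset gT) (F : X -> S e) : S X :=
  @mod_glue _ _ (alg_mod S) u X F.

Lemma alg_glueE (X : gset gT) (F : X -> S e) :
  (forall x g, F (gsact X x g) = tres S (gtrans g) (F x)) ->
  forall x, tres S (pt x) (alg_glue F) = F x.
Proof. exact: (@mod_glueE _ _ (alg_mod S) u uE). Qed.

Lemma tres_pt_act (X : gset gT) (a : S X) x g :
  tres S (pt (gsact X x g)) a = tres S (gtrans g) (tres S (pt x) a).
Proof. by rewrite pt_act tres_comp. Qed.

(** The pullback of the points [w] and [w'] is G/e if they lie in one orbit, and is empty otherwise;
    a norm along a map from the empty G-set is 1. *)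
Lemma tres_tnm_pt (W : gset gT) (p : gmap W e) (w w' : W) (c : S e) :
  p w = 1%g -> tres S (pt w') (tnm S (pt w) c) =
  if gsact W w (p w') == w' then tres S (gtrans (p w')) c else 1.
Proof.
move=> pw; have pwE g : p (gsact W w g) = g by rewrite gfunE pw /= mul1g.
case: eqP => [ww'|ne].
  (* Here w' = w (p w'), so left translation by [p w'] lifts the point [w'] to the point [w]. *)
  have pb : is_pullback (pt w) (pt w') (gtrans (p w')) (gmap_id e).
    split=> [h|x z /= xz]; first by rewrite /= -[in RHS]ww' actM.
    exists z; split=> [|z' [_ <-]] //; split=> //.
    by rewrite -[RHS]pwE xz gfunE.
  by rewrite (tnm_bc pb) tnm_id.
have [W1 [g1 [f1 pb1]]] := pullback_ex (pt w) (pt w').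
rewrite (tnm_bc pb1).
have W10 : #|W1| = 0%N.
  apply: eq_card0 => v; apply/idP => _; apply: ne.
  have /= E := proj1 pb1 v; have := congr1 p E; rewrite pwE gfunE /= => E'.
  by apply: (act_inj (gsact W) (f1 v)); rewrite -actM -E'.
have -> : tres S g1 c = 1
  by rewrite (t_empty W10 1) (t_empty W10 (tres S g1 c)).
by rewrite tnm_one.
Qed.

(** Frobenius reciprocity has no multiplicative form, so the decomposition of [b] into norms from
    the points of the fibre over 1 is checked locally, with [alg_loc_inj]. At a point [w'] a single
    factor differs from 1, that of the point of the fibre in the orbit of [w']. *)
Lemma tnm_over_free (W : gset gT) (p : gmap W e) (b : S W) :
  tnm S p b = \prod_(w | p w == 1%g) tres S (pt w) b.
Proof.
have bE : b = \prod_(w | p w == 1%g) tnm S (pt w) (tres S (pt w) b).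
  apply: alg_loc_inj => w'; rewrite rmorph_prod.
  have p1 : p (gsact W w' (p w')^-1%g) = 1%g by rewrite gfunE /= mulgV.
  rewrite (bigD1 (gsact W w' (p w')^-1%g)) /=; last by rewrite p1.
  rewrite (tres_tnm_pt _ _ p1) -actM mulVg act1 eqxx -tres_pt_act -actM mulVg
    act1.
  rewrite big1 ?mulr1 // => w /andP[/eqP pw ne].
  rewrite (tres_tnm_pt _ _ pw); case: eqP => // E; case/eqP: ne.
  by rewrite -[LHS](actK (gsact W) (p w')) E.
rewrite {1}bE (big_morph (tnm S p) (@tnm_mul _ S _ _ p) (@tnm_one _ S _ _ p)).
apply: eq_bigr => w /eqP pw.
by rewrite -tnm_comp comp_pt pw pt1 tnm_id.
Qed.

Lemma tres_tnm (X Y : gset gT) (f : gmap X Y) (a : S X) y :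
  tres S (pt y) (tnm S f a) = \prod_(x | f x == y) tres S (pt x) a.
Proof.
have [W [g' [f' pb]]] := pullback_ex f (pt y).
rewrite (tnm_bc pb) tnm_over_free.
have -> : \prod_(x | f x == y) tres S (pt x) a =
    \prod_(x | f x == pt y 1%g) tres S (pt x) a.
  by apply: eq_bigl => x; rewrite /= act1.
rewrite (fibre_bc _ _ _ pb); apply: eq_bigr => w _.
by rewrite -tres_comp comp_pt.
Qed.
End Algebra.

(** * Coinduced modules *)

Section EvaluationModule.
Variables (gT : finGroupType) (R : comPzRingType).
Local Notation e := (gfree gT).
Local Notation k := (const_tambara gT R).

(** A copy of M(G/e), to carry a module structure over R next to the one over k(G/e). *)
Definition ev_car (M : tmod k) : Type := M e.

Section Structure.
Variable M : tmod k.
HB.instance Definition _ := GRing.Zmodule.copy (ev_car M) (M e).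
Let scale (r : R) (m : ev_car M) : ev_car M := const_fun e r *: (m : M e).
Fact ev_scaleA a b v : scale a (scale b v) = scale (a * b) v.
Proof. by rewrite /scale rmorphM scalerA. Qed.
Fact ev_scale1 : left_id 1 scale.
Proof. by move=> v; rewrite /scale rmorph1 scale1r. Qed.
Fact ev_scaleDr : right_distributive scale +%R.
Proof. by move=> a x y; rewrite /scale scalerDr. Qed.
Fact ev_scaleDl v : {morph scale^~ v : a b / a + b}.
Proof. by move=> a b; rewrite /scale rmorphD scalerDl. Qed.
HB.instance Definition _ := GRing.Zmodule_isLmodule.Build R (ev_car M)
  ev_scaleA ev_scale1 ev_scaleDr ev_scaleDl.
End Structure.

Definition ev_mod (M : tmod k) : lmodType R := ev_car M.

Lemma mres_ptZ (M : tmod k) (X : gset gT) (x : X) (a : k X) (m : M X) :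
  mres M (pt x) (a *: m) = a x *: (mres M (pt x) m : ev_mod M).
Proof. by rewrite mresZ const_res_pt. Qed.

Lemma mres_ptP (M : tmod k) (X : gset gT) (x : X) (a : k X) (m n : M X) :
  mres M (pt x) (a *: m + n) =
  a x *: (mres M (pt x) m : ev_mod M) + mres M (pt x) n.
Proof. by rewrite raddfD mres_ptZ. Qed.

Lemma mres_trans_linear (M : tmod k) (g : gT) :
  linear (mres M (gtrans g) : ev_mod M -> ev_mod M).
Proof. by move=> a x y; rewrite raddfD mresZ const_res. Qed.

Lemma mres_pt_act (M : tmod k) (X : gset gT) (m : M X) x g :
  mres M (pt (gsact X x g)) m = mres M (gtrans g) (mres M (pt x) m).
Proof. by rewrite pt_act mres_comp. Qed.

Lemma mres_pt1 (M : tmod k) (m : M e) : mres M (pt (1%g : e)) m = m.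
Proof. by rewrite pt1 mres_id. Qed.

Lemma mhom_ev_linear (M N : tmod k) (f : mhom M N) :
  linear (f e : ev_mod M -> ev_mod N).
Proof. by move=> a x y; rewrite linearP. Qed.
End EvaluationModule.

(* Right adjoint to evaluation at G/e; an equivariant map X -> Map(G, A) is
   just a map X -> A. *)
Section Coinduction.
Variables (gT : finGroupType) (R : comPzRingType) (A : lmodType R).
Local Notation e := (gfree gT).
Local Notation k := (const_tambara gT R).

Definition co_car (X : gset gT) : Type := {ffun X -> A}.

Section Level.
Variable X : gset gT.
HB.instance Definition _ := GRing.Zmodule.copy (co_car X) {ffun X -> A}.
Let scale (a : k X) (m : co_car X) : co_car X :=
  [ffun x => a x *: (m : {ffun X -> A}) x].
Fact co_scaleA a b v : scale a (scale b v) = scale (a * b) v.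
Proof. by apply/ffunP => x; rewrite !ffunE scalerA. Qed.
Fact co_scale1 : left_id 1 scale.
Proof. by move=> v; apply/ffunP => x; rewrite !ffunE scale1r. Qed.
Fact co_scaleDr : right_distributive scale +%R.
Proof. by move=> a v w; apply/ffunP => x; rewrite !ffunE scalerDr. Qed.
Fact co_scaleDl v : {morph scale^~ v : a b / a + b}.
Proof. by move=> a b; apply/ffunP => x; rewrite !ffunE scalerDl. Qed.
HB.instance Definition _ := GRing.Zmodule_isLmodule.Build (k X) (co_car X)
  co_scaleA co_scale1 co_scaleDr co_scaleDl.
End Level.

Section Maps.
Variables (X Y : gset gT) (f : gmap X Y).
Definition co_res (m : co_car Y) : co_car X := [ffun x => m (f x)].
Definition co_tr (m : co_car X) : co_car Y :=
  [ffun y => \sum_(x | f x == y) m x].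
Fact co_res_zmod : zmod_morphism co_res.
Proof. by move=> a b; apply/ffunP => x; rewrite !ffunE. Qed.
Fact co_tr_zmod : zmod_morphism co_tr.
Proof.
move=> a b; apply/ffunP => x; rewrite !ffunE -sumrB.
by apply: eq_bigr => y _; rewrite !ffunE.
Qed.
End Maps.

Definition CoMod : tmod k.
Proof.
refine (@TMod gT k (fun X => co_car X)
  (fun X Y f => additive_of (co_res_zmod f)) (fun X Y f => additive_of
    (co_tr_zmod f))
  _ _ _ _ _ _ _ _ _ _).
- by move=> X m; apply/ffunP => x; rewrite !ffunE.
- by move=> X m; apply/ffunP => x; rewrite !ffunE /= big_pred1_eq.
- by move=> X Y Z g f m; apply/ffunP => x; rewrite !ffunE.
- move=> X Y Z g f m; apply/ffunP => z; rewrite !ffunE /= fibre_comp.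
  by apply: eq_bigr => y _; rewrite ffunE.
- by move=> X X0 m; apply/ffunP => x; have := fintype0 x X0.
- move=> X Y m n.
  exists ([ffun z : gsum X Y => match z with inl x => m x | inr y => n y end]).
  split=> [|d [ea eb]].
    by split; apply/ffunP => x; rewrite !ffunE.
  by apply/ffunP => -[] z; rewrite !ffunE -?ea -?eb !ffunE.
- move=> X Y Z W f g g' f' pb m; apply/ffunP => z.
  by rewrite !ffunE (fibre_bc _ _ _ pb); apply: eq_bigr => w _; rewrite !ffunE.
- by move=> X Y f a m; apply/ffunP => x; rewrite !ffunE.
- move=> X Y f a m; apply/ffunP => y; rewrite !ffunE scaler_suml.
  by apply: eq_bigr => x /eqP <-; rewrite !ffunE.
- move=> X Y f a m; apply/ffunP => y; rewrite !ffunE scaler_sumr.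
  by apply: eq_bigr => x /eqP <-; rewrite !ffunE.
Defined.
End Coinduction.

Section CoinductionTheory.
Variables (gT : finGroupType) (R : comPzRingType) (A : lmodType R).
Local Notation e := (gfree gT).

Definition co_at (X : gset gT) (a : CoMod gT A X) : X -> A :=
  fun_of_fin (a : {ffun X -> A}).

Lemma coP (X : gset gT) (a b : CoMod gT A X) : co_at a =1 co_at b -> a = b.
Proof. by move=> ab; apply/ffunP. Qed.

Lemma co_at_linear (X : gset gT) r (m n : CoMod gT A X) x :
  co_at (r *: m + n) x = r x *: co_at m x + co_at n x.
Proof. by rewrite /co_at [LHS]ffunE [in LHS]ffunE. Qed.

Lemma co_at_res (X Y : gset gT) (f : gmap X Y) (m : CoMod gT A Y) x :
  co_at (mres (CoMod gT A) f m) x = co_at m (f x).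
Proof. by rewrite /co_at !ffunE. Qed.

Lemma co_at_tr (X Y : gset gT) (f : gmap X Y) (m : CoMod gT A X) y :
  co_at (mtr (CoMod gT A) f m) y = \sum_(x | f x == y) co_at m x.
Proof. by rewrite /co_at !ffunE. Qed.

Lemma co_atE (X : gset gT) (F : X -> A) x :
  co_at ([ffun y => F y] : CoMod gT A X) x = F x.
Proof. by rewrite /co_at ffunE. Qed.

Lemma co_at_zmod (X : gset gT) x : zmod_morphism (@co_at X ^~ x).
Proof. by move=> m n; rewrite /co_at !ffunE. Qed.

Lemma co_at_sum (X : gset gT) (I : Type) (r : seq I) (P : pred I)
    (F : I -> CoMod gT A X) x :
  co_at (\sum_(i <- r | P i) F i) x = \sum_(i <- r | P i) co_at (F i) x.
Proof. exact: (raddf_sum (additive_of (@co_at_zmod X x))). Qed.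
End CoinductionTheory.

(** * Box products and flatness *)

Section Modules.
Variables (gT : finGroupType) (R : comPzRingType).
Local Notation e := (gfree gT).
Local Notation k := (const_tambara gT R).
Variable u : R.
Hypothesis uE : #|gT|%:R * u = 1.

Lemma mhom_loc (M N : tmod k) (f : mhom M N) (X : gset gT) (m : M X) x :
  mres N (pt x) (f X m) = f e (mres M (pt x) m).
Proof. by rewrite mh_res. Qed.

Lemma mhom_lift (P Q : tmod k) (phi : {linear ev_mod P -> ev_mod Q}) :
  (forall g (p : P e), phi (mres P (gtrans g) p) = mres Q (gtrans g) (phi p)) ->
  exists f : mhom P Q, forall X (p : P X) x,
    mres Q (pt x) (f X p) = phi (mres P (pt x) p).
Proof.
move=> phiE.
pose f X (p : P X) : Q X := mod_glue u (fun x => phi (mres P (pt x) p) : Q e).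
have fE X (p : P X) x : mres Q (pt x) (f X p) = phi (mres P (pt x) p).
  by apply: (mod_glueE uE) => y g; rewrite mres_pt_act phiE.
have fl X : linear (f X).
  move=> a m n; apply: (mod_loc_inj uE) => x.
  by rewrite mres_ptP !fE mres_ptP linearP.
have fr X Y (h : gmap X Y) m : f X (mres P h m) = mres Q h (f Y m).
  by apply: (mod_loc_inj uE) => x; rewrite fE -!mres_comp !comp_pt fE.
have ft X Y (h : gmap X Y) m : f Y (mtr P h m) = mtr Q h (f X m).
  apply: (mod_loc_inj uE) => y; rewrite fE !mres_mtr raddf_sum.
  by apply: eq_bigr => x _; rewrite fE.
by exists (@MHom _ _ P Q (fun X => linear_of (fl X)) fr ft) => X p x;
  rewrite /= fE.
Qed.

Lemma mhom_ev_inj (P Q : tmod k) (f f' : mhom P Q) :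
  f e =1 f' e -> forall X, f X =1 f' X.
Proof.
by move=> ff X p; apply: (mod_loc_inj uE) => x; rewrite !mhom_loc ff.
Qed.

Lemma pairing_ev_bilinear (M N P : tmod k) (t : forall X, M X -> N X -> P X) :
  is_pairing t -> @is_bilinear R (ev_mod M) (ev_mod N) (ev_mod P) (t e).
Proof. by case=> /(_ e)[tl tr] _ _ _; split=> a m m' n; rewrite ?tl ?tr. Qed.

(** The adjunction for pairings: [t] is not assumed equivariant, which the coinduced target absorbs.
    [mhom_to_co] is the analogue for linear maps. *)
Lemma pairing_co (M N : tmod k) (Q : lmodType R)
  (t : ev_mod M -> ev_mod N -> Q) :
  is_bilinear t ->
  is_pairing (fun X (m : M X) (n : N X) =>
    [ffun x => t (mres M (pt x) m) (mres N (pt x) n)] : CoMod gT Q X).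
Proof.
move=> tb; have [tl tr] := tb.
split.
- move=> X; split=> a m m' n; apply/ffunP => x; rewrite !ffunE mres_ptP.
    exact: tl.
  exact: tr.
- move=> X Y f m n; apply/ffunP => x; rewrite !ffunE.
  by rewrite -!mres_comp !comp_pt.
- move=> X Y f m n; apply/ffunP => y; rewrite !ffunE mres_mtr.
  rewrite (bilinear_suml tb).
  by apply: eq_bigr => x /eqP <-; rewrite ffunE -mres_comp comp_pt.
- move=> X Y f m n; apply/ffunP => y; rewrite !ffunE mres_mtr.
  rewrite (bilinear_sumr tb).
  by apply: eq_bigr => x /eqP <-; rewrite ffunE -mres_comp comp_pt.
Qed.

Lemma mhom_to_co (P : tmod k) (Q : lmodType R) (phi : {linear ev_mod P -> Q}) :
  exists f : mhom P (CoMod gT Q), forall X (p : P X),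
    f X p = [ffun x => phi (mres P (pt x) p)].
Proof.
pose f X (p : P X) : co_car Q X := [ffun x => phi (mres P (pt x) p)].
have fl X : linear (f X).
  by move=> a m n; apply/ffunP => x; rewrite !ffunE mres_ptP linearP.
have fr X Y (h : gmap X Y) m : f X (mres P h m) = mres (CoMod gT Q) h (f Y m).
  by apply/ffunP => x; rewrite !ffunE -!mres_comp !comp_pt.
have ft X Y (h : gmap X Y) m : f Y (mtr P h m) = mtr (CoMod gT Q) h (f X m).
  apply/ffunP => y; rewrite !ffunE !mres_mtr raddf_sum.
  by apply: eq_bigr => x _; rewrite ffunE.
by exists (@MHom _ _ P (CoMod gT Q) (fun X => linear_of (fl X)) fr ft).
Qed.

(** A test module [Q] over R is replaced by the coinduced module [CoMod gT Q]; the linear map sought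
    is the resulting map at level G/e, followed by evaluation at 1. *)
Lemma box_ev_tensor (M N P : tmod k) (t : forall X, M X -> N X -> P X) :
  is_box t -> @is_tensor R (ev_mod M) (ev_mod N) (ev_mod P) (t e).
Proof.
case=> tp tu; split; first exact: pairing_ev_bilinear.
move=> Q s sb; have [[F FE] _] := tu _ _ (pairing_co sb); split.
  have lF : linear (fun p : ev_mod P => co_at (F e p) (1%g : e)).
    by move=> a x y; rewrite linearP co_at_linear ffunE.
  by exists (linear_of lF) => m n; rewrite /= FE /co_at ffunE !mres_pt1.
move=> f f' ff' p; have [F1 F1E] := mhom_to_co f;
  have [F2 F2E] := mhom_to_co f'.
have [_ E] := tu _ _ (pairing_co (Q := Q) sb).
have {}E : F1 e p = F2 e p.
  apply: E => X m n; rewrite F1E F2E; apply/ffunP => x; rewrite !ffunE.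
  by rewrite (pairing_res tp) ff'.
have := congr1 (fun h => co_at h (1%g : e)) E.
by rewrite F1E F2E /co_at !ffunE mres_pt1.
Qed.

(** The linear map on G/e given by the tensor product commutes with the Weyl actions on the elements
    [t e m n], hence everywhere by uniqueness, and so it lifts to all levels. *)
Lemma tensor_ev_box (M N P : tmod k) (t : forall X, M X -> N X -> P X) :
  is_pairing t -> @is_tensor R (ev_mod M) (ev_mod N) (ev_mod P) (t e) ->
    is_box t.
Proof.
move=> tp te; split=> // Q s sp; split=> [|f f' ff']; last first.
  apply: mhom_ev_inj => p.
  by apply: (tensor_uniq (f := linear_of (mhom_ev_linear f))
    (f' := linear_of (mhom_ev_linear f')) te) => m n; exact: ff'.
have [_ /(_ (ev_mod Q) (s e) (pairing_ev_bilinear sp))[[phi phiE] _]] := te.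
have [|F FE] := mhom_lift (phi := phi).
  move=> g p.
  have l1 : linear (fun p : ev_mod P => phi (mres P (gtrans g) p)).
    by move=> a x y; rewrite mres_trans_linear linearP.
  have l2 : linear (fun p : ev_mod P => mres Q (gtrans g) (phi p) : ev_mod Q).
    by move=> a x y; rewrite linearP mres_trans_linear.
  apply: (tensor_uniq (f := linear_of l1) (f' := linear_of l2) te) => m n /=.
  by rewrite (pairing_res tp) !phiE (pairing_res sp).
exists F => X m n; apply: (mod_loc_inj uE) => x.
by rewrite FE (pairing_res tp) phiE (pairing_res sp).
Qed.

(** A projection formula, which provides the box products against which flatness is tested. By
    [tensor_ev_box] only level G/e matters, where a coinduced module is a direct sum of copies of
    [A] indexed by G. On the copy at g the pairing is [t] with its first argument translated by g,
    so it is a tensor product there. *)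
Lemma box_co (M : tmod k) (A B : lmodType R) (t : ev_mod M -> A -> B) :
  is_tensor t ->
  is_box (fun X (m : M X) (a : CoMod gT A X) =>
    [ffun x => t (mres M (pt x) m) (co_at a x)] : CoMod gT B X).
Proof.
move=> tt; have [tb tu] := tt; have [tl tr] := tb.
have tp : is_pairing (fun X (m : M X) (a : CoMod gT A X) =>
    [ffun x => t (mres M (pt x) m) (co_at a x)] : CoMod gT B X).
  split.
  - move=> X; split=> a m m' n; apply: coP => x; rewrite co_at_linear.
      by rewrite !co_atE mres_ptP tl.
    by rewrite co_atE co_at_linear tr !co_atE.
  - move=> X Y f m n; apply: coP => x; rewrite !(co_at_res, co_atE).
    by rewrite -!mres_comp !comp_pt.
  - move=> X Y f m n; apply: coP => y; rewrite co_at_tr !co_atE mres_mtr.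
    rewrite (bilinear_suml tb).
    by apply: eq_bigr => x /eqP <-; rewrite co_atE co_at_res.
  - move=> X Y f m n; apply: coP => y; rewrite co_at_tr co_atE co_at_tr.
    rewrite (bilinear_sumr tb).
    by apply: eq_bigr => x /eqP <-; rewrite co_atE -mres_comp comp_pt.
apply: (tensor_ev_box tp).
pose delta (V : lmodType R) (g : gT) (v : V) : ev_mod (CoMod gT V) :=
  [ffun h => if h == g then v else 0].
have dl V g : linear (@delta V g).
  move=> a x y; apply: coP => h; rewrite co_at_linear !co_atE ffunE.
  by case: eqP => _ //; rewrite scaler0 addr0.
have dsum V (a : ev_mod (CoMod gT V)) : a = \sum_g delta V g (co_at a g).
  apply: coP => h; rewrite co_at_sum (bigD1 h) //= co_atE eqxx big1 ?addr0 //.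
  by move=> g /negPf hg; rewrite co_atE eq_sym hg.
have tdelta g m a : [ffun x => t (mres M (pt (x :
  e)) m) (co_at (delta A g a) x)]
    = delta B g (t (mres M (gtrans g) m) a).
  apply: coP => h; rewrite !co_atE; case: eqP => [->|_];
    last exact: (bilinear0r tb).
  by rewrite pt_free.
have trK g (m : M e) : mres M (gtrans g) (mres M (gtrans g^-1%g) m) = m.
  rewrite -mres_comp -[RHS]mres_id; congr (mres M _ m).
  by apply: gmap_ext => h; rewrite /= mulKg.
split; first exact: (pairing_ev_bilinear tp).
move=> Q s sb; have [sl sr] := sb; split.
  (* Translating by g^-1 beforehand cancels the translation by g in the pairing. *)
  have h g : exists f : {linear B -> Q}, forall m a,
      f (t m a) = s (mres M (gtrans g^-1%g) m) (delta A g a).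
    have [|[f fE] _] := tu Q (fun m a => s (mres M (gtrans g^-1%g) m) (delta A g
      a)).
      by split=> a m m' n; rewrite ?mres_trans_linear ?dl ?sl ?sr.
    by exists f.
  have [f fE] := choice h.
  have lf : linear (fun b : ev_mod (CoMod gT B) =>
      \sum_g f g (co_at b g)).
    move=> r x y; rewrite scaler_sumr -big_split; apply: eq_bigr => g _ /=.
    by rewrite co_at_linear ffunE linearP.
  exists (linear_of lf) => m a /=.
  rewrite [in RHS](dsum _ a) (bilinear_sumr sb).
  apply: eq_bigr => g _; rewrite co_atE fE; congr (s _ _).
  by rewrite pt_free -{2}(trK g^-1%g m) invgK.
move=> f f' ff' b; rewrite (dsum _ b) !raddf_sum; apply: eq_bigr => g _.
have l1 (F : {linear ev_mod (CoMod gT B) -> Q}) :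
  linear (fun v => F (delta B g v)).
  by move=> r x y; rewrite dl linearP.
apply: (tensor_uniq (f := linear_of (l1 f)) (f' :=
  linear_of (l1 f')) tt) => m a /=.
by rewrite -{1 2}(trK g m) -tdelta ff'.
Qed.

(** Injectivity is local. For the existence of preimages, local ones are chosen at the points of X
    with no regard to equivariance; the averaged sum of their transfers is a preimage, since its
    image is the average of the transfers of the restrictions of the given element. *)
Lemma ev_short_exact (A B C : tmod k) (i : mhom A B) (p : mhom B C) :
  @short_exact_lin R (ev_mod A) (ev_mod B) (ev_mod C)
    (linear_of (mhom_ev_linear i)) (linear_of (mhom_ev_linear p)) ->
  short_exact i p.
Proof.
case=> inj surj ex X.
have avg (V W : tmod k) (f : mhom V W) (w : W X) (v : X -> V e) :
    (forall x, f e (v x) = mres W (pt x) w) ->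
    exists v0, f X v0 = w.
  move=> vE; exists (const_fun X u *: \sum_x mtr V (pt x) (v x)).
  rewrite linearZ raddf_sum [RHS](mod_average uE) /=; congr (_ *: _).
  by apply: eq_bigr => x _; rewrite mh_tr vE.
split=> [a a' aa'|c|b].
- apply: (mod_loc_inj uE) => x; apply: inj.
  by rewrite /= -!mhom_loc aa'.
- have [b bE] := choice (fun x => surj (mres C (pt x) c)).
  by have [b0 b0E] := avg _ _ p c b bE; exists b0.
- split=> [pb|[a <-]].
    have h x : exists a, i e a = mres B (pt x) b.
      by apply/(ex (mres B (pt x) b)); rewrite /= -mhom_loc pb raddf0.
    have [a aE] := choice h.
    by have [a0 a0E] := avg _ _ i b a aE; exists a0.
  apply: (mod_loc_inj uE) => x; rewrite !mhom_loc raddf0.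
  by apply/(ex _); exists (mres A (pt x) a).
Qed.

Lemma short_exact_ev (A B C : tmod k) (i : mhom A B) (p : mhom B C) :
  short_exact i p ->
  @short_exact_lin R (ev_mod A) (ev_mod B) (ev_mod C)
    (linear_of (mhom_ev_linear i)) (linear_of (mhom_ev_linear p)).
Proof. by move=> /(_ e). Qed.

Lemma flat_tmod_ev (M : tmod k) : flat_lmod (ev_mod M) -> flat_tmod M.
Proof.
move=> fl A B C i p ip MA MB MC tA tB tC hA hB hC Mi Mp hi hp.
apply: ev_short_exact.
apply: (fl _ _ _ _ _ (short_exact_ev ip) _ _ _ _ _ _ (box_ev_tensor hA)
  (box_ev_tensor hB) (box_ev_tensor hC)) => m a /=; [exact: hi | exact: hp].
Qed.

Lemma co_map (A B : lmodType R) (f : {linear A -> B}) :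
  exists F : mhom (CoMod gT A) (CoMod gT B), forall X (a : CoMod gT A X),
    F X a = [ffun x => f (co_at a x)].
Proof.
pose F X (a : CoMod gT A X) : CoMod gT B X := [ffun x => f (co_at a x)].
have fl X : linear (F X).
  by move=> r m n; apply: coP => x; rewrite !(co_at_linear, co_atE) linearP.
have fr X Y (h : gmap X Y) m :
    F X (mres (CoMod gT A) h m) = mres (CoMod gT B) h (F Y m).
  by apply: coP => x; rewrite !(co_at_res, co_atE).
have ft X Y (h : gmap X Y) m : F Y (mtr (CoMod gT A) h m) =
  mtr (CoMod gT B) h (F X m).
  apply: coP => y; rewrite !(co_at_tr, co_atE) raddf_sum.
  by apply: eq_bigr => x _; rewrite co_atE.
by exists (@MHom _ _ (CoMod gT A) (CoMod gT B) (fun X => linear_of (fl X)) fr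
  ft).
Qed.

(** A short exact sequence over R is coinduced to one over k, whose box products with [M] are known
    from [box_co]; the conclusion is read off at level G/e. *)
Lemma flat_ev_tmod (M : tmod k) : flat_tmod M -> flat_lmod (ev_mod M).
Proof.
move=> fl A B C i p [inj surj ex] MA MB MC tA tB tC hA hB hC Mi Mp hi hp.
have [I IE] := co_map i; have [P PE] := co_map p.
have [MI MIE] := co_map Mi; have [MP MPE] := co_map Mp.
have val (V : lmodType R) (X : gset gT) (a b : CoMod gT V X) x :
  a = b -> co_at a x = co_at b x by move=> ->.
have IP : short_exact I P.
  move=> X; split=> [a a' |c|b].
  - rewrite !IE => E; apply: coP => x; apply: inj.
    by have := val _ _ _ _ x E; rewrite !co_atE.
  - have [b bE] := choice (fun x => surj (co_at c x)).
    exists [ffun x => b x]; rewrite PE; by apply: coP => x; rewrite !co_atE bE.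
  - split=> [|[a <-]].
      rewrite PE => E.
      have h x : exists a, i a = co_at b x.
        by apply/ex; have := val _ _ _ _ x E; rewrite co_atE => ->;
          apply: (raddf0 (additive_of (@co_at_zmod _ _ C X x))).
      have [a aE] := choice h.
      by exists [ffun x => a x]; rewrite IE; apply: coP => x;
        rewrite !co_atE aE.
    rewrite PE IE; apply: coP => x; rewrite !co_atE.
    apply/ex.
    by exists (co_at a x).
have [] := fl _ _ _ _ _ IP _ _ _ _ _ _ (box_co hA) (box_co hB) (box_co hC) MI MP
  _ _ e.
- by move=> X m a; rewrite MIE IE; apply: coP => x; rewrite !co_atE hi.
- by move=> X m a; rewrite MPE PE; apply: coP => x; rewrite !co_atE hp.
(* Constant functions and evaluation at 1 exhibit [V] as a retract of its coinduced module at level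
   G/e, naturally in [V]; exactness passes to it. *)
pose cst (V : lmodType R) (v : V) : CoMod gT V e := [ffun=> v].
move=> inj' surj' ex'; split=> [a a' aa'|c|b].
- suff /(val _ _ _ _ (1%g : e)) : cst _ a = cst _ a' by rewrite !co_atE.
  by apply: inj'; rewrite !MIE; apply: coP => x; rewrite !co_atE.
- have [b /(val _ _ _ _ (1%g : e))] := surj' (cst _ c).
  by rewrite MPE !co_atE => bE; exists (co_at b (1%g : e)).
- split=> [pb|[a <-]].
    have [|a /(val _ _ _ _ (1%g : e))] := proj1 (ex' (cst _ b)).
      by rewrite MPE; apply: coP => x; rewrite !co_atE pb.
    by rewrite MIE !co_atE => aE; exists (co_at a (1%g : e)).
  have := proj2 (ex' (MI e (cst _ a))) (ex_intro _ _ erefl).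
  by rewrite MPE MIE => /(val _ _ _ _ (1%g : e)); rewrite !co_atE.
Qed.

End Modules.

(** * Algebras with an action of the group *)

Section EvaluationAlgebra.
Variables (gT : finGroupType) (R : comPzRingType).
Local Notation e := (gfree gT).
Local Notation k := (const_tambara gT R).

Lemma weylE (S : kalg k) g (s : S e) : weyl S g s = tres S (gtrans g) s.
Proof. by []. Qed.

Lemma weyl1 (S : kalg k) : weyl S 1%g = rhom_id (ev_ralg S).
Proof.
apply: rhom_ext => s; rewrite weylE -[RHS]tres_id; congr (tres S _ s).
by apply: gmap_ext => g /=; rewrite mul1g.
Qed.

Lemma weylM (S : kalg k) g h :
  weyl S (g * h)%g = rhom_comp (weyl S h) (weyl S g).
Proof.
apply: rhom_ext => s; rewrite /= -tres_comp; congr (tres S _ s).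
by apply: gmap_ext => x /=; rewrite mulgA.
Qed.

Definition ev_gralg (S : kalg k) : gralg gT R := GRAlg (weyl1 S) (@weylM S).

Lemma ev_weyl (S T : kalg k) (f : ahom S T) g s :
  ev_rhom f (weyl S g s) = weyl T g (ev_rhom f s).
Proof. by rewrite /= th_res. Qed.

Lemma ev_rhom_comp (S T U : kalg k) (f : ahom T U) (g : ahom S T) :
  ev_rhom (ahom_comp f g) = rhom_comp (ev_rhom f) (ev_rhom g).
Proof. by apply: rhom_ext. Qed.

Lemma ev_rhom_id (S : kalg k) : ev_rhom (ahom_id S) = rhom_id (ev_ralg S).
Proof. by apply: rhom_ext. Qed.

Section FixedPointEvaluation.
Variable A : gralg gT R.

Fact fp_orbitP (l : A) :
  [ffun g => ga_act A g l] \in @fp_pred gT (gring_of A) e.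
Proof. by apply/fp_predP => x g; rewrite !ffunE /= ga_actM. Qed.
(** The equivariant map from G/e with value [l] at 1; every element of level G/e is of this form. *)
Definition fp_orbit (l : A) : FPAlg A e := FP (fp_orbitP l).
Fact fp_orbit_zmod : zmod_morphism fp_orbit.
Proof. by move=> a b; apply: fpP => x; rewrite !ffunE rmorphB. Qed.
Fact fp_orbit_monoid : monoid_morphism fp_orbit.
Proof. by split=> [|a b]; apply: fpP => x;
  rewrite !ffunE ?rmorph1 ?rmorphM. Qed.
Fact fp_orbit_map r :
  rmorphism_of fp_orbit_zmod fp_orbit_monoid (ra_map A r) =
    ra_map (ev_ralg (FPAlg A)) r.
Proof. by apply: fpP => x; rewrite !ffunE rhE. Qed.
Definition fp_unit : rhom A (ev_ralg (FPAlg A)) :=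
  @RHom R A (ev_ralg (FPAlg A)) _ fp_orbit_map.

Definition fp_at1 (a : FPAlg A e) : A := fpv a (1%g : e).
Fact fp_at1_zmod : zmod_morphism fp_at1.
Proof. by move=> a b; rewrite /fp_at1 !ffunE. Qed.
Fact fp_at1_monoid : monoid_morphism fp_at1.
Proof. by split=> [|a b]; rewrite /fp_at1 !ffunE. Qed.
Fact fp_at1_map r :
  rmorphism_of fp_at1_zmod fp_at1_monoid (ra_map (ev_ralg (FPAlg A)) r) =
    ra_map A r.
Proof. by rewrite /= /fp_at1 !ffunE. Qed.
Definition fp_counit : rhom (ev_ralg (FPAlg A)) A :=
  @RHom R (ev_ralg (FPAlg A)) A _ fp_at1_map.

Lemma fp_unitK : rhom_comp fp_counit fp_unit = rhom_id A.
Proof. by apply: rhom_ext => l; rewrite /= /fp_at1 ffunE ga_act1. Qed.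

Lemma fp_counitK : rhom_comp fp_unit fp_counit = rhom_id _.
Proof.
apply: rhom_ext => a; apply: fpP => g; rewrite !ffunE /fp_at1.
by rewrite -[LHS](@fpE gT (gring_of A) e a) /= mul1g.
Qed.

Definition fp_ciso : @ciso (RAlgCat R) A (ev_ralg (FPAlg A)) :=
  @CIso (RAlgCat R) A (ev_ralg (FPAlg A)) _ _ fp_unitK fp_counitK.

Lemma fp_unit_weyl g l : fp_unit (ga_act A g l) = weyl (FPAlg A) g (fp_unit l).
Proof. by apply: fpP => x; rewrite !ffunE /= ga_actM. Qed.

Lemma fp_unit_can : cancel fp_unit fp_counit.
Proof. by move=> a; have := congr1 (fun h : rhom _ _ => h a) fp_unitK. Qed.

Lemma fp_counit_can : cancel fp_counit fp_unit.
Proof. by move=> a; have := congr1 (fun h : rhom _ _ => h a) fp_counitK. Qed.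
End FixedPointEvaluation.

Lemma fp_unit_nat (A B : gralg gT R) (f : grhom A B) l :
  ev_rhom (FPHom f) (fp_unit A l) = fp_unit B (f l).
Proof. by apply: fpP => x; rewrite !ffunE grhE. Qed.

Section Coinduced.
Variable B : ralg R.

Section Elements.
Definition coind_car : Type := {ffun gT -> B}.
HB.instance Definition _ := GRing.PzRing.copy coind_car {ffun gT -> B}.
Fact coind_mulC : commutative (@GRing.mul coind_car).
Proof. by move=> a b; apply/ffunP => x; rewrite !ffunE mulrC. Qed.
HB.instance Definition _ :=
  GRing.PzRing_hasCommutativeMul.Build coind_car coind_mulC.
Local Notation car := coind_car.
Fact coind_map_zmod : zmod_morphism (fun r : R => [ffun=> ra_map B r] : car).
Proof. by move=> a b; apply/ffunP => x; rewrite !ffunE rmorphB. Qed.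
Fact coind_map_monoid : monoid_morphism (fun r : R => [ffun=> ra_map B r] :
  car).
Proof. by split=> [|a b]; apply/ffunP => x;
  rewrite !ffunE ?rmorph1 ?rmorphM. Qed.
Definition coind_ralg : ralg R :=
  @RAlg R car (rmorphism_of coind_map_zmod coind_map_monoid).
End Elements.

(** Left translation of the argument is a right action, as [gralg] requires. *)
Definition coind_shift (g : gT) (a : coind_ralg) : coind_ralg :=
  [ffun h => (a : {ffun gT -> B}) (g * h)%g].
Fact coind_shift_zmod g : zmod_morphism (coind_shift g).
Proof. by move=> a b; apply/ffunP => x; rewrite !ffunE. Qed.
Fact coind_shift_monoid g : monoid_morphism (coind_shift g).
Proof. by split=> [|a b]; apply/ffunP => x; rewrite !ffunE. Qed.
Fact coind_shift_map g r :
  rmorphism_of (coind_shift_zmod g) (coind_shift_monoid g) (ra_map coind_ralg r)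
    =
  ra_map coind_ralg r.
Proof. by apply/ffunP => x; rewrite !ffunE. Qed.
Definition coind_act g : rhom coind_ralg coind_ralg :=
  @RHom R coind_ralg coind_ralg _ (coind_shift_map g).
Fact coind_act1 : coind_act 1%g = rhom_id _.
Proof. by apply: rhom_ext => a; apply/ffunP => x; rewrite ffunE mul1g. Qed.
Fact coind_actM g h : coind_act (g * h)%g =
  rhom_comp (coind_act h) (coind_act g).
Proof. by apply: rhom_ext => a; apply/ffunP => x; rewrite !ffunE mulgA. Qed.
Definition coind : gralg gT R := GRAlg coind_act1 coind_actM.

Fact coind_at1_zmod : zmod_morphism (fun a : coind => (a : {ffun gT -> B}) 1%g).
Proof. by move=> a b; rewrite !ffunE. Qed.
Fact coind_at1_monoid : monoid_morphism (fun a : coind => (a : {ffun gT ->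
  B}) 1%g).
Proof. by split=> [|a b]; rewrite !ffunE. Qed.
Fact coind_at1_map r :
  rmorphism_of coind_at1_zmod coind_at1_monoid (ra_map coind r) = ra_map B r.
Proof. by rewrite /= ffunE. Qed.
Definition coind_at1 : rhom coind B := @RHom R coind B _ coind_at1_map.
(** The counit of the adjunction between evaluation and B |-> FP(Map(G, B)). *)
Definition coind_eval : rhom (ev_ralg (FPAlg coind)) B :=
  rhom_comp coind_at1 (fp_counit coind).

(** By equivariance the value at (g, h) depends only on the product gh. Hence an element is
    determined by the counit on its translates, which makes the adjunction injective. *)
Lemma coind_eval_weyl (a : FPAlg coind e) (g h : gT) :
  ((fpv a (g : e)) : {ffun gT -> B}) h = coind_eval (weyl _ (g * h)%g a).
Proof.
rewrite /= /fp_at1 !ffunE /= mulg1.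
have E x : fpv a (x : e) = coind_shift x (fpv a (1%g : e)).
  by rewrite -[x in LHS]mul1g; exact: (@fpE gT (gring_of coind) e a).
by rewrite E (E (g * h)%g) !ffunE mulg1.
Qed.

Section Lift.
Variables (S : kalg k) (phi : rhom (ev_ralg S) B).
Definition coind_fun (s : ev_ralg S) : coind := [ffun g => phi (weyl S g s)].
Fact coind_fun_zmod : zmod_morphism coind_fun.
Proof. by move=> a b; apply/ffunP => x; rewrite !ffunE !rmorphB. Qed.
Fact coind_fun_monoid : monoid_morphism coind_fun.
Proof. by split=> [|a b]; apply/ffunP => x;
  rewrite !ffunE ?rmorph1 ?rmorphM. Qed.
Fact coind_fun_map r :
  rmorphism_of coind_fun_zmod coind_fun_monoid (ra_map (ev_ralg S) r) =
  ra_map coind r.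
Proof. by apply/ffunP => x; rewrite !ffunE !rhE. Qed.
Definition coind_lift : rhom (ev_ralg S) coind :=
  @RHom R (ev_ralg S) coind _ coind_fun_map.

Lemma coind_lift_weyl g s :
  coind_lift (weyl S g s) = ga_act coind g (coind_lift s).
Proof. by apply/ffunP => x; rewrite !ffunE weylM. Qed.
End Lift.
End Coinduced.

Variable u : R.
Hypothesis uE : #|gT|%:R * u = 1.

Lemma ahom_loc (S T : kalg k) (f : ahom S T) (X : gset gT) (a : S X) x :
  tres T (pt x) (f X a) = f e (tres S (pt x) a).
Proof. by rewrite th_res. Qed.

Lemma ev_rhom_inj (S T : kalg k) (f g : ahom S T) :
  ev_rhom f = ev_rhom g -> f = g.
Proof.
move=> fg; apply: ahom_ext => X a; apply: (alg_loc_inj uE) => x.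
by rewrite !ahom_loc -[LHS]/(ev_rhom f _) fg.
Qed.

Lemma ev_rhom_full (S T : kalg k) (phi : rhom (ev_ralg S) (ev_ralg T)) :
  (forall g s, phi (weyl S g s) = weyl T g (phi s)) ->
  exists f : ahom S T, ev_rhom f = phi.
Proof.
move=> phiE.
pose f X (a : S X) : T X := alg_glue u (fun x => phi (tres S (pt x) a) : T e).
have fE X (a : S X) x : tres T (pt x) (f X a) = phi (tres S (pt x) a).
  by apply: (alg_glueE uE) => y g; rewrite tres_pt_act -!weylE phiE.
have fz X : zmod_morphism (f X).
  by move=> a b; apply: (alg_loc_inj uE) => x;
    rewrite rmorphB !fE rmorphB [LHS]rmorphB.
have fm X : monoid_morphism (f X).
  split=> [|a b]; apply: (alg_loc_inj uE) => x.
    by rewrite fE !rmorph1.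
  by rewrite rmorphM !fE rmorphM [LHS]rmorphM.
have fr X Y (h : gmap X Y) a : f X (tres S h a) = tres T h (f Y a).
  by apply: (alg_loc_inj uE) => x; rewrite fE -!tres_comp !comp_pt fE.
have ft X Y (h : gmap X Y) a : f Y (ttr S h a) = ttr T h (f X a).
  apply: (alg_loc_inj uE) => y; rewrite fE !tres_ttr rmorph_sum.
  by apply: eq_bigr => x _; rewrite fE.
have fn X Y (h : gmap X Y) a : f Y (tnm S h a) = tnm T h (f X a).
  apply: (alg_loc_inj uE) => y; rewrite fE !(tres_tnm uE) rmorph_prod.
  by apply: eq_bigr => x _; rewrite fE.
pose F := @THom gT S T (fun X => rmorphism_of (fz X) (fm X)) fr ft fn.
have fk X a : F X (ka_map S X a) = ka_map T X a.
  apply: (alg_loc_inj uE) => x; rewrite fE -!th_res const_res_pt.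
  exact: (rhE phi (a x)).
exists (@AHom gT k S T F fk); apply: rhom_ext => s /=.
by rewrite -[LHS]tres_id -pt1 fE pt1 tres_id.
Qed.

Lemma ahom_bij (S T : kalg k)
  (phi : @ciso (RAlgCat R) (ev_ralg S) (ev_ralg T)) :
  (forall g s, (cito phi : rhom _ _) (weyl S g s) = weyl T g ((cito phi :
    rhom _ _) s)) ->
  exists f : @ciso (KAlgCat k) S T, ev_rhom (cito f) = cito phi.
Proof.
move=> phiE; have [f fE] := ev_rhom_full phiE.
have phiK : cancel (cito phi : rhom _ _) (cifrom phi : rhom _ _).
  by move=> s; have := congr1 (fun h : rhom _ _ => h s) (citoK phi).
have phiK' : cancel (cifrom phi : rhom _ _) (cito phi : rhom _ _).
  by move=> s; have := congr1 (fun h : rhom _ _ => h s) (cifromK phi).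
have [|h hE] := @ev_rhom_full T S (cifrom phi).
  by move=> g s; apply: (can_inj phiK); rewrite phiE !phiK'.
unshelve eexists (@CIso (KAlgCat k) S T f h _ _); last by [];
  apply: ev_rhom_inj; rewrite ev_rhom_comp ev_rhom_id fE hE.
- exact: (citoK phi).
- exact: (cifromK phi).
Qed.

Definition coind_adj (S : kalg k) (B : ralg R) (f : ahom S (FPAlg (coind B))) :
  rhom (ev_ralg S) B := rhom_comp (coind_eval B) (ev_rhom f).

Lemma coind_adj_inj S B : injective (@coind_adj S B).
Proof.
move=> f f' ff'; apply: ev_rhom_inj; apply: rhom_ext => s.
apply: fpP => g; apply/ffunP => h; rewrite !coind_eval_weyl -!ev_weyl.
exact: (congr1 (fun h : rhom _ _ => h _) ff').
Qed.

Lemma coind_adj_surj S B (phi : rhom (ev_ralg S) B) :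
  exists f, coind_adj f = phi.
Proof.
have [|f fE] := @ev_rhom_full S (FPAlg (coind B))
    (rhom_comp (fp_unit (coind B)) (coind_lift phi)).
  by move=> g s; rewrite /= -fp_unit_weyl -coind_lift_weyl.
exists f; rewrite /coind_adj fE; apply: rhom_ext => s.
by rewrite /coind_eval !rhom_compE fp_unit_can /= ffunE weyl1.
Qed.
End EvaluationAlgebra.

(** * Finite generation and differentials *)

Section FiniteGeneration.
Variables (gT : finGroupType) (R : comPzRingType).
Local Notation e := (gfree gT).
Local Notation k := (const_tambara gT R).

Lemma fg_lmod_surj (M M' : lmodType R) (f : {linear M -> M'}) :
  (forall y, exists x, f x = y) -> fg_lmod M -> fg_lmod M'.
Proof.
move=> surj [n [m mE]]; exists n, (fun i => f (m i)) => y.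
have [x <-] := surj y; have [a ->] := mE x; exists a.
by rewrite linear_sum; apply: eq_bigr => i _; rewrite linearZ.
Qed.

(** The restrictions of the generators to all points of their G-sets span M(G/e): the elements whose
    restrictions to points all lie in the span form a submodule, closed under transfers by
    [mres_mtr]. *)
Lemma fg_ev_tmod (M : tmod k) : fg_tmod M -> fg_lmod (ev_mod M).
Proof.
case=> n [Y [y yE]]; pose T : finType := {i : 'I_n & Y i}.
pose z (t : T) : ev_mod M := mres M (pt (tagged t)) (y (tag t)).
pose sp (m : ev_mod M) := exists a : T -> R, m = \sum_t a t *: z t.
have sp0 : sp 0 by exists (fun=> 0); rewrite big1 // => t _; rewrite scale0r.
have spD m m' : sp m -> sp m' -> sp (m + m').
  move=> [a ->] [b ->]; exists (fun t => a t + b t).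
  by rewrite -big_split; apply: eq_bigr => t _; rewrite scalerDl.
have spZ r m : sp m -> sp (r *: m).
  move=> [a ->]; exists (fun t => r * a t).
  by rewrite scaler_sumr; apply: eq_bigr => t _; rewrite scalerA.
have /yE/(_ _ e) Nall : is_submod (fun X (m : M X) => forall x,
  sp (mres M (pt x) m)).
  split.
  - by move=> X x; rewrite raddf0.
  - by move=> X m m' h h' x; rewrite raddfD; apply: spD.
  - by move=> X a m h x; rewrite mres_ptZ; apply: spZ.
  - by move=> X X' f m h x; rewrite -mres_comp comp_pt.
  - move=> X X' f m h x; rewrite mres_mtr.
    by apply: (big_ind sp) => // y' _; apply: h.
have spall m : sp m.
  rewrite -[m]mres_pt1; apply: Nall => i x.
  exists (fun t => (t == Tagged (fun i => Y i) x)%:R).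
  rewrite (bigD1 (Tagged (fun i => Y i) x)) //= eqxx scale1r big1 ?addr0 //.
  by move=> t /negPf ->; rewrite scale0r.
exists #|T|, (fun i => z (enum_val i)) => m; have [a ->] := spall m.
exists (fun i => a (enum_val i)).
by rewrite (reindex_onto _ _ (fun i _ => enum_rankK i)) /=;
  apply: eq_bigl => i; rewrite enum_valK eqxx.
Qed.

Variable u : R.
Hypothesis uE : #|gT|%:R * u = 1.

Lemma fg_tmod_ev (M : tmod k) : fg_lmod (ev_mod M) -> fg_tmod M.
Proof.
case=> n [m mE]; exists n, (fun=> e), m => N [N0 ND NZ Nr Nt] Nm X x.
have Ne (y : M e) : N e y.
  have [a ->] := mE y.
  by apply: (big_ind (N e)) => // [|i _]; [exact: ND | exact: (NZ e)].
rewrite (mod_average uE x); apply: NZ.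
by apply: (big_ind (N X)) => // [|y _]; [exact: ND | exact: Nt].
Qed.

(** The two modules differ only in the order in which scalars are restricted and the level is taken.
    This identity map and its converse carry statements between them. *)
Lemma ev_alg_linear (S : kalg k) :
  linear (idfun : ralg_mod (ev_ralg S) -> ev_mod (alg_mod S)).
Proof. by []. Qed.

Lemma alg_ev_linear (S : kalg k) :
  linear (idfun : ev_mod (alg_mod S) -> ralg_mod (ev_ralg S)).
Proof. by []. Qed.

Lemma fg_ev_alg (S : kalg k) :
  fg_tmod (alg_mod S) <-> fg_lmod (ralg_mod (ev_ralg S)).
Proof.
split=> [/fg_ev_tmod|] fg; last apply: fg_tmod_ev.
  by apply: (fg_lmod_surj (f := linear_of (@alg_ev_linear S)) _ fg) => x;
    exists x.
by apply: (fg_lmod_surj (f := linear_of (@ev_alg_linear S)) _ fg) => x;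
  exists x.
Qed.

Lemma flat_ev_alg (S : kalg k) :
  flat_tmod (alg_mod S) <-> flat_lmod (ralg_mod (ev_ralg S)).
Proof.
split=> [/(flat_ev_tmod uE)|] fl; last apply: (flat_tmod_ev uE).
  by apply: (flat_lmod_iso (e := linear_of (@alg_ev_linear S)) _ fl); exists id.
by apply: (flat_lmod_iso (e := linear_of (@ev_alg_linear S)) _ fl); exists id.
Qed.

Lemma alg_pairing (S T P : kalg k) (i : ahom S P) (j : ahom T P) :
  @is_pairing _ k (alg_mod S) (alg_mod T) (alg_mod P)
    (fun X s t => i X s * j X t : P X).
Proof.
split.
- move=> X; split=> a m m' n; rewrite /GRing.scale /=.
    by rewrite rmorphD rmorphM ahE mulrDl mulrA.
  by rewrite rmorphD rmorphM ahE mulrDr mulrCA.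
- by move=> X Y f m n; rewrite /= rmorphM !th_res.
- by move=> X Y f m n; rewrite /= th_res mulrC ttr_frob mulrC th_tr.
- by move=> X Y f m n; rewrite /= th_res ttr_frob th_tr.
Qed.

Lemma box_alg_ev (S T P : kalg k) (i : ahom S P) (j : ahom T P) :
  is_box_alg i j <-> is_tensor_alg (ev_rhom i) (ev_rhom j).
Proof.
split=> [/box_ev_tensor|h].
  exact: (@is_tensor_iso R _ (ralg_mod (ev_ralg S)) _ (ralg_mod (ev_ralg T))
    _ (ralg_mod (ev_ralg P)) _ _ (linear_of (@ev_alg_linear S))
    (linear_of (@ev_alg_linear T)) (linear_of (@ev_alg_linear P))
    (@idfun_bij _) (@idfun_bij _) (@idfun_bij _)).
apply: (tensor_ev_box uE (alg_pairing i j)).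
exact: (@is_tensor_iso R _ (ev_mod (alg_mod S)) _ (ev_mod (alg_mod T))
    _ (ev_mod (alg_mod P)) _ _ (linear_of (@alg_ev_linear S))
    (linear_of (@alg_ev_linear T)) (linear_of (@alg_ev_linear P))
    (@idfun_bij _) (@idfun_bij _) (@idfun_bij _)) h.
Qed.
End FiniteGeneration.

Section Kahler.

Lemma ideal_quot_trivial (S : comPzRingType) (I J : S -> Prop) :
  I 0 -> is_ideal J ->
  (forall c d : ideal_quot I J, c = d) <-> (forall a, I a -> J a).
Proof.
move=> I0 [J0 JD JM]; have JN a : J a -> J (- a) by move/(JM (-1));
  rewrite mulN1r.
split=> [cd a Ia|IJ [c ca] [d db]].
  pose coset a (Ia : I a) : ideal_quot I J :=
    exist _ (fun b => J (b - a)) (ex_intro2 _ _ a Ia erefl).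
  (* [a] belongs to its own coset, hence to the coset of 0, which is [J]. *)
  have := congr1 (fun c => sval c a) (cd (coset a Ia) (coset 0 I0)).
  by rewrite /= subrr subr0 => <-.
apply: eq_exist => /=; case: ca => a Ia ->; case: db => b Ib ->.
apply: funext => x; apply: propext; split=> h.
  by rewrite -(subrK a x) -addrA; apply: (JD) => //; apply: (JD);
    [|apply: (JN)]; apply: (IJ).
by rewrite -(subrK b x) -addrA; apply: (JD) => //; apply: (JD); [|apply: (JN)];
  apply: (IJ).
Qed.

Lemma ideal_sq_ideal (S : comPzRingType) (I : S -> Prop) :
  is_ideal (ideal_sq I).
Proof.
split=> [J [J0 _ _] _ //|a b ha hb J iJ hJ|a b hb J iJ hJ].
  by have [_ JD _] := iJ; apply: JD; [apply: ha | apply: hb].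
by have [_ _ JM] := iJ; apply: JM; apply: hb.
Qed.

Lemma ring_kahler_trivial (R : comPzRingType) (P S : ralg R) (mu : rhom P S) :
  (forall c d : ring_kahler mu, c = d) <->
  (forall a, mu a = 0 -> ideal_sq (fun b => mu b = 0) a).
Proof. exact: (ideal_quot_trivial (rmorph0 mu) (ideal_sq_ideal _)). Qed.

Lemma tideal_gen_ideal (gT : finGroupType) (S : tambara gT)
    (A : forall X, S X -> Prop) X : is_ideal (tideal_gen A (X := X)).
Proof.
split=> [J tJ _|a b ha hb J tJ hJ|a b hb J tJ hJ]; have [T [f fE]] := tJ;
  apply/fE.
- exact: rmorph0.
- by rewrite rmorphD (proj1 (fE _ _) (ha J tJ hJ)) (proj1 (fE _ _) (hb J tJ hJ))
    addr0.
- by rewrite rmorphM (proj1 (fE _ _) (hb J tJ hJ)) mulr0.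
Qed.

Lemma kahler_trivial (gT : finGroupType) (k : tambara gT) (P S : kalg k)
    (mu : ahom P S) (X : gset gT) :
  (forall c d : kahler mu X, c = d) <->
  (forall a, mu X a = 0 -> tideal_gt1 (fun Y (b : P Y) => mu Y b = 0) a).
Proof. exact: (ideal_quot_trivial (rmorph0 (mu X)) (@tideal_gen_ideal _ P _ X)).
  Qed.

Lemma ring_kahler_zero_iso (R : comPzRingType) (A B : ralg R)
    (c : @ciso (RAlgCat R) A B) : ring_kahler_zero A -> ring_kahler_zero B.
Proof.
case=> P [i [j [mu [ij mi mj /ring_kahler_trivial km]]]].
pose f : rhom A B := cito c; pose g : rhom B A := cifrom c.
have fK x : g (f x) = x by have := congr1 (fun h : rhom _ _ => h x) (citoK c).
have gK x : f (g x) = x by have := congr1 (fun h : rhom _ _ => h x) (cifromK c).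
have bg : bijective (rhom_lin g) by exists f.
exists P, (rhom_comp i g), (rhom_comp j g), (rhom_comp f mu).
split=> [|a|a|] /=; rewrite ?mi ?mj //.
  exact: (@is_tensor_iso R _ (ralg_mod B) _ (ralg_mod B) _ (ralg_mod P) _ _
    (rhom_lin g) (rhom_lin g) idfun bg bg (@idfun_bij _)) ij.
apply/ring_kahler_trivial => a /= fa0.
have /km h : mu a = 0 by rewrite -[LHS]fK fa0 rmorph0.
by move=> J iJ hJ; apply: h => // x y x0 y0; apply: hJ;
  rewrite /= ?x0 ?y0 rmorph0.
Qed.

Section Groups.
Variable gT : finGroupType.
Local Notation e := (gfree gT).

(** |G/K| exceeds |G/H|, so [f] identifies two points; as G acts transitively on G/H, they can be
    moved to the fibre over any given [y]. *)
Lemma proper_fibre (K H : {group gT}) (f : gmap (gorbit K) (gorbit H)) y :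
  (exists x, (K :^ x)%g \proper H) ->
  exists x1 x2, [/\ x1 != x2, f x1 == y & f x2 == y].
Proof.
case=> x KH.
have cardE (L : {group gT}) : (#|gorbit L| * #|L| = #|gT|)%N.
  rewrite -[X in (X * _)%N]/#|{: coset_car L}| card_sig mulnC.
  by rewrite -cardsT -(Lagrange (subsetT L)).
have ninj : ~ injective f.
  move=> /leq_card le; have := proper_card KH; rewrite cardJg => lt.
  have H0 : (0 < #|gorbit H|)%N.
    by have := cardE H; case: #|gorbit H| => //; rewrite mul0n => E;
       have := ltn0Sn 0; rewrite -{2}(cards1 (1%g :
         gT)) => /leq_trans/(_ (max_card _)); rewrite -E.
  have : (#|gorbit K| * #|K| < #|gorbit H| * #|H|)%N.
    by apply: leq_ltn_trans (leq_mul le (leqnn _)) _; rewrite ltn_pmul2l.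
  by rewrite !cardE ltnn.
have [x1 [x2 [ne f12]]] : exists x1 x2, x1 <> x2 /\ f x1 = f x2.
  apply: contrapT => h; apply: ninj => x1 x2 f12.
  by apply: contrapT => ne; apply: h; exists x1, x2.
have [g gy] : exists g, gsact (gorbit H) (f x1) g = y.
  case: (f x1) => A /= hA; case: y => B hB.
  have /rcosetsP[a _ EA] := hA; have /rcosetsP[b _ EB] := hB.
  exists (a^-1 * b)%g; apply: val_inj; rewrite /= EA EB.
  by rewrite -rcosetM mulKVg.
exists (gsact (gorbit K) x1 g), (gsact (gorbit K) x2 g); split.
- by rewrite (inj_eq (act_inj _ _)); apply/eqP.
- by rewrite gfunE gy.
- by rewrite gfunE -f12 gy.
Qed.

(** [norm_gens] speaks of the orbits [gorbit H] only, and [gfree] is not literally one of them. The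
    retraction presents each element of level G/e as a restriction from level G/1. *)
Lemma orbit1_retract :
  exists (o : gmap (gorbit 1%G) e) (o' : gmap e (gorbit 1%G)),
    gmap_comp o o' = gmap_id e.
Proof.
have rE (A : gorbit (1%G : {group gT})) : val A = [set repr (val A)].
  by case: A => A /= /rcosetsP[a _ ->]; rewrite mul1g repr_set1.
have oE (A : gorbit (1%G : {group gT})) g :
    (repr (val (gsact (gorbit 1%G) A g)) = repr (val A) * g)%g.
  by rewrite /= [X in repr (X :* _)%g]rE mulg_set1 repr_set1.
pose o : gmap (gorbit 1%G) e := @GMap gT (gorbit 1%G) e _ oE.
have h1 : (1%g : {set gT}) \in rcosets 1%G [set: gT].
  by apply/rcosetsP; exists 1%g => //; rewrite rcoset1.
pose c : coset_car 1%G := exist _ (1%g : {set gT}) h1.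
exists o, (pt (c : gorbit 1%G)).
by rewrite comp_pt -pt1; congr pt; rewrite /= repr_set1.
Qed.
End Groups.
End Kahler.

(** * Finite etale algebras *)

Section Evaluation.
Variables (gT : finGroupType) (R : comPzRingType).
Local Notation e := (gfree gT).
Local Notation k := (const_tambara gT R).
Variable u : R.
Hypothesis uE : #|gT|%:R * u = 1.

Lemma tres_weyl (S : kalg k) (X : gset gT) (a : S X) x g :
  weyl S g (tres S (pt x) a) = tres S (pt (gsact X x g)) a.
Proof. by rewrite tres_pt_act. Qed.

Lemma coind_ext (B : ralg R) (X : gset gT) (a b : FPAlg (coind gT B) X) :
  (forall x, coind_eval gT B (tres (FPAlg (coind gT B)) (pt x) a) =
             coind_eval gT B (tres (FPAlg (coind gT B)) (pt x) b)) -> a = b.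
Proof.
move=> ab; apply: (alg_loc_inj uE) => x; apply: fpP => g; apply/ffunP => h.
by rewrite !coind_eval_weyl !tres_weyl.
Qed.

Lemma coind_adjE (S : kalg k) (B : ralg R) (f : ahom S (FPAlg (coind gT B)))
    (X : gset gT) (a : S X) x :
  coind_eval gT B (tres (FPAlg (coind gT B)) (pt x) (f X a)) =
  coind_adj f (tres S (pt x) a).
Proof. by rewrite ahom_loc. Qed.

(* The kernel of P -> FP(Map(G, P(G/e)/I^2)) is a Tambara ideal; it contains
   I^{>1}, a norm along G/K -> G/H being a product over a fibre with at least
   two points. *)
Lemma kahler_ev (S : kalg k) : kahler_zero S -> ring_kahler_zero (ev_ralg S).
Proof.
case=> P [i [j [mu [ij mi mj km]]]].
exists (ev_ralg P), (ev_rhom i), (ev_rhom j), (ev_rhom mu).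
split; [exact/(box_alg_ev uE) | exact: mi | exact: mj |
  apply/ring_kahler_trivial].
move=> a a0; set K := ideal_sq _.
have iK : is_ideal K := ideal_sq_ideal _.
have [Q [p pK]] := ideal_quotient_ex iK.
pose B : ralg R := RAlg (p \o ra_map (ev_ralg P)).
have [F FE] := coind_adj_surj uE (@RHom R (ev_ralg P) B p (fun _ => erefl)).
have FpE s : coind_adj F s = p s by rewrite FE.
have tJ : is_tideal (fun X (b : P X) => F X b = 0)
  by exists (FPAlg (coind gT B)), F.
have Jloc X (b : P X) : (forall x, K (tres P (pt x) b)) -> F X b = 0.
  move=> h; apply: coind_ext => x; rewrite coind_adjE FpE.
  by rewrite rmorph0 rmorph0; apply/pK.
have muloc X (b : P X) x : mu X b = 0 -> mu e (tres P (pt x) b) = 0.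
  by move=> b0; rewrite -ahom_loc b0 rmorph0.
have KM b c : mu e b = 0 -> mu e c = 0 -> K (b * c).
  by move=> b0 c0 J iJ; apply.
have /kahler_trivial/(_ a a0)/(_ _ tJ) h := km e.
apply/pK; rewrite -FpE -[a]tres_id -pt1 -coind_adjE h ?rmorph0 ?rmorph0 //.
move=> Y b; case=> {Y b} [H b c b0 c0|L H f b LH b0]; apply: Jloc => y.
  by rewrite rmorphM; apply: KM; apply: muloc.
rewrite (tres_tnm uE); have [x1 [x2 [ne f1 f2]]] := proper_fibre f y LH.
rewrite (bigD1 x1) //= (bigD1 x2) /=; last by rewrite f2 eq_sym ne.
by rewrite mulrA mulrC; case: iK => _ _; apply; apply: KM; apply: muloc.
Qed.

Section TensorAction.
Variables (A : gralg gT R) (P : ralg R) (i j : rhom A P).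
Hypothesis ij : is_tensor_alg i j.

Lemma tensor_action_ex : exists act : gT -> rhom P P,
  [/\ act 1%g = rhom_id P, forall g h, act (g * h)%g =
    rhom_comp (act h) (act g),
      forall g a, act g (i a) = i (ga_act A g a) &
      forall g a, act g (j a) = j (ga_act A g a)].
Proof.
have [act actE] := choice (fun g =>
  tensor_alg_ex ij (rhom_comp i (ga_act A g)) (rhom_comp j (ga_act A g))).
exists act; split=> [|g h|g a|g a]; try by have [? ?] := actE g.
- have [hi hj] := actE 1%g.
  by apply: (tensor_alg_uniq ij) => a; rewrite ?hi ?hj /= ga_act1.
- have [hi hj] := actE (g * h)%g; have [gi gj] := actE g;
    have [ki kj] := actE h.
  by apply: (tensor_alg_uniq ij) => a;
    rewrite /= ?hi ?hj ?gi ?gj /= ?gi ?gj ?ki ?kj /= ga_actM.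
Qed.
End TensorAction.

Lemma fp_counit_weyl (A : gralg gT R) g a :
  fp_counit A (weyl (FPAlg A) g a) = ga_act A g (fp_counit A a).
Proof.
by rewrite -{1}[a]fp_counit_can -fp_unit_weyl fp_unit_can.
Qed.

Lemma fp_tensor_box (S T : kalg k) (P : gralg gT R) (i : ahom S (FPAlg P))
    (j : ahom T (FPAlg P)) :
  is_tensor_alg (rhom_comp (fp_counit P) (ev_rhom i))
    (rhom_comp (fp_counit P) (ev_rhom j)) -> is_box_alg i j.
Proof.
move=> h; apply/(box_alg_ev uE).
have bc : bijective (rhom_lin (fp_counit P)) by exists (fp_unit P);
  [exact: fp_counit_can | exact: fp_unit_can].
refine (@is_tensor_iso R _ (ralg_mod (ev_ralg S)) _ (ralg_mod (ev_ralg T)) _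
  (ralg_mod (ev_ralg (FPAlg P))) _ _ idfun idfun (rhom_lin (fp_counit P))
  (@idfun_bij _) (@idfun_bij _) bc _ h) => m n.
exact: (rmorphM (fp_counit P)).
Qed.

(* At level G/e the products suffice; they come from level G/1 of I^{>1}. *)
Lemma ev_kahler (S : kalg k) : ring_kahler_zero (ev_ralg S) -> kahler_zero S.
Proof.
case=> P [i [j [mu [ij mi mj /ring_kahler_trivial km]]]].
have [act [act1 actM acti actj]] := tensor_action_ex (A := ev_gralg S) ij.
pose G : gralg gT R := GRAlg act1 actM.
have mu_act g p : mu (act g p) = weyl S g (mu p).
  suff E : rhom_comp mu (act g) = rhom_comp (weyl S g) mu.
    exact: (congr1 (fun h : rhom _ _ => h p) E).
  by apply: (tensor_alg_uniq ij) => a; rewrite /= ?acti ?actj /= ?mi ?mj.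
have lift (f : rhom (ev_ralg S) P) : (forall g a, act g (f a) =
  f (weyl S g a)) ->
    exists F : ahom S (FPAlg G), ev_rhom F = rhom_comp (fp_unit G) f.
  move=> fE; apply: (@ev_rhom_full _ _ _ uE S (FPAlg G)) => g s.
  by rewrite /= -fp_unit_weyl /= fE.
have [I IE] := lift i acti; have [J JE] := lift j actj.
have [M ME] : exists M : ahom (FPAlg G) S, ev_rhom M =
  rhom_comp mu (fp_counit G).
  apply: (@ev_rhom_full _ _ _ uE (FPAlg G) S) => g s.
  by rewrite !rhom_compE fp_counit_weyl -mu_act.
have sec (F : ahom S (FPAlg G)) f : ev_rhom F = rhom_comp (fp_unit G) f ->
    (forall a, mu (f a) = a) -> forall X a, M X (F X a) = a.
  move=> FE fE X a.
  suff E : ahom_comp M F = ahom_id S by exact: (congr1 (fun h :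
    ahom _ _ => h X a) E).
  apply: (ev_rhom_inj uE); rewrite ev_rhom_comp ME FE; apply: rhom_ext => b.
  by rewrite !rhom_compE fp_unit_can fE.
exists (FPAlg G), I, J, M; split; [| exact: sec IE mi | exact: sec JE mj |].
  apply: fp_tensor_box; rewrite IE JE.
  have E (f : rhom (ev_ralg S) P) :
      rhom_comp (fp_counit G) (rhom_comp (fp_unit G) f) = f.
    by apply: rhom_ext => a; rewrite !rhom_compE fp_unit_can.
  by rewrite (E i) (E j).
move=> X; apply/kahler_trivial => a a0 N [T [f fN]] hN; apply/fN.
(* A Tambara ideal is the kernel of a map to a bare Tambara functor. Through [f] this target becomes
   an algebra over k, so that its elements may be compared at points. *)
pose T' : kalg k := KAlg (thom_comp f (ka_map (FPAlg G))).
apply: (@alg_loc_inj _ _ _ uE T') => x.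
rewrite -[LHS]th_res [RHS]rmorph0.
have : M e (tres (FPAlg G) (pt x) a) = 0 by rewrite -ahom_loc a0 rmorph0.
have MeE b : M e b = mu (fp_counit G b) by rewrite -[LHS]/(ev_rhom M b) ME.
move: (tres _ _ _) => b; rewrite MeE => /km Kb; rewrite -[b]fp_counit_can.
(* The part at G/e of the kernel of [f] is an ideal of [P], so it contains the square of the
   augmentation ideal once it contains products of two elements of that ideal. *)
apply: (Kb (fun p => f e (fp_unit G p) = 0)).
  split=> [|p q hp hq|p q hq].
  - by rewrite !rmorph0.
  - by rewrite !rmorphD hp hq addr0.
  - by rewrite !rmorphM hq mulr0.
move=> p q p0 q0; have [o [o' oo']] := orbit1_retract gT.
have oK (c : FPAlg G e) : tres (FPAlg G) o' (tres (FPAlg G) o c) = c.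
  by rewrite -tres_comp oo' tres_id.
rewrite [fp_unit G _]rmorphM -[fp_unit G p]oK -[fp_unit G q]oK -rmorphM th_res.
rewrite (proj1 (fN _ _)) ?rmorph0 //; apply: hN.
by apply: NormProd; rewrite th_res MeE fp_unit_can ?p0 ?q0 rmorph0.
Qed.

(** As a left adjoint, evaluation preserves free algebras and coequalizers. A generator in level Y
    becomes one polynomial variable for each point of Y. *)
Lemma fp_ev (S : kalg k) : fp_kalg S -> fp_ralg (ev_ralg S).
Proof.
have free n (Y : 'I_n -> gset gT) (P : kalg k) (y : forall i, P (Y i)) :
    free_poly y -> free_poly_ring (fun t : 'I_#|{: {i : 'I_n & Y i}}| =>
      let t' := enum_val t in tres P (pt (tagged t')) (y (tag t')) : ev_ralg P).
  move=> fy B s; pose T : finType := {i : 'I_n & Y i}.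
  pose s' i (x : Y i) : B := s (enum_rank (Tagged (fun i => Y i) x : T)).
  (* The element of FP(Map(G, B))(Y i) that corresponds to the plain map [s' i] from [Y i] to
     [B]. *)
  have sP i : [ffun x => [ffun h => s' i (gsact _ x h)]] \in
      @fp_pred gT (gring_of (coind gT B)) (Y i).
    apply/fp_predP => x g; apply/ffunP => h; rewrite !ffunE actM //.
  pose c i : FPAlg (coind gT B) (Y i) := FP (sP i).
  have cE i x : coind_eval gT B (tres (FPAlg (coind gT B)) (pt x) (c i)) =
    s' i x.
    by rewrite /= /fp_at1 !ffunE /= !act1.
  have [F [FE Funi]] := fy _ c.
  exists (coind_adj F); split=> [t|f' f'E].
    rewrite -coind_adjE FE cE /s'; congr (s _); rewrite -[RHS]enum_valK.
    by congr enum_rank; case: (enum_val t).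
  have [F' F'E] := coind_adj_surj uE f'; rewrite -F'E; congr coind_adj.
  apply: Funi => i; apply: coind_ext => x; rewrite coind_adjE F'E cE /s' -f'E.
  by rewrite enum_rankK.
case=> m [n [Z [Y [Q [P [z [y [v [w [p [fz fy [pE pu]]]]]]]]]]]].
exists #|{: {i : 'I_m & Z i}}|, #|{: {i : 'I_n & Y i}}|, (ev_ralg Q),
  (ev_ralg P).
do 2![eexists]; exists (ev_rhom v), (ev_rhom w), (ev_rhom p); split.
- exact: free fz.
- exact: free fy.
split=> [a|B f fE]; first exact: pE.
have [F FE] := coind_adj_surj uE f.
have [|G [GE Guni]] := pu _ F.
  move=> X a.
  suff E : ahom_comp F v = ahom_comp F w by exact: (congr1 (fun h :
    ahom _ _ => h X a) E).
  apply: (coind_adj_inj uE); apply: rhom_ext => b.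
  have := fE b; rewrite -FE; exact.
exists (coind_adj G); split=> [a|g gE]; first by rewrite -FE /= GE.
have [G' G'E] := coind_adj_surj uE g; rewrite -G'E; congr coind_adj.
apply: Guni => X a.
suff E : ahom_comp G' p = F by exact: (congr1 (fun h : ahom _ _ => h X a) E).
apply: (coind_adj_inj uE); apply: rhom_ext => b.
by rewrite FE -gE -G'E.
Qed.

(* FP(R[Z]), with Z the disjoint union of the Y i. *)
Lemma free_kalg_ex n (Y : 'I_n -> gset gT) :
  exists (P : kalg k) (y : forall i, P (Y i)), free_poly y.
Proof.
pose T := {i : 'I_n & Y i}.
have [P0 [x xU]] := free_ralg_ex R T.
have ext (S : ralg R) (f g : rhom P0 S) : (forall t, f (x t) = g (x t)) -> f =
  g.
  move=> fg; have [h [_ hu]] := xU S (fun t => f (x t)).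
  by rewrite -(hu f) // -(hu g).
pose sh g (t : T) : T := Tagged (fun i => Y i) (gsact (Y (tag t)) (tagged t) g).
have [act actE] := choice (fun g => let: ex_intro f (conj fE _) :=
  xU P0 (fun t => x (sh g t)) in ex_intro _ f fE).
have act1 : act 1%g = rhom_id P0.
  by apply: ext => -[i y]; rewrite actE /sh /= act1.
have actM g h : act (g * h)%g = rhom_comp (act h) (act g).
  by apply: ext => -[i y]; rewrite /= !actE /sh /= actM.
pose P : gralg gT R := GRAlg act1 actM.
have yP i : [ffun z => x (Tagged (fun i => Y i) z)] \in
    @fp_pred gT (gring_of P) (Y i).
  by apply/fp_predP => z g; rewrite !ffunE /= actE.
pose y i : FPAlg P (Y i) := FP (yP i).
have yE i z : tres (FPAlg P) (pt z) (y i) =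
  fp_unit P (x (Tagged (fun i => Y i) z)).
  by apply: fpP => g; rewrite !ffunE /= actE.
exists (FPAlg P), y => S s.
have [phi [phiE _]] :=
  xU (ev_ralg S) (fun t => tres S (pt (tagged t)) (s (tag t))).
have [|F FE] := @ev_rhom_full _ _ _ uE (FPAlg P) S (rhom_comp phi (fp_counit
  P)).
  move=> g a; rewrite !rhom_compE fp_counit_weyl.
  suff E : rhom_comp phi (act g) = rhom_comp (weyl S g) phi.
    exact: (congr1 (fun h : rhom _ _ => h _) E).
  by apply: ext => t; rewrite /= actE !phiE /= tres_pt_act.
have FE' b : F e (fp_unit P b) = phi b
  by rewrite -[LHS]/(ev_rhom F _) FE rhom_compE fp_unit_can.
exists F; split=> [i|F' F'E].
  by apply: (alg_loc_inj uE) => z; rewrite ahom_loc yE FE' phiE.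
apply: (ev_rhom_inj uE); apply: rhom_ext => a; rewrite -[a]fp_counit_can.
suff E : rhom_comp (ev_rhom F) (fp_unit P) = rhom_comp (ev_rhom F') (fp_unit P).
  exact: (congr1 (fun h : rhom _ _ => h _) E).
apply: ext => -[i z];
  by rewrite !rhom_compE [LHS]FE' phiE [in LHS]/= -F'E ahom_loc yE.
Qed.

Hypothesis hilbert : hilbert_basis k.

(** S is the coequalizer of two maps Q -> P, where P is free on module generators of S and Q is free
    on generators of the kernel of P -> S: one map sends the generators of Q to those of the kernel,
    the other sends them to 0. *)
Lemma fg_fp (S : kalg k) : fg_tmod (alg_mod S) -> fp_kalg S.
Proof.
case=> n [Y [s sgen]]; have [P [y fy]] := free_kalg_ex Y.
have [p [ps _]] := fy S s.
have psurj X (a : S X) : exists b, p X b = a.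
  apply: (sgen (fun X a => exists b, p X b = a)); last by move=> i;
    exists (y i).
  split=> [V|V c d [a' <-] [b' <-]|V c d [a' <-]|V W f c [a' <-]|V W f c [a'
    <-]].
  - by exists 0; rewrite rmorph0.
  - by exists (a' + b'); rewrite rmorphD.
  - by exists (ka_map P V c * a'); rewrite rmorphM ahE.
  - by exists (tres P f a'); rewrite th_res.
  - by exists (ttr P f a'); rewrite th_tr.
have tJ : is_tideal (fun X (a : P X) => p X a = 0) by exists S, p.
have [m [Z [z zgen]]] := hilbert fy tJ.
(* The generators enter [fg_tideal] through equalities of dependent pairs; a property of all pairs
   is transported along such an equality. *)
have gens (N : forall X, P X -> Prop) : (forall i, N _ (z i)) ->
    forall X (b : P X), (exists i, existT (fun X => tob P X) (Z i) (z i) =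
      existT _ X b) ->
    N X b.
  move=> Nz X b [i E].
  by have := Nz i; rewrite -[N _ _]/((fun q :
    {X & tob P X} => N (projT1 q) (projT2 q))
    (existT (fun X => tob P X) (Z i) (z i))) E.
have zJ i : p _ (z i) = 0 by apply/zgen => N tN; apply; exists i.
have [Q [q fq]] := free_kalg_ex Z.
have [v [vE _]] := fq P z; have [w [wE _]] := fq P (fun i => 0).
exists m, n, Z, Y, Q, P, q, y, v, w, p; split=> //; split=> [X a|T f fE].
  (* Both composites Q -> S vanish on the generators of Q, so freeness of Q identifies them. *)
  have [h [_ hu]] := fq S (fun i => 0).
  suff E : ahom_comp p v = ahom_comp p w by exact: (congr1 (fun h :
    ahom _ _ => h X a) E).
  by rewrite -(hu (ahom_comp p v)) ?(hu (ahom_comp p w)) // => i /=;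
    rewrite ?vE ?wE ?zJ ?rmorph0.
(* The kernel of [f] is a Tambara ideal, and it contains each [z i] because [f] takes equal values
   on [z i] and 0, the images of a generator of Q. *)
have fker X a : p X a = 0 -> f X a = 0.
  move/zgen => h; apply: (h (fun X a => f X a = 0)); first by exists T, f.
  by apply: gens => i; rewrite -vE fE wE rmorph0.
have fdep X a b : p X a = p X b -> f X a = f X b.
  by move=> ab; apply/subr0_eq; rewrite -rmorphB fker // rmorphB ab subrr.
pose r X (a : S X) : P X := sval (cid (psurj X a)).
have rK X a : p X (r X a) = a := svalP (cid (psurj X a)).
pose g X a := f X (r X a).
have gE X a : g X (p X a) = f X a by apply: fdep; rewrite rK.
have gz X : zmod_morphism (g X).
  by move=> a b; rewrite -(rK X a) -(rK X b) -rmorphB !gE rmorphB.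
have gm X : monoid_morphism (g X).
  split=> [|a b]; first by rewrite -(rmorph1 (p X)) gE rmorph1.
  by rewrite -(rK X a) -(rK X b) -rmorphM !gE rmorphM.
have gr X X' (h : gmap X X') a : g X (tres S h a) = tres T h (g X' a).
  by rewrite -(rK _ a) -th_res !gE th_res.
have gt X X' (h : gmap X X') a : g X' (ttr S h a) = ttr T h (g X a).
  by rewrite -(rK _ a) -th_tr !gE th_tr.
have gn X X' (h : gmap X X') a : g X' (tnm S h a) = tnm T h (g X a).
  by rewrite -(rK _ a) -th_nm !gE th_nm.
pose G := @THom gT S T (fun X => rmorphism_of (gz X) (gm X)) gr gt gn.
have gk X a : G X (ka_map S X a) = ka_map T X a by rewrite -(ahE p) /= gE ahE.
exists (@AHom gT k S T G gk); split=> [X a|g' g'E] /=; first exact: gE.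
by apply: ahom_ext => X a; rewrite -(rK X a) g'E /= gE.
Qed.

Lemma finite_etale_ev (S : kalg k) :
  finite_etale S -> finite_etale_ring (ev_ralg S).
Proof.
case=> fg [[fl ka] fp]; split.
- exact/(fg_ev_alg uE).
- exact/(flat_ev_alg uE).
- exact: kahler_ev.
- exact: fp_ev.
Qed.

Lemma finite_etale_FP (A : gralg gT R) :
  finite_etale_ring A -> finite_etale (FPAlg A).
Proof.
case=> fg fl ka fp; have c := fp_ciso A.
have bl : bijective (rhom_lin (fp_counit A)).
  by exists (fp_unit A); [exact: fp_counit_can | exact: fp_unit_can].
have fgS : fg_tmod (alg_mod (FPAlg A)).
  apply/(fg_ev_alg uE);
    apply: (fg_lmod_surj (f := rhom_lin (fp_unit A)) _ fg) => b.
  by exists (fp_counit A b); exact: fp_counit_can.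
split=> //; split; last exact: fg_fp; split.
  by apply/(flat_ev_alg uE); apply: flat_lmod_iso bl fl.
by apply: ev_kahler; apply: ring_kahler_zero_iso c ka.
Qed.
End Evaluation.

(** * Group schemes *)

Section BGIso.
Variables (gT : finGroupType) (C : category) (A B : bg_ob gT C).
Variable c : ciso (bg_val A) (bg_val B).
Hypothesis cE : forall g, cito c \oc bg_act A g = bg_act B g \oc cito c.

Let from_eq g : cifrom c \oc bg_act B g = bg_act A g \oc cifrom c.
Proof.
rewrite -[bg_act B g]ccompm1 -(cifromK c) [bg_act B g \oc _]ccompA -cE.
by rewrite -ccompA ccompA citoK ccomp1m.
Qed.

Definition bg_iso : @ciso (BG gT C) A B.
Proof.
refine (@CIso (BG gT C) A B (BGHom cE) (BGHom from_eq) _ _);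
  apply: bg_hom_ext => /=; [exact: citoK | exact: cifromK].
Defined.
End BGIso.

Section Equivalence.
Variables (gT : finGroupType) (R : comPzRingType).
Local Notation e := (gfree gT).
Local Notation k := (const_tambara gT R).
Variable u : R.
Hypothesis uE : #|gT|%:R * u = 1.
Hypothesis hilbert : hilbert_basis k.
Local Notation GrpR := (GrpFetRing R).
Local Notation GrpR_BG := (BG gT GrpR).
Local Notation GrpK := (GrpFet k).

Section EvaluationObject.
Variable S : GrpK.

Definition coind_unadj (B : ralg R) (phi : rhom (ev_ralg (grep S)) B) :
    ahom (grep S) (FPAlg (coind gT B)) :=
  sval (cid (coind_adj_surj uE phi)).

Lemma coind_unadjK B : cancel (@coind_unadj B) (@coind_adj _ _ (grep S) B).
Proof. by move=> phi; exact: svalP (cid (coind_adj_surj uE phi)). Qed.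

Lemma coind_adjK B : cancel (@coind_adj _ _ (grep S) B) (@coind_unadj B).
Proof. by move=> f; apply: (coind_adj_inj uE); rewrite coind_unadjK. Qed.

(** The points of S in FP(Map(G, B)) form a group, whose law is transferred along the adjunction
    bijection. *)
Definition ev_law (B : RAlgCat R) :
  group_law (@chom (RAlgCat R) (ev_ralg (grep S)) B) :=
  @group_law_pullback _ _ (glaw S (FPAlg (coind gT B))) (@coind_unadj B)
    (can_inj (@coind_unadjK B))
    (fun a b => ex_intro _ (coind_adj _) (coind_adjK _))
    (ex_intro _ (coind_adj _) (coind_adjK _))
    (fun a => ex_intro _ (coind_adj _) (coind_adjK _)).

Lemma coind_adj_gop (B : ralg R) (F F' : ahom (grep S) (FPAlg (coind gT B))) :
  coind_adj (gop (glaw S (FPAlg (coind gT B))) F F') =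
  gop (ev_law B) (coind_adj F) (coind_adj F').
Proof.
apply: (can_inj (@coind_unadjK B)).
rewrite [RHS](@group_law_pullbackE _ _ _ (@coind_unadj B)).
by rewrite !coind_adjK.
Qed.

Lemma coind_adj_comp (S' T : kalg k) (B : ralg R)
  (f : ahom T (FPAlg (coind gT B)))
    (h : ahom S' T) :
  coind_adj (ahom_comp f h) = rhom_comp (coind_adj f) (ev_rhom h).
Proof. exact: rhom_ext. Qed.

(* Every psi is the adjoint of some T -> FP(Map(G, B)), so this is the
   naturality of the group law of S. *)
Lemma ev_gop_comp (T : kalg k) (B : ralg R) (psi : rhom (ev_ralg T) B)
    (a b : ahom (grep S) T) :
  rhom_comp psi (ev_rhom (gop (glaw S T) a b)) =
  gop (ev_law B) (rhom_comp psi (ev_rhom a)) (rhom_comp psi (ev_rhom b)).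
Proof.
have [f <-] := coind_adj_surj uE psi; rewrite -!coind_adj_comp -coind_adj_gop.
congr coind_adj; exact: (@glaw_nat _ _ S).
Qed.

Lemma ev_gop (T : kalg k) (a b : ahom (grep S) T) :
  ev_rhom (gop (glaw S T) a b) =
    gop (ev_law (ev_ralg T)) (ev_rhom a) (ev_rhom b).
Proof.
have id1 f : rhom_comp (rhom_id (ev_ralg T)) f = f :> rhom (ev_ralg (grep S)) _.
  exact: rhom_ext.
by have := ev_gop_comp (rhom_id (ev_ralg T)) a b; rewrite !id1.
Qed.

(** This is [ev_gop_comp] for [f] after the counit, which takes the place of the functoriality of
    Map(G, -). [weyl_mul] is obtained likewise, from the counit after a Weyl action. *)
Lemma ev_law_nat (B B' : RAlgCat R) (f : chom B B')
    (a b : @chom (RAlgCat R) (ev_ralg (grep S)) B) :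
  f \oc gop (ev_law B) a b = gop (ev_law B') (f \oc a) (f \oc b).
Proof.
have fE (F : ahom (grep S) (FPAlg (coind gT B))) :
    f \oc coind_adj F = rhom_comp (rhom_comp f (coind_eval gT B)) (ev_rhom F).
  exact: rhom_ext.
rewrite -(coind_unadjK a) -(coind_unadjK b) -coind_adj_gop !fE.
exact: ev_gop_comp.
Qed.

Definition ev_grp : GrpR :=
  @GrpOb (RAlgCat R) (@finite_etale_ring R) (ev_ralg (grep S))
    (finite_etale_ev uE (grepP S)) ev_law ev_law_nat.

Lemma weyl_mul g (B : RAlgCat R)
  (a b : @chom (RAlgCat R) (ev_ralg (grep S)) B) :
  rhom_comp (gop (ev_law B) a b) (weyl (grep S) g) =
  gop (ev_law B) (rhom_comp a (weyl (grep S) g)) (rhom_comp b (weyl (grep S)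
    g)).
Proof.
have wE (F : ahom (grep S) (FPAlg (coind gT B))) :
    rhom_comp (coind_adj F) (weyl (grep S) g) =
    rhom_comp (rhom_comp (coind_eval gT B) (weyl _ g)) (ev_rhom F).
  by apply: rhom_ext => s; rewrite !rhom_compE ev_weyl.
rewrite -(coind_unadjK a) -(coind_unadjK b) -coind_adj_gop !wE.
exact: ev_gop_comp.
Qed.

Definition weyl_hom g : @chom GrpR ev_grp ev_grp :=
  @GrpHom (RAlgCat R) (@finite_etale_ring R) ev_grp ev_grp
    (fun B a => rhom_comp a (weyl (grep S) g))
    (fun B B' f a => esym (@ccompA (RAlgCat R) _ _ _ _ f a (weyl (grep S) g)))
      (weyl_mul g).

Lemma weyl_hom1 : weyl_hom 1%g = cidm ev_grp.
Proof.
by apply: grp_hom_ext => B a; apply: rhom_ext => s;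
  rewrite /= -[tres _ _ _]/(weyl (grep S) _ _) weyl1.
Qed.

(** Precomposition turns the right action on the ring into a left action on its points. *)
Lemma weyl_homM g h : weyl_hom (g * h)%g = weyl_hom g \oc weyl_hom h.
Proof. by apply: grp_hom_ext => B a; rewrite /= weylM; apply: rhom_ext. Qed.

Definition ev_ob : GrpR_BG := @BGOb gT GrpR ev_grp weyl_hom weyl_hom1 weyl_homM.
End EvaluationObject.

Section EvaluationMorphism.
Variables (S T : GrpK) (f : chom S T).

Lemma ev_hom_mul (B : RAlgCat R)
  (a b : @chom (RAlgCat R) (ev_ralg (grep S)) B) :
  rhom_comp (gop (ev_law S B) a b) (ev_rhom (yoneda f)) =
  gop (ev_law T B) (rhom_comp a (ev_rhom (yoneda f)))
    (rhom_comp b (ev_rhom (yoneda f))).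
Proof.
rewrite -(coind_unadjK a) -(coind_unadjK b) -coind_adj_gop -!coind_adj_comp.
rewrite -coind_adj_gop; congr coind_adj.
have := gnt_mul f (coind_unadj a) (coind_unadj b); rewrite !(yonedaE f); exact.
Qed.

Definition ev_grp_hom : @chom GrpR (ev_grp S) (ev_grp T) :=
  @GrpHom (RAlgCat R) (@finite_etale_ring R) (ev_grp S) (ev_grp T)
    (fun B a => rhom_comp a (ev_rhom (yoneda f)))
    (fun B B' h a => esym (@ccompA (RAlgCat R) _ _ _ _ h a (ev_rhom (yoneda
      f))))
    ev_hom_mul.

Lemma ev_hom_eq g :
  ev_grp_hom \oc bg_act (ev_ob S) g = bg_act (ev_ob T) g \oc ev_grp_hom.
Proof.
by apply: grp_hom_ext => B a; apply: rhom_ext => s; rewrite /= th_res.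
Qed.

Definition ev_hom : chom (ev_ob S) (ev_ob T) :=
  @BGHom gT GrpR (ev_ob S) (ev_ob T) ev_grp_hom ev_hom_eq.
End EvaluationMorphism.

Definition EV : functor GrpK GrpR_BG.
Proof.
refine (@Functor GrpK GrpR_BG ev_ob ev_hom _ _) => [S|S T U g f];
  apply: bg_hom_ext; apply: grp_hom_ext => B a; apply: rhom_ext => s //.
exact: (congr1 (fun h : ahom _ _ => a (h e s)) (yoneda_comp g f)).
Defined.

Section FixedPointObject.
Variable Gam : GrpR_BG.
Local Notation L := (rep_gralg Gam).
Local Notation law := (glaw (bg_val Gam)).

Lemma act_gop (B : RAlgCat R) (a b : @chom (RAlgCat R) (ga_alg L) B) g :
  rhom_comp (gop (law B) a b) (ga_act L g) =
  gop (law B) (rhom_comp a (ga_act L g)) (rhom_comp b (ga_act L g)).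
Proof.
have := gnt_mul (bg_act Gam g) a b; rewrite !(yonedaE (bg_act Gam g)); exact.
Qed.

(** Equivariant points are closed under the law: the action on the source preserves products because
    G acts by group scheme automorphisms, the endomorphism [w] of the target because the law is
    natural. *)
Lemma act_gop_equiv (B : ralg R) (w : rhom B B) g (a b : rhom L B) :
  rhom_comp a (ga_act L g) = rhom_comp w a ->
  rhom_comp b (ga_act L g) = rhom_comp w b ->
  rhom_comp (gop (law B) a b) (ga_act L g) = rhom_comp w (gop (law B) a b).
Proof.
by move=> ha hb; rewrite act_gop ha hb;
  have := @glaw_nat _ _ (bg_val Gam) _ _ (w : chom (B : RAlgCat R) B) a b.
Qed.

(** Its image consists of the equivariant maps, a subgroup of all R-algebra maps from [L] to T(G/e);
    this is what [fp_law] is pulled back from. *)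
Definition fp_bar (T : kalg k) (f : ahom (FPAlg L) T) : rhom L (ev_ralg T) :=
  rhom_comp (ev_rhom f) (fp_unit L).

Lemma fp_bar_inj T : injective (@fp_bar T).
Proof.
move=> f f' ff'; apply: (ev_rhom_inj uE); apply: rhom_ext => a.
by rewrite -[a]fp_counit_can; exact: (congr1 (fun h : rhom _ _ => h _) ff').
Qed.

Lemma fp_bar_weyl T (f : ahom (FPAlg L) T) g :
  rhom_comp (fp_bar f) (ga_act L g) = rhom_comp (weyl T g) (fp_bar f).
Proof.
by apply: rhom_ext => l; rewrite !rhom_compE fp_unit_weyl ev_weyl.
Qed.

Lemma fp_bar_surj (T : kalg k) (phi : rhom L (ev_ralg T)) :
  (forall g, rhom_comp phi (ga_act L g) = rhom_comp (weyl T g) phi) ->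
  exists f, fp_bar f = phi.
Proof.
move=> phiE.
have [|f fE] := @ev_rhom_full _ _ _ uE (FPAlg L) T (rhom_comp phi (fp_counit
  L)).
  move=> g a; rewrite !rhom_compE fp_counit_weyl.
  exact: (congr1 (fun h : rhom _ _ => h _) (phiE g)).
by exists f; apply: rhom_ext => l; rewrite /fp_bar fE !rhom_compE fp_unit_can.
Qed.

Lemma fp_bar_comp (T T' : kalg k) (h : ahom T T') (f : ahom (FPAlg L) T) :
  fp_bar (ahom_comp h f) = rhom_comp (ev_rhom h) (fp_bar f).
Proof. exact: rhom_ext. Qed.

Lemma fp_law_mul T (a b : ahom (FPAlg L) T) :
  exists c, fp_bar c = gop (law (ev_ralg T)) (fp_bar a) (fp_bar b).
Proof. by apply: fp_bar_surj => g; apply: act_gop_equiv;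
  exact: fp_bar_weyl. Qed.

(** Both ways of acting on points, through [L] and through T(G/e), preserve products and therefore
    fix the unit. *)
Lemma fp_law_one (T : kalg k) :
  exists c : ahom (FPAlg L) T, fp_bar c = gone (law (ev_ralg T)).
Proof.
apply: fp_bar_surj => g.
have /gop_morph1 -> := fun a b => act_gop (B := ev_ralg T) a b g.
have /gop_morph1 := @glaw_nat _ _ (bg_val Gam) _ _ (weyl T g : chom (_ :
  RAlgCat R) _).
by move=> h; exact/esym/h.
Qed.

Lemma fp_law_inv T (a : ahom (FPAlg L) T) :
  exists c, fp_bar c = ginv (law (ev_ralg T)) (fp_bar a).
Proof.
apply: fp_bar_surj => g.
have /gop_morphV -> := fun a b => act_gop (B := ev_ralg T) a b g.
have /gop_morphV h := @glaw_nat _ _ (bg_val Gam) _ _ (weyl T g : chom (_ :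
  RAlgCat R) _).
by rewrite fp_bar_weyl; exact/esym/h.
Qed.

Definition fp_law (T : KAlgCat k) : group_law (@chom (KAlgCat k) (FPAlg L) T) :=
  group_law_pullback (@fp_bar_inj T) (@fp_law_mul T) (fp_law_one T) (@fp_law_inv
    T).

Lemma fp_bar_gop (T : kalg k) (a b : ahom (FPAlg L) T) :
  fp_bar (gop (fp_law T) a b) = gop (law (ev_ralg T)) (fp_bar a) (fp_bar b).
Proof. exact: (@group_law_pullbackE _ _ _ (@fp_bar T)). Qed.

Lemma fp_law_nat (T T' : KAlgCat k) (f : chom T T')
    (a b : @chom (KAlgCat k) (FPAlg L) T) :
  f \oc gop (fp_law T) a b = gop (fp_law T') (f \oc a) (f \oc b).
Proof.
apply: fp_bar_inj; rewrite fp_bar_gop !fp_bar_comp fp_bar_gop.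
exact: (@glaw_nat _ _ (bg_val Gam)).
Qed.

Definition fp_ob : GrpK :=
  @GrpOb (KAlgCat k) (@finite_etale gT k) (FPAlg L)
    (finite_etale_FP uE hilbert (A :=
      L) (grepP (bg_val Gam))) fp_law fp_law_nat.
End FixedPointObject.

Section FixedPointMorphism.
Variables (Gam Del : GrpR_BG) (f : chom Gam Del).

Lemma fp_bar_FPHom (T : kalg k) (a : ahom (FPAlg (rep_gralg Gam)) T) :
  fp_bar (ahom_comp a (FPHom (rep_grhom f))) =
  rhom_comp (fp_bar a) (yoneda (bgh_val f)).
Proof.
by apply: rhom_ext => l; rewrite fp_bar_comp !rhom_compE; congr (ev_rhom a _);
  exact: fp_unit_nat.
Qed.

Lemma fp_hom_mul (T : KAlgCat k)
  (a b : @chom (KAlgCat k) (FPAlg (rep_gralg Gam)) T) :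
  ahom_comp (gop (fp_law Gam T) a b) (FPHom (rep_grhom f)) =
  gop (fp_law Del T) (ahom_comp a (FPHom (rep_grhom f)))
    (ahom_comp b (FPHom (rep_grhom f))).
Proof.
apply: fp_bar_inj; rewrite fp_bar_gop !fp_bar_FPHom fp_bar_gop.
have := gnt_mul (bgh_val f) (fp_bar a) (fp_bar b).
rewrite !(yonedaE (bgh_val f)); exact.
Qed.

Definition fp_hom : chom (fp_ob Gam) (fp_ob Del) :=
  @GrpHom (KAlgCat k) (@finite_etale gT k) (fp_ob Gam) (fp_ob Del)
    (fun T a => ahom_comp a (FPHom (rep_grhom f)))
    (fun T T' h a => esym (@ccompA (KAlgCat k) _ _ _ _ h a (FPHom (rep_grhom
      f))))
    fp_hom_mul.
End FixedPointMorphism.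

Definition Phi : functor GrpR_BG GrpK.
Proof.
refine (@Functor GrpR_BG GrpK fp_ob fp_hom _ _) => [Gam|Gam Del Xi g f];
  apply: grp_hom_ext => T a; apply: fp_bar_inj.
- by rewrite fp_bar_FPHom; apply: rhom_ext.
- rewrite [RHS]fp_bar_FPHom [in RHS]fp_bar_FPHom [LHS]fp_bar_FPHom.
  apply: rhom_ext => l.
  exact: (congr1 (fun h : rhom _ _ => fp_bar a (h l))
    (yoneda_comp (bgh_val g) (bgh_val f))).
Defined.

Definition ciso_id (C : category) (A : C) : ciso A A :=
  CIso (ccomp1m (cidm A)) (ccomp1m (cidm A)).

Lemma EV_is_ev : is_ev EV.
Proof.
exists (fun S : GrpK => @ciso_id (RAlgCat R) (ev_ralg (grep S))).
split=> [S P i j Q i' j' ij ij'|S g|S T f].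
- have [kappa [ki kj]] := tensor_alg_ciso ij' (proj1 (box_alg_ev uE _ _) ij).
  exists kappa; split; [exact: ki | exact: kj |].
  rewrite /comul !ccompm1 [LHS](@glaw_nat _ _ (ev_grp S)).
  exact: (etrans (congr2 (gop _) ki kj) (esym (ev_gop i j))).
- exact: rhom_ext.
- exact: rhom_ext.
Qed.

Lemma Phi_is_FP : is_FP Phi.
Proof.
exists (fun Gam : GrpR_BG => @ciso_id (KAlgCat k) (FPAlg (rep_gralg Gam))).
split=> [Gam Q i j ij|Gam Del f]; last first.
  by apply: ahom_ext.
split.
  apply: (fp_tensor_box uE).
  have cE (h : grhom (rep_gralg Gam) Q) :
      rhom_comp (fp_counit Q) (ev_rhom (FPHom h)) =
      rhom_comp h (fp_counit (rep_gralg Gam)).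
    apply: rhom_ext => a; rewrite !rhom_compE -{1}[a]fp_counit_can.
    by rewrite fp_unit_nat fp_unit_can.
  rewrite !cE.
  have bc : bijective (rhom_lin (fp_counit (rep_gralg Gam))).
    by exists (fp_unit _); [exact: fp_counit_can | exact: fp_unit_can].
  exact: (@is_tensor_iso R _ (ralg_mod (ev_ralg (FPAlg (rep_gralg Gam)))) _
    (ralg_mod (ev_ralg (FPAlg (rep_gralg Gam)))) _ (ralg_mod Q) _ _
    (rhom_lin (fp_counit _)) (rhom_lin (fp_counit _)) idfun bc bc (@idfun_bij
      _)) ij.
(* The comultiplication is the product of the equivariant points [i] and [j], hence equivariant. *)
have dE g : rhom_comp (comul (A := bg_val Gam) (P := ga_alg Q : RAlgCat R) i j)
    (ga_act (rep_gralg Gam) g) =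
    rhom_comp (ga_act Q g) (comul (A := bg_val Gam) (P := ga_alg Q :
      RAlgCat R) i j).
  by apply: act_gop_equiv; apply: rhom_ext => l; rewrite !rhom_compE grhE.
pose d : grhom (rep_gralg Gam) Q :=
  GRHom (fun g x => congr1 (fun h : rhom _ _ => h x) (dE g)).
exists d => //; rewrite !ccompm1; apply: fp_bar_inj; rewrite [LHS]fp_bar_gop.
have barE (h : grhom (rep_gralg Gam) Q) : fp_bar (FPHom h) =
  rhom_comp (fp_unit Q) h.
  by apply: rhom_ext => l; rewrite /fp_bar !rhom_compE fp_unit_nat.
rewrite !barE; apply/esym.
exact: (@glaw_nat _ _ (bg_val Gam) _ _ (fp_unit Q : chom (_ :
  RAlgCat R) _) i j).
Qed.

(** The map S -> FP(S(G/e)) is determined by what it is at level G/e, the isomorphism of a ring with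
    its orbit maps, and evaluation is fully faithful. *)
Lemma theta_ex (S : GrpK) :
  exists c : @ciso (KAlgCat k) (grep S) (FPAlg (rep_gralg (ev_ob S))),
    ev_rhom (cito c) = fp_unit (rep_gralg (ev_ob S)).
Proof.
apply: (@ahom_bij _ _ _ uE (grep S) (FPAlg (rep_gralg (ev_ob S)))
  (fp_ciso (rep_gralg (ev_ob S)))) => g s.
exact: (fp_unit_weyl (A := rep_gralg (ev_ob S))).
Qed.

Definition theta (S : GrpK) := sval (cid (theta_ex S)).
Lemma thetaE S : ev_rhom (cito (theta S)) = fp_unit (rep_gralg (ev_ob S)).
Proof. exact: svalP (cid (theta_ex S)). Qed.

Lemma ev_comp_theta (S : GrpK) (T : kalg k)
    (a : ahom (FPAlg (rep_gralg (ev_ob S))) T) :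
  ev_rhom (ahom_comp a (cito (theta S))) = fp_bar a.
Proof. by rewrite ev_rhom_comp thetaE. Qed.

Lemma theta_mul (S : GrpK) (T : KAlgCat k)
    (a b : @chom (KAlgCat k) (FPAlg (rep_gralg (ev_ob S))) T) :
  gop (fp_law (ev_ob S) T) a b \oc cito (theta S) =
  gop (glaw S T) (a \oc cito (theta S)) (b \oc cito (theta S)).
Proof.
apply: (ev_rhom_inj uE); rewrite ev_gop !ev_comp_theta.
exact: (@fp_bar_gop (ev_ob S) T a b).
Qed.

Definition unit_iso (S : GrpK) : ciso (fcomp Phi EV S) (fid GrpK S) :=
  @grp_iso (KAlgCat k) (@finite_etale gT k) (fp_ob (ev_ob S)) S (theta S)
    (@theta_mul S).

Lemma unit_iso_nat (S T : GrpK) (f : chom S T) :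
  unit_iso T \oc fmap (fcomp Phi EV) f = f \oc unit_iso S.
Proof.
apply: grp_hom_ext => X a; rewrite [RHS](yonedaE f).
apply: (ev_rhom_inj uE).
rewrite [LHS]ev_comp_theta [LHS]fp_bar_FPHom [RHS]ev_rhom_comp.
by rewrite [in RHS]ev_comp_theta; apply: rhom_ext.
Qed.

(** The law on the left is built in two stages: points in B become maps from FP(L) to FP(Map(G, B)),
    and these become equivariant points of L. Naturality of the original law along [coind_eval]
    undoes both. *)
Lemma counit_mul (Gam : GrpR_BG) (B : RAlgCat R)
    (a b : @chom (RAlgCat R) (ev_ralg (FPAlg (rep_gralg Gam))) B) :
  gop (ev_law (fp_ob Gam) B) a b \oc cito (fp_ciso (rep_gralg Gam)) =
  gop (glaw (bg_val Gam) B) (a \oc cito (fp_ciso (rep_gralg Gam)))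
    (b \oc cito (fp_ciso (rep_gralg Gam))).
Proof.
rewrite -(coind_unadjK (S := fp_ob Gam) a) -(coind_unadjK (S := fp_ob Gam) b).
rewrite -coind_adj_gop.
move: (coind_unadj _) (coind_unadj _) => F' F.
have E (H : ahom (FPAlg (rep_gralg Gam)) (FPAlg (coind gT B))) :
    rhom_comp (coind_adj H) (fp_unit _) =
      rhom_comp (coind_eval gT B) (fp_bar H).
  exact: rhom_ext.
transitivity (rhom_comp (coind_eval gT B)
  (fp_bar (gop (fp_law Gam (FPAlg (coind gT B))) F F'))); first exact: E.
rewrite fp_bar_gop.
refine (etrans (@glaw_nat _ _ (bg_val Gam) _ _
  (coind_eval gT B : chom (_ : RAlgCat R) _) (fp_bar F) (fp_bar F')) _).
exact: (congr2 (gop _) (esym (E F)) (esym (E F'))).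
Qed.

Definition counit_grp_iso (Gam : GrpR_BG) :
    @ciso GrpR (ev_grp (fp_ob Gam)) (bg_val Gam) :=
  @grp_iso (RAlgCat R) (@finite_etale_ring R) (ev_grp (fp_ob Gam)) (bg_val Gam)
    (fp_ciso (rep_gralg Gam)) (@counit_mul Gam).

Lemma counit_equiv (Gam : GrpR_BG) g :
  cito (counit_grp_iso Gam) \oc bg_act (ev_ob (fp_ob Gam)) g =
  bg_act Gam g \oc cito (counit_grp_iso Gam).
Proof.
apply: grp_hom_ext => B a; rewrite [RHS](yonedaE (bg_act Gam g)).
apply: rhom_ext => l.
exact: (congr1 a (esym (fp_unit_weyl (A := rep_gralg Gam) g l))).
Qed.

Definition counit_iso (Gam : GrpR_BG) : ciso (fcomp EV Phi Gam) (fid _ Gam) :=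
  @bg_iso gT GrpR (ev_ob (fp_ob Gam)) Gam _ (counit_equiv Gam).

Lemma counit_iso_nat (Gam Del : GrpR_BG) (f : chom Gam Del) :
  counit_iso Del \oc fmap (fcomp EV Phi) f = f \oc counit_iso Gam.
Proof.
apply: bg_hom_ext; apply: grp_hom_ext => B a.
rewrite [RHS](yonedaE (bgh_val f)); apply: rhom_ext => l.
exact: (congr1 a (fp_unit_nat (rep_grhom f) l)).
Qed.

Lemma EV_Phi_quasi_inverse : quasi_inverse EV Phi.
Proof.
split; first by exists unit_iso; exact: unit_iso_nat.
by exists counit_iso; exact: counit_iso_nat.
Qed.
End Equivalence.

Theorem corollary7 (gT : finGroupType) (R : comPzRingType)
  (cardG_unit : exists u : R, #|gT|%:R * u = 1)
  (hilbert : hilbert_basis (const_tambara gT R)) :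
  exists (EV : functor (GrpFet (const_tambara gT R)) (BG gT (GrpFetRing R)))
         (Phi : functor (BG gT (GrpFetRing R)) (GrpFet (const_tambara gT R))),
    [/\ is_ev EV, is_FP Phi & quasi_inverse EV Phi].
Proof.
have [u uE] := cardG_unit.
exists (EV uE), (Phi uE hilbert); split.
- exact: EV_is_ev.
- exact: Phi_is_FP.
- exact: EV_Phi_quasi_inverse.
Qed.
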